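(* For $0<\alpha<1$ and $0<\rho<1$, the measure $\nu_{\alpha,\rho}$ has a positive analytic density on $\mathbf{R}$ given by $$\psi_{\alpha,\rho}(x)=\frac1\pi(\sin\theta)^{1+\frac1\alpha}\bigl(\sin[\alpha\rho\pi+(1-\alpha)\theta]\bigr)^{-\frac1\alpha},$$ where $\theta\in(0,\pi)$ is the only solution of the equation $$x=(\sin\theta)^{-\frac1\alpha}\bigl(\sin[\alpha\rho\pi+(1-\alpha)\theta]\bigr)^{\frac1\alpha-1}\sin[\alpha\rho\pi-\alpha\theta].$$ The support of the measure $\nu_{\alpha,0}$ is the interval $(-\infty,-\alpha(1-\alpha)^{\frac1\alpha-1}]$, and $\nu_{\alpha,0}$ has an analytic density on this support given by the formula $$\psi_{\alpha,0}(x)=\frac1\pi(\sin\theta)^{1+\frac1\alpha}(\sin(1-\alpha)\theta)^{-\frac1\alpha},$$ where $\theta\in(0,\pi)$ is the only solution of the equation $$x=-(\sin\theta)^{-\frac1\alpha}(\sin(1-\alpha)\theta)^{\frac1\alpha-1}\sin\alpha\theta.$$ The measure $\nu_{\alpha,1}$ is the image of $\nu_{\alpha,0}$ by the map $t\mapsto-t$.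
   Context: For a Borel probability measure $\mu$ on $\mathbf{R}$ let $G_\mu(z)=\int_{-\infty}^\infty\frac{1}{z-t}\,d\mu(t)$ and $F_\mu=1/G_\mu$ on $\mathbf{C}^+=\{\Im z>0\}$. For every $\eta>0$ there is $M>0$ such that $F_\mu$ has an analytic inverse $F_\mu^{-1}$ on $\Gamma_{\eta,M}=\{x+iy:y>M,|x|<\eta y\}$ with values in $\mathbf{C}^+$ ($F_\mu(F_\mu^{-1}(z))=z$, $F_\mu^{-1}(z)/z\to1$ as $z\to\infty$). The Voiculescu transform is $\phi_\mu(z)=F_\mu^{-1}(z)-z$; it determines $\mu$. For $0<\alpha<1$ and $0\le\rho\le1$, $\nu_{\alpha,\rho}$ denotes the probability measure on $\mathbf{R}$ (stable for free additive convolution) whose Voiculescu transform is $\phi(z)=-e^{i\alpha\rho\pi}z^{-\alpha+1}$, with the principal branch of the power on $\mathbf{C}^+$.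
   Formalization: For ρ=0, the analyticity of the density and the formula with θ are asserted only on the interior of the support, since at the right endpoint −α(1−α)^{1/α−1} the equation has no solution θ in (0,π). *)

(* Defs.v *)
From HB Require Import structures.
From mathcomp Require Import all_boot all_order all_algebra.
From mathcomp Require Import all_classical all_reals all_analysis.
From mathcomp Require Import complex.

Set Implicit Arguments.
Unset Strict Implicit.
Unset Printing Implicit Defensive.
Import Order.TTheory GRing.Theory Num.Theory.
Import numFieldNormedType.Exports.

Local Open Scope classical_set_scope.
Local Open Scope ring_scope.
Local Open Scope complex_scope.

(* Used both for K = R and for K = R[i]. *)
Definition analytic_at (K : numFieldType) (f : K -> K) (x0 : K) : Prop :=
  exists a : nat -> K,
    \forall x \near x0, series (fun n => a n * (x - x0) ^+ n) @ \oo --> f x.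

Definition analytic_on (K : numFieldType) (D : set K) (f : K -> K) : Prop :=
  forall x, D x -> analytic_at f x.

Section Complex.
Variable R : realType.

Definition expi (t : R) : R[i] := cos t +i* sin t.

(* The norm `|z| lives in R[i]; this is its value in R. *)
Definition cmod (z : R[i]) : R := complex.Re `|z|.

(* Principal argument, in ]-pi, pi] for z != 0. *)
Definition Carg (z : R[i]) : R :=
  let t := acos (complex.Re z / cmod z) in if 0 <= complex.Im z then t else - t.

Definition cpow (z : R[i]) (s : R) : R[i] :=
  (cmod z `^ s)%:C * expi (s * Carg z).

Definition upper_half_plane : set R[i] := [set z | 0 < complex.Im z].

Definition truncated_cone (eta M : R) : set R[i] :=
  [set z | M < complex.Im z /\ `|complex.Re z| < eta * complex.Im z].

(* Neighbourhoods of infinity inside D. *)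
Definition infty_in (D : set R[i]) : set_system R[i] :=
  filter_from [set: R] (fun r => D `&` [set z | r < cmod z]).

End Complex.

Section FreeProbability.
Variable R : realType.
Implicit Type mu : probability (measurableTypeR R) R.

(* The integrand is bounded for z in the upper half-plane, so that both real
   integrals are finite there. *)
Definition cauchy_transform mu (z : R[i]) : R[i] :=
  (\int[mu]_t complex.Re (z - t%:C)^-1)%R
    +i* (\int[mu]_t complex.Im (z - t%:C)^-1)%R.

Definition F_transform mu (z : R[i]) : R[i] := (cauchy_transform mu z)^-1.

Definition is_F_inverse mu (eta M : R) (Finv : R[i] -> R[i]) : Prop :=
  let Gamma := truncated_cone eta M in
  [/\ analytic_on Gamma Finv,
      forall z, Gamma z -> upper_half_plane (Finv z),
      forall z, Gamma z -> F_transform mu (Finv z) = z &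
      (fun z => Finv z / z : R[i]^o) @ infty_in Gamma --> (1 : R[i]^o)].

Definition has_voiculescu_transform mu (phi : R[i] -> R[i]) : Prop :=
  forall eta : R, 0 < eta -> exists2 M : R, 0 < M &
  exists2 Finv, is_F_inverse mu eta M Finv &
    forall z, truncated_cone eta M z -> phi z = Finv z - z.

(* mu is the measure nu_{alpha, rho}, with Voiculescu transform
   - e^(i alpha rho pi) z^(1 - alpha). *)
Definition is_free_stable (alpha rho : R) mu : Prop :=
  has_voiculescu_transform mu
    (fun z => - (expi (alpha * rho * pi) * cpow z (1 - alpha))).

End FreeProbability.

Section Densities.
Variable R : realType.
Implicit Type mu : probability (measurableTypeR R) R.

Definition measure_support mu : set R :=
  [set x | forall U : set R, open U -> U x -> (0 < mu U)%E].

(* mu is carried by D and has density f there; the values of f off D are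
   irrelevant. *)
Definition has_density_on (D : set R) (f : R -> R) mu : Prop :=
  [/\ measurable_fun (D : set (measurableTypeR R)) (f : measurableTypeR R -> R),
      forall x, D x -> 0 <= f x &
      forall A : set (measurableTypeR R), measurable A ->
        mu A = (\int[@lebesgue_measure R]_(x in A `&` D) (f x)%:E)%E].

End Densities.

(* Main.v *)
Require Import Defs.
From HB Require Import structures.
From mathcomp Require Import all_boot all_order all_algebra.
From mathcomp Require Import all_classical all_reals all_analysis.
From mathcomp Require Import measurable_realfun complex ring lra zify.

(** If [F = 1 / G] is the reciprocal Cauchy transform of the measure, the
    hypothesis gives [F (H (i y)) = i y] for large [y], where
    [H z = z - expi (alpha rho pi) z^(1 - alpha)].  Differentiating along this
    curve yields a quadratic differential equation for [G] with polynomial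
    coefficients; [G] has a power series of radius [Im w] around every point [w]
    of the upper half-plane, so the equation propagates to the whole half-plane,
    where it says that [(F w - w) F(w)^(alpha - 1)] is constant, i.e.
    [H (F w) = w].  In polar coordinates [F w = r e^(i theta)] this bounds
    [- Im G = sin theta / r] and identifies its boundary values with
    [pi * psi], so that Stieltjes inversion gives the density.  The same
    differential equation has a convergent power series solution at each boundary
    point; by injectivity of [theta |-> x] its imaginary part is [- pi * psi], so
    [psi] is analytic. *)

Set Implicit Arguments.
Unset Strict Implicit.
Unset Printing Implicit Defensive.
Import Order.TTheory GRing.Theory Num.Theory.
Import numFieldNormedType.Exports.
Local Open Scope classical_set_scope.
Local Open Scope ring_scope.
Local Open Scope complex_scope.

(** * Real and imaginary parts, and the real-valued modulus *)

Section cplx.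
Variable R : realType.
Local Notation C := R[i].
Implicit Types (z w : C).
Local Notation Re := (@complex.Re R).
Local Notation Im := (@complex.Im R).

(** The hypothesis controls F only on the image of a cone, whereas the density needs F near the real
    line. The relation H (F w) = w contains a branch of a power and cannot be compared
    coefficientwise. Differentiating F - w = c F^(1 - alpha) and eliminating c gives F' (alpha F +
    (1 - alpha) w) = F, that is alpha G' + (1 - alpha) w G G' + G^2 = 0 for G = 1 / F. No power and
    no constant is left, so Cauchy products turn the left side into a power series, and zeros
    accumulating at one centre kill it on a whole disc. The constant c is recovered from a point of
    the known curve by integrating back along a segment. No limit of G at the real line is assumed:
    for fixed x <> 0 the polar coordinates of F stay in a compact rectangle, and every cluster point
    gives the same value of sin theta / r. The same cluster points show that each admissible x <> 0
    has an angle theta, so surjectivity of theta |-> x comes from the measure and not from limits of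
    the formula. Reflection turns rho = 1 into rho = 0, and two measures with the same density
    agree. *)

Lemma ReD z w : Re (z + w) = Re z + Re w. Proof. by case: z; case: w. Qed.
Lemma ImD z w : Im (z + w) = Im z + Im w. Proof. by case: z; case: w. Qed.
Lemma ReN z : Re (- z) = - Re z. Proof. by case: z. Qed.
Lemma ImN z : Im (- z) = - Im z. Proof. by case: z. Qed.
Lemma ReM z w : Re (z * w) = Re z * Re w - Im z * Im w.
Proof. by case: z; case: w. Qed.
Lemma ImM z w : Im (z * w) = Re z * Im w + Im z * Re w.
Proof. by case: z; case: w. Qed.
Lemma ReV z : Re z^-1 = Re z / (Re z ^+ 2 + Im z ^+ 2).
Proof. by case: z. Qed.
Lemma ImV z : Im z^-1 = - Im z / (Re z ^+ 2 + Im z ^+ 2).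
Proof. by case: z => a b; rewrite /= mulNr. Qed.
Definition cE := (ReD, ImD, ReN, ImN, ReM, ImM).

Lemma complexP z w : Re z = Re w -> Im z = Im w -> z = w.
Proof. by case: z; case: w => a b c d /= -> ->. Qed.

Lemma Re_sum I (r : seq I) (P : pred I) (f : I -> C) :
  Re (\sum_(i <- r | P i) f i) = \sum_(i <- r | P i) Re (f i).
Proof. by elim/big_rec2 : _ => // i y x _ <-; rewrite ReD. Qed.
Lemma Im_sum I (r : seq I) (P : pred I) (f : I -> C) :
  Im (\sum_(i <- r | P i) f i) = \sum_(i <- r | P i) Im (f i).
Proof. by elim/big_rec2 : _ => // i y x _ <-; rewrite ImD. Qed.

Lemma cmodE z : cmod z = Num.sqrt (Re z ^+ 2 + Im z ^+ 2).
Proof. by rewrite /cmod normc_def. Qed.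

Lemma cmod_sqr z : cmod z ^+ 2 = Re z ^+ 2 + Im z ^+ 2.
Proof. by rewrite cmodE sqr_sqrtr // addr_ge0 // sqr_ge0. Qed.

Lemma cmod_ge0 z : 0 <= cmod z.
Proof. by rewrite cmodE sqrtr_ge0. Qed.

Lemma cmod_normc z : cmod z = Normc.normc z.
Proof. by case: z. Qed.

Lemma cmodM z w : cmod (z * w) = cmod z * cmod w.
Proof. by rewrite !cmod_normc Normc.normcM. Qed.
Lemma cmodV z : cmod z^-1 = (cmod z)^-1.
Proof. by rewrite !cmod_normc Normc.normcV. Qed.
Lemma cmodD z w : cmod (z + w) <= cmod z + cmod w.
Proof. by rewrite !cmod_normc le_normcD. Qed.
Lemma cmodN z : cmod (- z) = cmod z.
Proof. by rewrite !cmod_normc normcN. Qed.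
Lemma cmodB z w : cmod (z - w) <= cmod z + cmod w.
Proof. by rewrite -(cmodN w) cmodD. Qed.
Lemma cmod0 : cmod (0 : C) = 0.
Proof. by rewrite cmodE /= expr0n addr0 sqrtr0. Qed.
Lemma cmod1 : cmod (1 : C) = 1.
Proof. by rewrite cmodE /= expr0n addr0 expr1n sqrtr1. Qed.
Lemma cmodX z n : cmod (z ^+ n) = cmod z ^+ n.
Proof. by elim: n => [|n IH]; rewrite ?expr0 ?cmod1 // !exprS cmodM IH. Qed.
Lemma cmodR (x : R) : cmod x%:C = `|x|.
Proof. by rewrite cmodE /= expr0n addr0 sqrtr_sqr. Qed.
Lemma cmod_eq0 z : cmod z = 0 -> z = 0.
Proof. by rewrite cmod_normc; exact: Normc.eq0_normc. Qed.
Lemma cmod_gt0 z : z != 0 -> 0 < cmod z.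
Proof.
move=> z0; rewrite lt_neqAle cmod_ge0 andbT eq_sym.
by apply/eqP => /cmod_eq0; exact/eqP.
Qed.
Lemma cmod_sum I (r : seq I) (P : pred I) (f : I -> C) :
  cmod (\sum_(i <- r | P i) f i) <= \sum_(i <- r | P i) cmod (f i).
Proof.
elim/big_rec2 : _ => [|i y x _ h]; first by rewrite cmod0.
by apply: (le_trans (cmodD _ _)); rewrite lerD2l.
Qed.

Lemma Re_le z : `|Re z| <= cmod z.
Proof. by rewrite cmodE -sqrtr_sqr ler_wsqrtr // lerDl sqr_ge0. Qed.
Lemma Im_le z : `|Im z| <= cmod z.
Proof. by rewrite cmodE -sqrtr_sqr ler_wsqrtr // lerDr sqr_ge0. Qed.
Lemma cmod_le z : cmod z <= `|Re z| + `|Im z|.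
Proof.
rewrite -[leRHS]ger0_norm ?addr_ge0 // -sqrtr_sqr cmodE ler_wsqrtr //.
rewrite sqrrD !real_normK ?num_real // -subr_ge0.
by rewrite (_ : _ - _ = `|Re z| * `|Im z| *+ 2) ?mulrn_wge0 ?mulr_ge0 //; ring.
Qed.

(** * Limits of complex-valued functions *)

Definition ccvg {T} (F : set_system T) (u : T -> C) (l : C) : Prop :=
  (fun x => Re (u x)) @ F --> Re l /\ (fun x => Im (u x)) @ F --> Im l.

Section ccvg.
Context {T : Type} {F : set_system T} {FF : ProperFilter F}.
Implicit Types (u v : T -> C).

Lemma ccvg_cst (l : C) : ccvg F (fun=> l) l.
Proof. by split; exact: cvg_cst. Qed.

Lemma ccvgD u v k l : ccvg F u k -> ccvg F v l ->
  ccvg F (fun x => u x + v x) (k + l).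
Proof.
move=> [u1 u2] [v1 v2]; split.
  rewrite ReD; under eq_fun do rewrite ReD; exact: cvgD.
rewrite ImD; under eq_fun do rewrite ImD; exact: cvgD.
Qed.

Lemma ccvgM u v k l : ccvg F u k -> ccvg F v l ->
  ccvg F (fun x => u x * v x) (k * l).
Proof.
move=> [u1 u2] [v1 v2]; split.
  rewrite ReM; under eq_fun do rewrite ReM; apply: cvgB; exact: cvgM.
rewrite ImM; under eq_fun do rewrite ImM; apply: cvgD; exact: cvgM.
Qed.

Lemma ccvg_unique u k l : ccvg F u k -> ccvg F u l -> k = l.
Proof.
move=> [u1 u2] [v1 v2]; apply: complexP.
  exact: (cvg_unique _ u1 v1).
exact: (cvg_unique _ u2 v2).
Qed.

(** The bridge between two forms of convergence: [cmod_le] bounds the modulus by both parts, [Re_le]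
    and [Im_le] bound each part by the modulus. Sums and products use components, error estimates
    use the modulus. *)
Lemma ccvg_cmod u k : ccvg F u k <-> cmod (u x - k) @[x --> F] --> (0 : R).
Proof.
split=> [[u1 u2]|h].
  apply: (squeeze_cvgr (f := fun=> 0)
    (h := fun x => `|Re (u x) - Re k| + `|Im (u x) - Im k|)).
  - near=> x; rewrite cmod_ge0 /=; apply: (le_trans (cmod_le _)).
    by rewrite !cE.
  - exact: cvg_cst.
  - rewrite -[X in _ --> X]addr0; apply: cvgD.
      by apply/norm_cvg0P; apply/subr_cvg0.
    by apply/norm_cvg0P; apply/subr_cvg0.
split; apply/subr_cvg0; apply/norm_cvg0P;
  apply: (squeeze_cvgr (f := fun=> 0) _ _ h); try exact: cvg_cst.
  near=> x; rewrite normr_ge0 /=; apply: (le_trans _ (Re_le _)).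
  by rewrite !cE.
near=> x; rewrite normr_ge0 /=; apply: (le_trans _ (Im_le _)).
by rewrite !cE.
Unshelve. all: by end_near. Qed.

Lemma ccvg_bound u k (e : T -> R) : (\forall x \near F, cmod (u x - k) <= e x) ->
  e @ F --> (0 : R) -> ccvg F u k.
Proof.
move=> h e0; apply/ccvg_cmod; apply: (squeeze_cvgr _ _ e0); last first.
  exact: cvg_cst.
by near=> x; rewrite cmod_ge0 /=; near: x.
Unshelve. all: by end_near. Qed.

Lemma ccvg_near u v k : (\forall x \near F, u x = v x) -> ccvg F u k -> ccvg F v k.
Proof.
move=> uv /ccvg_cmod hu; apply: (ccvg_bound _ hu).
by near=> x; rewrite (near uv x).
Unshelve. all: by end_near. Qed.

End ccvg.

End cplx.

Section psum.
Variable R : realType.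
Local Notation C := R[i].
Implicit Types (a b : nat -> C) (s : C).
Local Notation Re := (@complex.Re R).
Local Notation Im := (@complex.Im R).

(** * Absolutely convergent complex power series *)

Definition psum a s (l : C) : Prop :=
  ccvg \oo (fun N => \sum_(n < N) a n * s ^+ n) l /\
  exists B : R, forall N, \sum_(n < N) cmod (a n * s ^+ n) <= B.

Definition cauchy_prod a b n : C := \sum_(k < n.+1) a k * b (n - k)%N.

Lemma psum_unique a s k l : psum a s k -> psum a s l -> k = l.
Proof. by move=> [h _] [h' _]; exact: (ccvg_unique h h'). Qed.

Lemma psumD a b s k l : psum a s k -> psum b s l ->
  psum (fun n => a n + b n) s (k + l).
Proof.
move=> [h1 [B1 hB1]] [h2 [B2 hB2]]; split.
  under eq_fun do (under eq_bigr do rewrite mulrDl); under eq_fun do rewrite big_split.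
  exact: ccvgD.
exists (B1 + B2) => N; apply: le_trans (lerD (hB1 N) (hB2 N)).
by rewrite -big_split ler_sum // => i _; rewrite mulrDl cmodD.
Qed.

Lemma psumZ a s k c : psum a s k -> psum (fun n => c * a n) s (c * k).
Proof.
move=> [h1 [B1 hB1]]; split.
  under eq_fun do (under eq_bigr do rewrite -mulrA); under eq_fun do rewrite -mulr_sumr.
  by apply: ccvgM => //; exact: ccvg_cst.
exists (cmod c * B1) => N; apply: le_trans (ler_wpM2l (cmod_ge0 _) (hB1 N)).
by rewrite mulr_sumr ler_sum // => i _; rewrite -mulrA cmodM.
Qed.

Lemma psum_finite a s m : (forall n, (m <= n)%N -> a n = 0) ->
  psum a s (\sum_(n < m) a n * s ^+ n).
Proof.
move=> a0.
have H (T : nmodType) (f : C -> T) : f 0 = 0 -> forall N,  (m <= N)%N ->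
    \sum_(n < N) f (a n * s ^+ n) = \sum_(n < m) f (a n * s ^+ n).
  move=> f0 N mN; rewrite -!(big_mkord predT (fun n => f (a n * s ^+ n))).
  rewrite (big_cat_nat (leq0n m) mN) //= [X in _ + X]big_nat_cond [X in _ + X]big1 ?addr0 //.
  by move=> i /andP[/andP[mi _] _]; rewrite a0 // mul0r f0.
split.
  apply: (@ccvg_bound _ _ _ _ _ _ (fun=> 0)); last exact: cvg_cst.
  near=> N; rewrite (H _ id) // ?subrr ?cmod0 //; near: N; exact: nbhs_infty_ge.
exists (\sum_(n < m) cmod (a n * s ^+ n)) => N.
case: (leqP m N) => mN; first by rewrite (H _ (@cmod R)) // cmod0.
rewrite -!(big_mkord predT (fun n => cmod (a n * s ^+ n))).
rewrite [leRHS](@big_cat_nat _ _ _ N 0 m) //=; last exact: ltnW.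
by rewrite lerDl sumr_ge0 // => i _; exact: cmod_ge0.
Unshelve. all: by end_near. Qed.

Lemma triangle_sum (K : pzSemiRingType) (A B : nat -> K) N :
  \sum_(n < N) \sum_(k < n.+1) A k * B (n - k)%N
  = \sum_(i < N) A i * \sum_(j < N - i) B j.
Proof.
elim: N => [|N IH]; first by rewrite !big_ord0.
rewrite big_ord_recr IH /= [RHS]big_ord_recr /= subSnn big_ord1.
rewrite [X in _ + X]big_ord_recr /= subnn addrA; congr (_ + _).
rewrite -big_split; apply: eq_bigr => i _ /=.
by rewrite subSn 1?ltnW // big_ord_recr /= mulrDr.
Qed.

Lemma nondecr_sum (A : nat -> R) : (forall n, 0 <= A n) ->
  forall m n, (m <= n)%N -> \sum_(i < m) A i <= \sum_(i < n) A i.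
Proof.
move=> A0 m n mn; rewrite -!(big_mkord predT A) [leRHS](big_cat_nat (leq0n m) mn) //=.
by rewrite lerDl sumr_ge0.
Qed.

Lemma bounded_sum_cvg (A : nat -> R) B : (forall n, 0 <= A n) ->
  (forall N, \sum_(i < N) A i <= B) ->
  cvgn (fun N => \sum_(i < N) A i).
Proof.
move=> A0 hB; apply: nondecreasing_is_cvgn.
  by move=> m n mn; exact: nondecr_sum.
by exists B => _ [n _ <-].
Qed.

Lemma half_cvg_infty : (fun n => n./2) @ \oo --> \oo.
Proof.
move=> A [N _ h]; exists N.*2 => // n /= hn; apply: h => /=.
by rewrite -[N]doubleK half_leq.
Qed.

Lemma cauchy_prodX a b s n :
  cauchy_prod a b n * s ^+ n
  = cauchy_prod (fun n => a n * s ^+ n) (fun n => b n * s ^+ n) n.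
Proof.
rewrite /cauchy_prod mulr_suml; apply: eq_bigr => i _.
rewrite mulrACA -exprD subnKC // -ltnS; exact: ltn_ord.
Qed.

(** The partial sums of the product run over the triangle i + j < N, the product of partial sums
    over the square i, j < N. The absolute bounds carried by [psum] make the difference negligible
    and pass to the product. *)
Lemma psumM a b s k l : psum a s k -> psum b s l ->
  psum (cauchy_prod a b) s (k * l).
Proof.
move=> [h1 [B1 hB1]] [h2 [B2 hB2]].
pose A n := a n * s ^+ n; pose B n := b n * s ^+ n.
pose al n := cmod (A n); pose be n := cmod (B n).
have al0 n : 0 <= al n by exact: cmod_ge0.
have be0 n : 0 <= be n by exact: cmod_ge0.
pose T N := \sum_(i < N) al i * \sum_(j < N - i) be j.
pose sa N := \sum_(i < N) al i; pose sb N := \sum_(i < N) be i.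
have Tle N : T N <= sa N * sb N.
  rewrite /sa mulr_suml; apply: ler_sum => i _; apply: ler_wpM2l => //.
  by apply: nondecr_sum => //; exact: leq_subr.
have absT N : \sum_(n < N) cmod (cauchy_prod a b n * s ^+ n) <= T N.
  rewrite /T -triangle_sum; apply: ler_sum => n _.
  rewrite cauchy_prodX; apply: (le_trans (cmod_sum _ _ _)).
  by apply: ler_sum => i _; rewrite cmodM.
split; last first.
  exists (B1 * B2) => N; apply: (le_trans (absT N)); apply: (le_trans (Tle N)).
  by apply: ler_pM; [exact: sumr_ge0|exact: sumr_ge0|exact: hB1|exact: hB2].
have hsa := bounded_sum_cvg al0 hB1; have hsb := bounded_sum_cvg be0 hB2.
pose la := limn sa; pose lb := limn sb.
have hsa' : sa n @[n --> \oo] --> la by exact: hsa.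
have hsb' : sb n @[n --> \oo] --> lb by exact: hsb.
have main : ccvg \oo (fun N => (\sum_(n < N) A n) * (\sum_(n < N) B n)) (k * l).
  exact: ccvgM.
have diff : ccvg \oo (fun N => \sum_(n < N) cauchy_prod a b n * s ^+ n
    - (\sum_(n < N) A n) * (\sum_(n < N) B n)) 0.
  apply: (@ccvg_bound _ _ _ _ _ _ (fun N => sa N * sb N - sa N./2 * sb N./2)).
    near=> N; rewrite subr0.
    under eq_bigr do rewrite cauchy_prodX.
    rewrite triangle_sum mulr_suml -sumrB.
    apply: (le_trans (cmod_sum _ _ _)).
    (* The square i, j < N / 2 lies inside the triangle, so the pairs left over weigh at most the
       large square minus the small one, and both tend to the same limit. *)
    apply: (@le_trans _ _ (sa N * sb N - T N)); last first.
      rewrite lerD2l lerN2 /sa mulr_suml /T.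
      rewrite [leRHS](_ : _ = \sum_(0 <= i < N) al i * \sum_(j < N - i) be j);
        last by rewrite big_mkord.
      rewrite -(big_mkord predT (fun i => al i * sb N./2)).
      have hN : (N./2 <= N)%N by lia.
      rewrite [leRHS](big_cat_nat (leq0n _) hN) //= -[leLHS]addr0 lerD //; last first.
        by apply: sumr_ge0 => i _; rewrite mulr_ge0 // sumr_ge0.
      rewrite big_nat_cond [leRHS]big_nat_cond; apply: ler_sum => i.
      rewrite andbT => /andP[_ hi]; apply: ler_wpM2l => //.
      apply: nondecr_sum => //.
      by lia.
    rewrite /sa mulr_suml /T -sumrB; apply: ler_sum => i _.
    rewrite -mulrBr -mulrBr cmodM; apply: ler_wpM2l; first exact: al0.
    rewrite -(cmodN (_ - _)) opprB.
    have iN : (N - i <= N)%N by exact: leq_subr.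
    have E (K : zmodType) (f : nat -> K) :
        \sum_(j < N) f j - \sum_(j < N - i) f j = \sum_(N - i <= j < N) f j.
      rewrite -!(big_mkord predT f) (big_cat_nat (leq0n _) iN) /=.
      by rewrite addrAC subrr add0r.
    by rewrite /sb !E; exact: cmod_sum.
  rewrite -(subrr (la * lb)); apply: cvgB; first exact: cvgM.
  apply: cvgM.
    exact: (cvg_comp _ _ half_cvg_infty hsa').
  exact: (cvg_comp _ _ half_cvg_infty hsb').
have := ccvgD diff main; rewrite add0r; under eq_fun do rewrite subrK.
exact.
Unshelve. all: by end_near. Qed.

Lemma psum_coef_bound a s l : psum a s l ->
  exists2 B : R, 0 <= B & forall n, cmod (a n) * cmod s ^+ n <= B.
Proof.
move=> [_ [B hB]]; exists B => [|n]; first by have := hB 0; rewrite big_ord0.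
rewrite -cmodX -cmodM; apply: le_trans (hB n.+1).
by rewrite big_ord_recr /= lerDr sumr_ge0 // => i _; exact: cmod_ge0.
Qed.

(** If the coefficients below n vanish, a zero s gives |a_n| |s|^n <= M |s|^(n+1), hence |a_n| <= M
    |s| with |s| arbitrarily small. Convergence at r bounds the coefficients geometrically. *)
Lemma psum_zero_coef a r l : r != 0 -> psum a r l ->
  (forall e, 0 < e -> exists s, [/\ s != 0, cmod s < e & psum a s 0]) ->
  forall n, a n = 0.
Proof.
move=> r0 har hz; have [B B0 hB] := psum_coef_bound har.
have q0 := cmod_gt0 r0; set q := cmod r in q0 hB.
suff H : forall n, (forall k, (k < n)%N -> a k = 0) -> a n = 0.
  by elim/ltn_ind => n IH; exact: H.
move=> n an0; apply: cmod_eq0; apply/eqP; rewrite eq_le cmod_ge0 andbT.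
apply/ler_addgt0Pl => e e0; rewrite addr0.
(* Tail constant: |a_k| <= B / q^k, and a ratio p / q < 1/2 makes the geometric factor at most 2. In
   [d], the term q / 2 secures this ratio and e / (M + 1) makes M p <= e. *)
pose M := 2 * B / q ^+ n.+1.
have M0 : 0 <= M by rewrite divr_ge0 // ?mulr_ge0 // exprn_ge0 // ltW.
pose d := Num.min (q / 2) (e / (M + 1)).
have d0 : 0 < d by rewrite lt_min !divr_gt0 // ltr_wpDl.
have [s [s0 sd hs]] := hz d d0.
have p0 := cmod_gt0 s0; set p := cmod s in p0 sd.
have pq : p / q < 2^-1.
  rewrite ltr_pdivrMr // mulrC.
  by apply: (lt_le_trans sd); rewrite /d ge_min lexx.
have pq0 : 0 < p / q by rewrite divr_gt0.
have key : cmod (a n) * p ^+ n <= M * p ^+ n.+1.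
  have [hc _] := hs.
  have /ccvg_cmod hc' : ccvg \oo (fun N => \sum_(k < N) a k * s ^+ k) 0 by [].
  have bnd N : (n < N)%N ->
    cmod (a n) * p ^+ n <= cmod (\sum_(k < N) a k * s ^+ k - 0) + M * p ^+ n.+1.
    move=> nN; rewrite subr0 -(big_mkord predT (fun k => a k * s ^+ k)).
    rewrite (big_cat_nat (leq0n _) (ltnW nN)) /= big_nat_cond big1 ?add0r; last first.
      by move=> k /andP[/andP[_ kn] _]; rewrite an0 // mul0r.
    rewrite big_ltn //; set S := \sum_(_ <= _ < _) _.
    have hS : cmod S <= M * p ^+ n.+1.
      apply: (le_trans (cmod_sum _ _ _)).
      apply: (@le_trans _ _ (\sum_(n.+1 <= k < N) B * (p / q) ^+ k)).
        apply: ler_sum => k _; rewrite cmodM cmodX expr_div_n mulrA.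
        by rewrite ler_pdivlMr ?exprn_gt0 // mulrAC ler_wpM2r // exprn_ge0 // ltW.
      rewrite -mulr_sumr -[n.+1]add0n big_addn.
      under eq_bigr do rewrite exprD.
      rewrite -mulr_suml big_mkord.
      have hg m : \sum_(i < m) (p / q) ^+ i <= 2.
        have h1 : (1 - p / q) * \sum_(i < m) (p / q) ^+ i = 1 - (p/q) ^+ m.
          rewrite -[in RHS](expr1n _ m) subrXX; congr (_ * _).
          by apply: eq_bigr => i _; rewrite expr1n mul1r.
        have h2 : 0 <= (p / q) ^+ m by rewrite exprn_ge0 // ltW.
        rewrite -(ler_pM2l (_ : 0 < 1 - p / q)); last by lra.
        by rewrite h1; lra.
      rewrite /M add0n expr_div_n [leRHS](_ : _ = B * (2 * (p ^+ n.+1 / q ^+ n.+1)));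
        last by ring.
      by rewrite ler_wpM2l // ler_wpM2r // divr_ge0 // exprn_ge0 // ltW.
    rewrite -[X in X * _ <= _]/(cmod (a n)) -cmodX -cmodM.
    rewrite -[X in cmod X <= _](addrK S).
    by apply: (le_trans (cmodB _ _)); rewrite lerD2l.
  rewrite -[leRHS]add0r.
  have hcv : (cmod (\sum_(k < N) a k * s ^+ k - 0) + M * p ^+ n.+1)
      @[N --> \oo] --> 0 + M * p ^+ n.+1.
    by apply: cvgD; [exact: hc'|exact: cvg_cst].
  by apply: (cvgr_to_ge hcv); exists n.+1 => // N /= nN; exact: bnd.
move: key; rewrite exprS mulrA ler_pM2r ?exprn_gt0 // => key.
apply: (le_trans key); apply: (@le_trans _ _ (M * (e / (M + 1)))).
  by rewrite ler_wpM2l // ltW // (lt_le_trans sd) // /d ge_min lexx orbT.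
by rewrite mulrA ler_pdivrMr ?ltr_wpDl // mulrDr mulr1 mulrC lerDl ltW.
Qed.

(* The coefficients of a G' + (1 - a) (w + s) G G' + G^2, as a series in s,
   when G has coefficients g. *)
Definition ode_series (alpha : R) (w : C) (g : nat -> C) (n : nat) : C :=
  alpha%:C * (n.+1%:R * g n.+1)
  + (1 - alpha)%:C * cauchy_prod (nth 0 [:: w; 1])
      (cauchy_prod g (fun n => n.+1%:R * g n.+1)) n
  + cauchy_prod g g n.

Lemma ode_series_psum alpha w g s u v :
  psum g s u -> psum (fun n => n.+1%:R * g n.+1) s v ->
  psum (ode_series alpha w g) s
    (alpha%:C * v + (1 - alpha)%:C * ((w + s) * (u * v)) + u * u).
Proof.
move=> h0 h1; apply: psumD; last exact: psumM.
apply: psumD; apply: psumZ => //.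
apply: psumM; last exact: psumM.
(* [nth 0 [:: w; 1]] is the coefficient sequence of the polynomial w + s in s. *)
have := @psum_finite (nth 0 [:: w; 1]) s 2 _.
rewrite !big_ord_recl big_ord0 /= expr0 mulr1 mul1r addr0; apply.
by case=> [|[|n]] // _; rewrite nth_default.
Qed.

End psum.

Section cauchy.
Variable R : realType.
Variable mu : probability (measurableTypeR R) R.
Local Notation C := R[i].
Local Notation Re := (@complex.Re R).
Local Notation Im := (@complex.Im R).

(** * Bounded complex integrands and the resolvent *)

Definition cint (f : R -> C) : C :=
  (\int[mu]_t Re (f t))%R +i* (\int[mu]_t Im (f t))%R.

Definition cbounded_meas (f : R -> C) : Prop :=
  [/\ measurable_fun [set: measurableTypeR R] (fun t => Re (f t)),
      measurable_fun [set: measurableTypeR R] (fun t => Im (f t)) &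
      exists M, forall t, cmod (f t) <= M].

Lemma bounded_meas_integrable (f : R -> R) :
  measurable_fun [set: measurableTypeR R] f -> (exists M, forall t, `|f t| <= M) ->
  mu.-integrable setT (EFin \o f).
Proof.
move=> mf [M hM]; apply: measurable_bounded_integrable => //.
  by have h := ltry (1 : R); rewrite -(probability_setT mu) in h; exact: h.
exists M; split; first exact: num_real.
by move=> x Mx t _ /=; apply: (le_trans (hM t)); exact: ltW.
Qed.

Lemma cbounded_Re f : cbounded_meas f -> mu.-integrable setT (EFin \o (fun t => Re (f t))).
Proof.
move=> [m1 m2 [M hM]]; apply: bounded_meas_integrable => //.
by exists M => t; apply: (le_trans (Re_le _)).
Qed.
Lemma cbounded_Im f : cbounded_meas f -> mu.-integrable setT (EFin \o (fun t => Im (f t))).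
Proof.
move=> [m1 m2 [M hM]]; apply: bounded_meas_integrable => //.
by exists M => t; apply: (le_trans (Im_le _)).
Qed.

Lemma cbounded_cst (c : C) : cbounded_meas (fun=> c).
Proof. by split; try exact: measurable_cst; exists (cmod c). Qed.

Lemma cboundedD f g : cbounded_meas f -> cbounded_meas g ->
  cbounded_meas (fun t => f t + g t).
Proof.
move=> [f1 f2 [M hM]] [g1 g2 [N hN]]; split.
- by under eq_fun do rewrite ReD; exact: measurable_funD.
- by under eq_fun do rewrite ImD; exact: measurable_funD.
- by exists (M + N) => t; apply: (le_trans (cmodD _ _)); exact: lerD.
Qed.

Lemma cboundedM f g : cbounded_meas f -> cbounded_meas g ->
  cbounded_meas (fun t => f t * g t).
Proof.
move=> [f1 f2 [M hM]] [g1 g2 [N hN]]; split.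
- by under eq_fun do rewrite ReM; apply: measurable_funB; exact: measurable_funM.
- by under eq_fun do rewrite ImM; apply: measurable_funD; exact: measurable_funM.
- exists (M * N) => t; rewrite cmodM; apply: ler_pM => //; exact: cmod_ge0.
Qed.

Lemma cboundedX f n : cbounded_meas f -> cbounded_meas (fun t => f t ^+ n).
Proof.
move=> hf; elim: n => [|n IH].
  by under eq_fun do rewrite expr0; exact: cbounded_cst.
by under eq_fun do rewrite exprS; exact: cboundedM.
Qed.

Lemma cintD f g : cbounded_meas f -> cbounded_meas g ->
  cint (fun t => f t + g t) = cint f + cint g.
Proof.
move=> hf hg; rewrite /cint; apply: complexP => /=.
  under [in LHS]eq_Rintegral do rewrite ReD.
  by rewrite RintegralD //; exact: cbounded_Re.
under [in LHS]eq_Rintegral do rewrite ImD.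
by rewrite RintegralD //; exact: cbounded_Im.
Qed.

Lemma cintZ f (c : C) : cbounded_meas f -> cint (fun t => c * f t) = c * cint f.
Proof.
move=> hf; rewrite /cint; apply: complexP.
  rewrite ReM /=; under eq_Rintegral do rewrite ReM.
  rewrite RintegralB //; first by rewrite !RintegralZl //;
    [exact: cbounded_Im|exact: cbounded_Re].
    by have := cbounded_Re (cboundedM (cbounded_cst (Re c)%:C) hf);
      under [X in _.-integrable _ X]eq_fun do rewrite ReM /= mul0r subr0.
  by have := cbounded_Im (cboundedM (cbounded_cst (Im c)%:C) hf);
      under [X in _.-integrable _ X]eq_fun do rewrite ImM /= mul0r addr0.
rewrite ImM /=; under eq_Rintegral do rewrite ImM.
rewrite RintegralD //; first by rewrite !RintegralZl //;
    [exact: cbounded_Re|exact: cbounded_Im].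
  by have := cbounded_Im (cboundedM (cbounded_cst (Re c)%:C) hf);
      under [X in _.-integrable _ X]eq_fun do rewrite ImM /= mul0r addr0.
by have := cbounded_Re (cboundedM (cbounded_cst (Im c)%:C) hf);
      under [X in _.-integrable _ X]eq_fun do rewrite ReM /= mul0r subr0.
Qed.

Lemma cintB f g : cbounded_meas f -> cbounded_meas g ->
  cint (fun t => f t - g t) = cint f - cint g.
Proof.
move=> hf hg; rewrite -(mulN1r (cint g)) -cintZ // -cintD //; last first.
  by apply: cboundedM => //; exact: cbounded_cst.
by congr cint; apply: funext => t; rewrite mulN1r.
Qed.

Lemma cint_cst (c : C) : cint (fun=> c) = c.
Proof.
have mu1 := probability_setT mu.
by rewrite /cint !Rintegral_cst //= [X in fine X]mu1 /= !mulr1; case: c.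
Qed.

Lemma cbounded_sum N (c : nat -> C) (f : nat -> R -> C) :
  (forall n, cbounded_meas (f n)) ->
  cbounded_meas (fun t => \sum_(n < N) c n * f n t) /\
  cint (fun t => \sum_(n < N) c n * f n t) = \sum_(n < N) c n * cint (f n).
Proof.
move=> hf; elim: N => [|N [IH1 IH2]].
  under eq_fun do rewrite big_ord0; rewrite big_ord0 cint_cst.
  by split => //; exact: cbounded_cst.
under eq_fun do rewrite big_ord_recr /=; rewrite big_ord_recr /= -IH2 -cintZ //.
have h : cbounded_meas (fun t => c N * f N t).
  by apply: cboundedM => //; exact: cbounded_cst.
by split; [exact: cboundedD|exact: cintD].
Qed.

(** The factor 2 comes from estimating real and imaginary parts separately; it is harmless in the
    estimates that follow. *)
Lemma cint_bound f M : cbounded_meas f -> (forall t, cmod (f t) <= M) ->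
  cmod (cint f) <= 2 * M.
Proof.
move=> hf hM; apply: (le_trans (cmod_le _)); rewrite /= mulr_natl mulr2n.
have icst : mu.-integrable setT (EFin \o (fun=> M)).
  by apply: bounded_meas_integrable => //; exists `|M|.
have H g : mu.-integrable setT (EFin \o g) -> (forall t, `|g t| <= M) ->
    `|\int[mu]_t g t| <= M.
  move=> ig gM; apply: (le_trans (le_normr_Rintegral _ ig)) => //.
  have -> : M = \int[mu]_t (fun=> M) t.
    have mu1 := probability_setT mu.
    by rewrite Rintegral_cst // [X in fine X]mu1 mulr1.
  apply: le_Rintegral => //.
  exact: (integrable_norm ig).
apply: lerD; apply: H.
- exact: cbounded_Re.
- by move=> t; exact: (le_trans (Re_le _)).
- exact: cbounded_Im.
- by move=> t; exact: (le_trans (Im_le _)).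
Qed.

Definition resolvent (w : C) (t : R) : C := (w - t%:C)^-1.

Lemma subR_neq0 (w : C) (t : R) : 0 < Im w -> w - t%:C != 0.
Proof.
move=> w0; apply/eqP => /(congr1 Im); rewrite !cE /= subr0 => h.
by rewrite h ltxx in w0.
Qed.

Lemma resolvent_le (w : C) t : 0 < Im w -> cmod (resolvent w t) <= (Im w)^-1.
Proof.
move=> w0; rewrite cmodV lef_pV2 ?posrE ?cmod_gt0 ?subR_neq0 //.
apply: (le_trans _ (Im_le _)); rewrite !cE /= subr0; exact: ler_norm.
Qed.

Lemma resolvent_cont (w : C) : 0 < Im w ->
  continuous (fun t => Re (resolvent w t)) /\ continuous (fun t => Im (resolvent w t)).
Proof.
move=> w0.
have den t : (Re w - t) ^+ 2 + (Im w) ^+ 2 != 0.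
  by rewrite gt_eqF // ltr_wpDl ?sqr_ge0 ?exprn_gt0.
have cden : continuous (fun t => ((Re w - t) ^+ 2 + (Im w) ^+ 2)^-1).
  move=> t; apply: cvgV => //=.
  apply: cvgD; last exact: cvg_cst.
  have h : (Re w - x) @[x --> t] --> Re w - t by apply: cvgB; [exact: cvg_cst|exact: cvg_id].
  rewrite /GRing.exp /=; exact: (cvgM h h).
have E1 : (fun t => Re (resolvent w t)) =
    (fun t => (Re w - t) * ((Re w - t) ^+ 2 + (Im w) ^+ 2)^-1).
  by apply: funext => t; rewrite /resolvent ReV !cE /= subr0.
have E2 : (fun t => Im (resolvent w t)) =
    (fun t => - Im w * ((Re w - t) ^+ 2 + (Im w) ^+ 2)^-1).
  by apply: funext => t; rewrite /resolvent ImV !cE /= subr0.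
rewrite E1 E2; split=> t; apply: cvgM; try exact: cden.
  by apply: cvgB; [exact: cvg_cst|exact: cvg_id].
exact: cvg_cst.
Qed.

Lemma cbounded_resolvent (w : C) : 0 < Im w -> cbounded_meas (resolvent w).
Proof.
move=> w0; have [c1 c2] := resolvent_cont w0.
split; try exact: continuous_measurable_fun.
by exists (Im w)^-1 => t; exact: resolvent_le.
Qed.

Local Notation G := (cauchy_transform mu).

Lemma cauchy_transformE (w : C) : G w = cint (resolvent w).
Proof. by []. Qed.

Definition cauchy_deriv (w : C) : C := - cint (fun t => resolvent w t ^+ 2).

(** Taylor coefficients of G at w, from 1 / (w + s - t) = sum of (- s)^n / (w - t)^(n+1). *)
Definition cauchy_coef (w : C) (n : nat) : C :=
  (-1) ^+ n * cint (fun t => resolvent w t ^+ n.+1).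

(** The integrand is negative at every t, so a vanishing integral would make it vanish almost
    everywhere, while the whole line has mass 1. Strictness gives G <> 0 and puts 1 / G in the upper
    half-plane. *)
Lemma Im_cauchy_lt0 (w : C) : 0 < Im w -> Im (G w) < 0.
Proof.
move=> w0; rewrite cauchy_transformE /cint /=.
have ib := cbounded_Im (cbounded_resolvent w0).
have fE t : - Im (resolvent w t) = Im w / ((Re w - t) ^+ 2 + (Im w) ^+ 2).
  by rewrite /resolvent ImV !cE /= subr0 mulNr opprK.
have fpos t : 0 < - Im (resolvent w t).
  by rewrite fE divr_gt0 // ltr_wpDl ?sqr_ge0 ?exprn_gt0.
have le0 : \int[mu]_t Im (resolvent w t) <= 0.
  rewrite -oppr_ge0 -mulN1r -RintegralZl //; apply: Rintegral_ge0 => t _.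
  by rewrite mulN1r ltW.
rewrite lt_neqAle le0 andbT; apply/eqP => h0.
have : (\int[mu]_t `| (Im (resolvent w t))%:E | = 0)%E.
  have fin := integrable_fin_num measurableT ib.
  have h := congr1 EFin h0; rewrite /Rintegral fineK // in h.
  have -> : (\int[mu]_t `|(Im (resolvent w t))%:E| = - \int[mu]_t (Im (resolvent w t))%:E)%E.
    rewrite -integralN //; last first.
      exact: integrable_add_def.
    apply: eq_integral => t _; rewrite /= ler0_norm //.
    by rewrite -oppr_ge0 ltW.
  by rewrite h oppe0.
move=> h1; have mI := measurable_int mu ib.
have [N [mN muN hN]] := (ae_eq_integral_abs mu measurableT mI).1 h1.
have : (mu setT <= mu N)%E.
  apply: le_measure; rewrite ?inE // => t _; apply: hN => /= /(_ Logic.I) [] h.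
  by have := fpos t; rewrite h oppr0 ltxx.
have -> := probability_setT mu.
by rewrite muN lee_fin leNgt ltr01.
Qed.

Lemma arith_geom_sum (K : comPzRingType) (q : K) N :
  (1 - q) ^+ 2 * \sum_(n < N) n.+1%:R * q ^+ n
  = 1 - N.+1%:R * q ^+ N + N%:R * q ^+ N.+1.
Proof.
elim: N => [|N IH]; first by rewrite big_ord0; ring.
by rewrite big_ord_recr /= mulrDr IH -!(natr1 N.+1) -!(natr1 N) !exprS; ring.
Qed.

Lemma geom_sum (K : comPzRingType) (q : K) N :
  (1 - q) * \sum_(n < N) q ^+ n = 1 - q ^+ N.
Proof.
elim: N => [|N IH]; first by rewrite big_ord0; ring.
by rewrite big_ord_recr /= mulrDr IH !exprS; ring.
Qed.

Lemma geom_sum_le (q : R) N : 0 <= q < 1 -> \sum_(n < N) q ^+ n <= (1 - q)^-1.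
Proof.
move=> /andP[q0 q1]; have q1' : 0 < 1 - q by lra.
rewrite -[leRHS]mul1r ler_pdivlMr // mulrC geom_sum.
by rewrite lerBlDr lerDl exprn_ge0.
Qed.

Lemma arith_geom_sum_le (q : R) N : 0 <= q < 1 ->
  \sum_(n < N) n.+1%:R * q ^+ n <= ((1 - q) ^+ 2)^-1.
Proof.
move=> /andP[q0 q1]; have q1' : 0 < 1 - q by lra.
rewrite -[leRHS]mul1r ler_pdivlMr ?exprn_gt0 // mulrC arith_geom_sum.
rewrite exprS mulrA -natr1.
have := exprn_ge0 N q0; have : 0 <= N%:R :> R by []. 
set a := N%:R; set b := q ^+ N => a0 b0.
rewrite -subr_ge0 [leRHS](_ : _ = (a * (1 - q) + 1) * b); last by ring.
by rewrite mulr_ge0 // addr_ge0 // mulr_ge0 // ltW.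
Qed.

Lemma arith_geom_cvg0 (q : R) : 0 <= q < 1 ->
  N.+1%:R * q ^+ N @[N --> \oo] --> (0 : R).
Proof.
move=> q01; have /andP[q0 _] := q01; apply: cvg_series_cvg_0.
have := @bounded_sum_cvg R (fun n => n.+1%:R * q ^+ n) _ _ (fun N => arith_geom_sum_le N q01).
rewrite (_ : (fun N => _) = series (fun n => n.+1%:R * q ^+ n)).
  by apply=> n; rewrite mulr_ge0 // exprn_ge0.
by apply: funext => N; rewrite /series /= big_mkord.
Qed.

Section expansion.
Variables (w s : C).
Hypotheses (w0 : 0 < Im w) (sw : cmod s < Im w).

Let ws0 : 0 < Im (w + s).
Proof.
by rewrite ImD; have := le_lt_trans (Im_le s) sw; rewrite ltr_norml; lra.
Qed.

Let q : R := cmod s / Im w.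

Let q01 : 0 <= q < 1.
Proof. by rewrite divr_ge0 ?cmod_ge0 ?(ltW w0) // ltr_pdivrMr // mul1r. Qed.

Lemma resolvent_shift t :
  resolvent w t = resolvent (w + s) t * (1 + s * resolvent w t).
Proof.
have h1 := subR_neq0 t w0; have h2 := subR_neq0 t ws0.
rewrite /resolvent addrAC -[in RHS](mulfV h1).
by rewrite -mulrDl mulrA mulVf ?mul1r // -addrAC.
Qed.

Let q_le t : cmod (- s * resolvent w t) <= q.
Proof. by rewrite cmodM cmodN ler_wpM2l ?cmod_ge0 // resolvent_le. Qed.

Let cbw n : cbounded_meas (fun t => resolvent w t ^+ n).
Proof. exact/cboundedX/cbounded_resolvent. Qed.

(** The finite geometric sum has the exact remainder (- s R)^N R', with R and R' the resolvents at w
    and w + s; it is at most q^N / Im (w + s) uniformly in t. So only finite sums are exchanged with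
    the integral. *)
Lemma cauchy_psum : psum (cauchy_coef w) s (G (w + s)).
Proof.
have E N : G (w + s) - \sum_(n < N) cauchy_coef w n * s ^+ n =
    cint (fun t => (- s * resolvent w t) ^+ N * resolvent (w + s) t).
  have [h1 h2] := @cbounded_sum N (fun n => (-1) ^+ n * s ^+ n) _ (fun n => cbw n.+1).
  under eq_bigr do rewrite /cauchy_coef mulrAC.
  rewrite -h2 cauchy_transformE -cintB //; last exact: cbounded_resolvent.
  congr cint; apply: funext => t.
  have /= := geom_sum (- s * resolvent w t) N => hg.
  have hr := resolvent_shift t.
  set a := resolvent w t in hg hr *; set b := resolvent (w + s) t in hr *.
  have -> : \sum_(n < N) (-1) ^+ n * s ^+ n * a ^+ n.+1 =
      a * \sum_(n < N) (- s * a) ^+ n.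
    rewrite mulr_sumr; apply: eq_bigr => i _.
    by rewrite exprMn -[in RHS](mulN1r s) exprMn exprS; ring.
  rewrite [X in X * _]hr [in X in _ - X = _](_ : 1 + s * a = 1 - - s * a); last by ring.
  by rewrite -mulrA hg; ring.
split.
  apply: (@ccvg_bound _ _ _ _ _ _ (fun N => 2 * (q ^+ N / Im (w + s)))).
    near=> N; rewrite -cmodN opprB E; apply: cint_bound.
      apply: cboundedM; last exact: cbounded_resolvent.
      apply: cboundedX; apply: cboundedM; first exact: cbounded_cst.
      exact: cbounded_resolvent.
    move=> t; rewrite cmodM cmodX ler_pM ?exprn_ge0 ?cmod_ge0 ?resolvent_le //.
    have /andP[q0 _] := q01; rewrite lerXn2r ?nnegrE ?cmod_ge0 //; exact: q_le.
  rewrite -(mulr0 2) -[X in _ * X](mul0r (Im (w + s))^-1).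
  apply: cvgM; first exact: cvg_cst; apply: cvgM; last exact: cvg_cst.
  by apply: cvg_expr; have /andP[? ?] := q01; rewrite ger0_norm.
exists (2 / Im w * (1 - q)^-1) => N.
apply: le_trans (ler_wpM2l _ (geom_sum_le N q01)); last by rewrite divr_ge0 // ltW.
rewrite mulr_sumr; apply: ler_sum => n _; rewrite /cauchy_coef !cmodM !cmodX cmodN cmod1.
rewrite expr1n mul1r expr_div_n mulrA mulrAC; apply: ler_wpM2r.
  by rewrite exprn_ge0 // cmod_ge0.
have -> : 2 / Im w / Im w ^+ n = 2 * (Im w)^-1 ^+ n.+1 by rewrite exprS exprVn mulrA.
apply: cint_bound; first exact: cbw.
move=> t; rewrite cmodX lerXn2r ?nnegrE ?cmod_ge0 ?invr_ge0 ?(ltW w0) //.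
exact: resolvent_le.
Unshelve. all: by end_near. Qed.

(** As for G, but with the finite sum of (n + 1) x^n at x = - s R, because R^2 = R'^2 (1 + s R)^2;
    the remainder [rem] is of size (N + 1) q^N. *)
Lemma cauchy_deriv_psum :
  psum (fun n => n.+1%:R * cauchy_coef w n.+1) s (cauchy_deriv (w + s)).
Proof.
have /andP[q0 q1] := q01.
pose rem N t := (resolvent (w + s) t ^+ 2) *
  (N.+1%:R * (- s * resolvent w t) ^+ N + - N%:R * (- s * resolvent w t) ^+ N.+1).
have E N : cauchy_deriv (w + s) - \sum_(n < N) n.+1%:R * cauchy_coef w n.+1 * s ^+ n =
    - cint (rem N).
  have [h1 h2] := @cbounded_sum N (fun n => - (n.+1%:R * (-1) ^+ n.+1 * s ^+ n)) _
    (fun n => cbw n.+2).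
  have -> : \sum_(n < N) n.+1%:R * cauchy_coef w n.+1 * s ^+ n =
     - \sum_(n < N) - (n.+1%:R * (-1) ^+ n.+1 * s ^+ n) * cint (fun t => resolvent w t ^+ n.+2).
    rewrite -sumrN; apply: eq_bigr => n _; rewrite /cauchy_coef; ring.
  rewrite -h2 /cauchy_deriv -opprD; congr (- _).
  rewrite -cintB //; last by apply: cboundedX; exact: cbounded_resolvent.
  congr cint; apply: funext => t; rewrite /rem.
  have /= := arith_geom_sum (- s * resolvent w t) N => hg.
  have hr := resolvent_shift t.
  set a := resolvent w t in hg hr *; set b := resolvent (w + s) t in hr *.
  have -> : \sum_(n < N) - (n.+1%:R * (-1) ^+ n.+1 * s ^+ n) * a ^+ n.+2 =
      a ^+ 2 * \sum_(n < N) n.+1%:R * (- s * a) ^+ n.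
    rewrite mulr_sumr; apply: eq_bigr => i _.
    by rewrite exprMn -[in RHS](mulN1r s) exprMn !exprS; ring.
  rewrite [X in X ^+ 2 * _]hr [in X in _ - X = _](_ : 1 + s * a = 1 - - s * a); last by ring.
  by rewrite exprMn -mulrA hg; ring.
have cbs : cbounded_meas (fun t => - s * resolvent w t).
  by apply: cboundedM; [exact: cbounded_cst|exact: cbounded_resolvent].
split.
  apply: (@ccvg_bound _ _ _ _ _ _ (fun N => 2 * ((Im (w + s))^-1 ^+ 2 * (2 * (N.+1%:R * q ^+ N))))).
    near=> N; rewrite -cmodN opprB E cmodN; apply: cint_bound.
      apply: cboundedM; first by apply: cboundedX; exact: cbounded_resolvent.
      apply: cboundedD; apply: cboundedM; try exact: cbounded_cst; exact: cboundedX.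
    move=> t; rewrite /rem cmodM cmodX ler_pM ?exprn_ge0 ?cmod_ge0 //.
      by rewrite lerXn2r ?nnegrE ?cmod_ge0 ?invr_ge0 ?(ltW ws0) //; exact: resolvent_le.
    apply: (le_trans (cmodD _ _)).
    rewrite [leRHS](_ : _ = N.+1%:R * q ^+ N + N.+1%:R * q ^+ N); last by ring.
    have cn n : cmod (n%:R : C) = n%:R.
      by rewrite -(rmorph_nat (real_complex R)) cmodR ger0_norm.
    have hq m : cmod (- s * resolvent w t) ^+ m <= q ^+ m.
      by rewrite lerXn2r ?nnegrE ?cmod_ge0 //; exact: q_le.
    rewrite !cmodM cmodN !cn !cmodX; apply: lerD; apply: ler_pM => //.
    - by rewrite exprn_ge0 ?cmod_ge0.
    - by rewrite exprn_ge0 ?cmod_ge0.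
    - by rewrite ler_nat.
    - by apply: (le_trans (hq _)); rewrite exprS ler_piMl ?exprn_ge0 // ltW.
  rewrite -(mulr0 2) -[X in _ * X](mulr0 ((Im (w + s))^-1 ^+ 2)) -[X in _ * (_ * X)](mulr0 2).
  apply: cvgM; first exact: cvg_cst; apply: cvgM; first exact: cvg_cst.
  by apply: cvgM; [exact: cvg_cst|exact: arith_geom_cvg0].
exists (2 / Im w ^+ 2 * ((1 - q) ^+ 2)^-1) => N.
apply: le_trans (ler_wpM2l _ (arith_geom_sum_le N q01)); last first.
  by rewrite divr_ge0 // exprn_ge0 // ltW.
rewrite mulr_sumr; apply: ler_sum => n _; rewrite /cauchy_coef !cmodM !cmodX cmodN cmod1.
rewrite -(rmorph_nat (real_complex R)) cmodR ger0_norm // expr1n mul1r.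
rewrite [leRHS](_ : _ = n.+1%:R * (2 / Im w ^+ 2 / Im w ^+ n) * cmod s ^+ n); last first.
  by rewrite expr_div_n; ring.
apply: ler_wpM2r; first by rewrite exprn_ge0 // cmod_ge0.
apply: ler_wpM2l => //.
have -> : 2 / Im w ^+ 2 / Im w ^+ n = 2 * (Im w)^-1 ^+ n.+2.
  by rewrite exprVn -mulrA -invfM -exprD.
apply: cint_bound; first exact: cbw.
move=> t; rewrite cmodX lerXn2r ?nnegrE ?cmod_ge0 ?invr_ge0 ?(ltW w0) //.
exact: resolvent_le.
Unshelve. all: by end_near. Qed.

(** The error is exactly s^2 times the integral of R^2 R'. Being of second order and explicit in s,
    it gives the derivative of G along the image of the imaginary axis as well as along segments. *)
Lemma cauchy_diff :
  cmod (G (w + s) - G w - s * cauchy_deriv w) <=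
  2 * (cmod s ^+ 2 * ((Im w)^-1 ^+ 2 * (Im (w + s))^-1)).
Proof.
have cbs := cbounded_resolvent ws0; have cb := cbounded_resolvent w0.
have -> : G (w + s) - G w - s * cauchy_deriv w =
   cint (fun t => s ^+ 2 * (resolvent w t ^+ 2 * resolvent (w + s) t)).
  rewrite !cauchy_transformE /cauchy_deriv mulrN opprK -cintZ //.
  rewrite -cintB // -cintD //; last 2 first.
  - have := cboundedD cbs (cboundedM (cbounded_cst (-1)) cb).
    by under eq_fun do rewrite mulN1r.
  - by apply: cboundedM; [exact: cbounded_cst|exact: cbw].
  congr cint; apply: funext => t; have hr := resolvent_shift t.
  set a := resolvent w t in hr *; set b := resolvent (w + s) t in hr *.
  have -> : b - a + s * a ^+ 2 = b - a * (1 - s * a) by ring.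
  rewrite [in LHS]hr; have -> : s ^+ 2 * (a ^+ 2 * b) = b - b * (1 + s * a) * (1 - s * a) by ring.
  by rewrite -hr.
apply: cint_bound.
  apply: cboundedM; first exact: cbounded_cst.
  by apply: cboundedM => //; exact: cbw.
move=> t; rewrite cmodM cmodX [cmod (_ * resolvent (w + s) t)]cmodM cmodX; apply: ler_wpM2l; first by rewrite exprn_ge0 // cmod_ge0.
apply: ler_pM; rewrite ?exprn_ge0 ?cmod_ge0 ?resolvent_le //.
by rewrite lerXn2r ?nnegrE ?cmod_ge0 ?invr_ge0 ?(ltW w0) //; exact: resolvent_le.
Qed.

End expansion.

End cauchy.

Section ode.
Variable R : realType.
Variable mu : probability (measurableTypeR R) R.
Variable alpha : R.
Local Notation C := R[i].
Local Notation Re := (@complex.Re R).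
Local Notation Im := (@complex.Im R).
Local Notation G := (cauchy_transform mu).
Local Notation G1 := (cauchy_deriv mu).

(** * The differential equation satisfied by the Cauchy transform *)

Definition ode (w : C) : C :=
  alpha%:C * G1 w + (1 - alpha)%:C * (w * (G w * G1 w)) + G w * G w.

Definition ode_coef (w : C) : nat -> C := ode_series alpha w (cauchy_coef mu w).

Lemma ode_psum w s : 0 < Im w -> cmod s < Im w -> psum (ode_coef w) s (ode (w + s)).
Proof.
move=> w0 sw; have h0 := cauchy_psum mu w0 sw; have h1 := cauchy_deriv_psum mu w0 sw.
exact: ode_series_psum.
Qed.

(** The expansion of [ode] at w is valid on the disc of radius Im w; its coefficients vanish by
    [psum_zero_coef], hence its sum vanishes on that whole disc. *)
Lemma ode_disc w : 0 < Im w ->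
  (forall e, 0 < e -> exists s, [/\ s != 0, cmod s < e & ode (w + s) = 0]) ->
  forall s, cmod s < Im w -> ode (w + s) = 0.
Proof.
move=> w0 hz s sw.
have c0 : forall n, ode_coef w n = 0.
  have hr : cmod (Im w / 2)%:C < Im w by rewrite cmodR ger0_norm; lra.
  apply: (psum_zero_coef _ (ode_psum w0 hr)).
    by apply/eqP => /(congr1 Re) /=; lra.
  move=> e e0; have [s' [s0 s'e hs]] : exists s, [/\ s != 0, cmod s < Num.min e (Im w) & ode (w + s) = 0].
    by apply: hz; rewrite lt_min e0.
  move: s'e; rewrite lt_min => /andP[s'e s'w].
  by exists s'; split => //; rewrite -hs; exact: ode_psum.
apply: (psum_unique (ode_psum w0 sw)); split.
  by under eq_fun do (under eq_bigr do rewrite c0 mul0r; rewrite big1 //); exact: ccvg_cst.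
by exists 0 => N; rewrite big1 // => n _; rewrite c0 mul0r cmod0.
Qed.

(** A chain of discs along the segment from w0 to w1: every centre has imaginary part at least m,
    and consecutive centres are closer than m, so each disc contains a neighbourhood of the next
    centre. *)
Lemma ode_propagate w0 w1 : 0 < Im w0 -> 0 < Im w1 ->
  (forall s, cmod s < Im w0 -> ode (w0 + s) = 0) -> ode w1 = 0.
Proof.
move=> h0 h1 hd; pose m := Num.min (Im w0) (Im w1).
have m0 : 0 < m by rewrite lt_min h0.
pose N := (Num.truncn (cmod (w1 - w0) / m)).+1.
have N0 : 0 < N%:R :> R by rewrite ltr0n.
pose p (k : nat) := w0 + (k%:R / N%:R)%:C * (w1 - w0).
have step k : p k.+1 - p k = (N%:R^-1)%:C * (w1 - w0).
  rewrite /p opprD addrACA subrr add0r -mulrBl -rmorphB -mulrBl.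
  by rewrite -natrB // subSn // subnn mul1r.
have stepm k : cmod (p k.+1 - p k) < m.
  rewrite step cmodM cmodR ger0_norm ?invr_ge0 ?(ltW N0) // mulrC ltr_pdivrMr //.
  rewrite mulrC -ltr_pdivrMr //; exact: truncnS_gt.
have pm k : (k <= N)%N -> m <= Im (p k).
  move=> kN; rewrite /p ImD ImM /= mul0r addr0 !cE.
  have : 0 <= k%:R / N%:R :> R by rewrite divr_ge0.
  have : k%:R / N%:R <= 1 :> R by rewrite ler_pdivrMr // mul1r ler_nat.
  set u := _ / _ => u1 u0.
  have : m <= Im w0 by rewrite ge_min lexx.
  have : m <= Im w1 by rewrite ge_min lexx orbT.
  by nra.
have P k : (k <= N)%N -> forall s, cmod s < Im (p k) -> ode (p k + s) = 0.
  elim: k => [_|k IH kN].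
    by rewrite /p mul0r mul0r addr0.
  apply: ode_disc; first exact: (lt_le_trans m0 (pm _ kN)).
  move=> e e0; pose s0 := p k.+1 - p k; have hs0 := stepm k; rewrite -/s0 in hs0.
  (* Small real displacements of the new centre stay in the old disc and provide the accumulating
     zeros; [x] is kept below e and below the room m - |s0|. *)
  pose x := Num.min (e / 2) ((m - cmod s0) / 2).
  have x0 : 0 < x by rewrite lt_min !divr_gt0 // subr_gt0.
  have xe : x <= e / 2 by rewrite ge_min lexx.
  have xm : x <= (m - cmod s0) / 2 by rewrite ge_min lexx orbT.
  exists x%:C; split.
  - by apply/eqP => /(congr1 Re) /=; lra.
  - by rewrite cmodR ger0_norm; lra.
  - have -> : p k.+1 + x%:C = p k + (s0 + x%:C) by rewrite /s0; ring.
    apply: IH; first exact: ltnW.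
    apply: (lt_le_trans _ (pm _ (ltnW kN))).
    by apply: (le_lt_trans (cmodD _ _)); rewrite cmodR ger0_norm; lra.
have := P N (leqnn N) 0; rewrite addr0 cmod0 /p divff ?gt_eqF // mul1r subrKC.
exact.
Qed.

Section axis.
Variables (c : C) (M : R).
Hypothesis (M0 : 0 < M).

(** This is H (i y): the factor i^(1 - alpha) of the power is absorbed in [c], and only a real power
    of y remains. *)
Definition axis_curve (y : R) : C := y *i - c * (y `^ (1 - alpha))%:C.

Local Notation gam := axis_curve.

Hypotheses (gam_Im : forall y, M < y -> 0 < Im (gam y))
  (gamG : forall y, M < y -> G (gam y) = (y *i)^-1).

Lemma axis_curve_quotient y : 0 < y ->
  ccvg (0^')%classic (fun h : R => (h^-1)%:C * (gam (h + y) - gam y))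
    ('i - c * ((1 - alpha) * y `^ (- alpha))%:C).
Proof.
move=> y0.
have hd : is_derive y 1 (@powR R ^~ (1 - alpha)) ((1 - alpha) * y `^ (1 - alpha - 1)).
  exact: is_derive1_powR.
have hcv : h^-1 * ((h + y) `^ (1 - alpha) - y `^ (1 - alpha)) @[h --> 0^'] -->
   (1 - alpha) * y `^ (- alpha).
  have e1 : 1 - alpha - 1 = - alpha by ring.
  have := @ex_derive _ _ _ _ _ _ _ hd; rewrite /derivable => hc.
  have := @derive_val _ _ _ _ _ _ _ hd; rewrite /derive e1 => <-.
  move: hc; rewrite /=.
  by under eq_fun do rewrite [_ *: 1]mulr1.
apply: (@ccvg_bound _ _ _ _ _ _ (fun h => cmod c * `|h^-1 * ((h + y) `^ (1 - alpha) - y `^ (1 - alpha)) -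
    (1 - alpha) * y `^ (- alpha)|)).
  near=> h.
  have h0 : h != 0 by near: h; exact: nbhs_dnbhs_neq.
  have -> : (h^-1)%:C * (gam (h + y) - gam y) - ('i - c * ((1 - alpha) * y `^ (- alpha))%:C) =
     - (c * (h^-1 * ((h + y) `^ (1 - alpha) - y `^ (1 - alpha)) -
    (1 - alpha) * y `^ (- alpha))%:C).
    rewrite /gam; apply: complexP; rewrite !cE /=; first by ring.
    by field.
  by rewrite cmodN cmodM cmodR.
rewrite -[X in _ --> X](mulr0 (cmod c)); apply: cvgM; first exact: cvg_cst.
by apply/norm_cvg0P; apply/subr_cvg0; exact: hcv.
Unshelve. all: by end_near. Qed.

(** G along the curve is differentiated in two ways: by the chain rule as gam'(y) G'(w), and from
    the known value 1 / (i y) as i / y^2. *)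
Lemma axis_curve_ode y : M < y -> ode (gam y) = 0.
Proof.
move=> My; have y0 : 0 < y by apply: lt_trans My.
pose s (h : R) := gam (h + y) - gam y.
have PF : ProperFilter (0^')%classic := Proper_dnbhs_numFieldType (0 : R).
pose dg := 'i - c * ((1 - alpha) * y `^ (- alpha))%:C.
have hq := axis_curve_quotient y0; rewrite -/dg in hq.
have h0 : ccvg (0^')%classic (fun h : R => h%:C) 0.
  by split; [exact: nbhs_dnbhs|exact: cvg_cst].
have hs : ccvg (0^')%classic s 0.
  have := @ccvgM R _ _ PF _ _ _ _ h0 hq; rewrite mul0r; apply: ccvg_near; near=> h.
  have hn0 : h != 0 by near: h; exact: nbhs_dnbhs_neq.
  by rewrite mulrA -rmorphM mulfV // mul1r.
have v0 := gam_Im My; pose w := gam y; rewrite -/w in v0 *.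
have hGq : ccvg (0^')%classic (fun h : R => (h^-1)%:C * (G (w + s h) - G w)) (dg * G1 w).
  pose rem (h : R) := (h^-1)%:C * (G (w + s h) - G w - s h * G1 w).
  have : ccvg (0^')%classic (fun h : R => (h^-1)%:C * s h * G1 w + rem h) (dg * G1 w + 0).
    apply: ccvgD; first by apply: ccvgM => //; exact: ccvg_cst.
    pose K := 2 * ((Im w)^-1 ^+ 2 * (Im w / 2)^-1).
    apply: (@ccvg_bound _ _ _ _ _ _ (fun h : R => cmod ((h^-1)%:C * s h * s h - 0) * K)).
      have /ccvg_cmod hs0 := hs; have v2 : 0 < Im w / 2 by rewrite divr_gt0.
      have hlt : \forall h \near (0^')%classic, cmod (s h - 0) < Im w / 2.
        by apply: (cvgr_lt 0 hs0).
      near=> h.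
      have sh : cmod (s h) < Im w / 2 by have := near hlt h; rewrite subr0; apply.
      have shw : cmod (s h) < Im w by lra.
      have hd := cauchy_diff mu v0 shw.
      have hI : Im w / 2 <= Im (w + s h).
        by rewrite ImD; have := Im_le (s h); rewrite ler_norml; lra.
      rewrite !subr0 /rem cmodM; apply: (le_trans (ler_wpM2l (cmod_ge0 _) hd)).
      rewrite [cmod (_ * s h * s h)]cmodM [cmod (_ * s h)]cmodM.
      set A := cmod (h^-1)%:C; set B := cmod (s h).
      rewrite [leRHS](_ : _ = A * (2 * (B ^+ 2 * ((Im w)^-1 ^+ 2 * (Im w / 2)^-1)))); last by rewrite /K; ring.
      apply: ler_wpM2l; first exact: cmod_ge0.
      apply: ler_wpM2l => //; apply: ler_wpM2l; first by rewrite exprn_ge0 // cmod_ge0.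
      apply: ler_wpM2l; first by rewrite exprn_ge0 // invr_ge0 ltW.
      by rewrite lef_pV2 ?posrE //; apply: lt_le_trans hI.
    have := @ccvgM R _ _ PF _ _ _ _ hq hs; rewrite mulr0 => /ccvg_cmod hh.
    by rewrite -[X in _ --> X](mul0r K); apply: cvgM => //; exact: cvg_cst.
  rewrite addr0; apply: ccvg_near; near=> h.
  by rewrite /rem; ring.
have hGq' : ccvg (0^')%classic (fun h : R => (h^-1)%:C * (G (w + s h) - G w)) ((y * y)^-1 *i).
  have : ccvg (0^')%classic (fun h : R => ((h + y) * y)^-1 *i) ((y * y)^-1 *i).
    split; first exact: cvg_cst.
    rewrite /=; apply: cvgV; first by rewrite mulf_neq0 // gt_eqF.
    apply: cvgM; last exact: cvg_cst.
    rewrite -[X in _ --> X](add0r y); apply: cvgD; last exact: cvg_cst.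
    exact: nbhs_dnbhs.
  apply: ccvg_near; near=> h.
  have hn0 : h != 0 by near: h; exact: nbhs_dnbhs_neq.
  have hM : M < h + y.
    have : M - y < h.
      near: h; apply: nbhs_dnbhs; apply: lt_nbhsr; first by rewrite subr_lt0.
    by rewrite ltrBlDr.
  have hy0 : 0 < h + y by apply: lt_trans hM.
  have -> : w + s h = gam (h + y) by rewrite /w /s; ring.
  rewrite /w !gamG //; apply: complexP; rewrite !cE !ReV !ImV /= !expr0n /= !add0r; first by ring.
  by field; rewrite hn0 !gt_eqF.
have E := ccvg_unique hGq hGq'.
have Gw : G w = (y *i)^-1 by exact: gamG.
(* y gam'(y) is a combination of i y = 1 / G w and of w itself; this eliminates [c]. *)
have ydg : y%:C * dg = alpha%:C * (y *i) + (1 - alpha)%:C * w.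
  have yp : y * y `^ (- alpha) = y `^ (1 - alpha).
    by rewrite powRD ?powRr1 ?ltW //; apply/implyP => _; rewrite gt_eqF.
  rewrite /dg /w /gam -yp; apply: complexP; rewrite !cE /=; ring.
have yi0 : y *i != 0 :> C by apply/eqP => /(congr1 Im) /= h; rewrite h ltxx in y0.
have -> : ode w = G w * (G1 w * (alpha%:C * (y *i) + (1 - alpha)%:C * w)) + G w * G w.
  rewrite /ode Gw; field; exact: yi0.
rewrite -ydg [G1 w * _](_ : _ = y%:C * (dg * G1 w)); last by ring.
rewrite E Gw; apply: complexP; rewrite !cE !ReV !ImV /= !expr0n /= !add0r; first by field; rewrite gt_eqF.
by ring.
Unshelve. all: by end_near. Qed.

Lemma ode_upper_half w : 0 < Im w -> ode w = 0.
Proof.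
move=> w0; pose y := M + 1; have My : M < y by rewrite ltrDl.
have y0 : 0 < y by apply: lt_trans My.
apply: (@ode_propagate (gam y)) => //; first exact: gam_Im.
apply: ode_disc; first exact: gam_Im.
move=> e e0.
have PF : ProperFilter (0^')%classic := Proper_dnbhs_numFieldType (0 : R).
have h0 : ccvg (0^')%classic (fun h : R => h%:C) 0.
  by split; [exact: nbhs_dnbhs|exact: cvg_cst].
have := @ccvgM R _ _ PF _ _ _ _ h0 (axis_curve_quotient y0); rewrite mul0r => /ccvg_cmod hs.
have hlt : \forall h \near (0^')%classic, cmod (h%:C * ((h^-1)%:C * (gam (h + y) - gam y)) - 0) < e.
  by apply: (cvgr_lt 0 hs).
have : \forall h \near (0^')%classic, [/\ cmod (gam (h + y) - gam y) < e, h != 0 & - 1 < h].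
  near=> h; have hn0 : h != 0 by near: h; exact: nbhs_dnbhs_neq.
  split => //.
    have := near hlt h; rewrite subr0 mulrA -rmorphM mulfV // mul1r; exact.
  by near: h; apply: nbhs_dnbhs; apply: lt_nbhsr; rewrite oppr_lt0.
move=> /filter_ex [h [h1 h2 h3]].
have hM : M < h + y by rewrite /y; lra.
exists (gam (h + y) - gam y); split => //; last by rewrite subrKC; exact: axis_curve_ode.
(* The curve is injective, as G takes distinct values 1 / (i y) on it; so its nearby points are
   zeros different from the centre. *)
apply/eqP => /eqP; rewrite subr_eq0 => /eqP hh.
have := gamG hM; rewrite hh gamG // => /invr_inj /(congr1 Im) /= /eqP.
by rewrite -subr_eq0 opprD addrCA subrr addr0 oppr_eq0; apply/negP.
Unshelve. all: by end_near. Qed.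

End axis.

End ode.

Section polar.
Variable R : realType.
Local Notation C := R[i].
Local Notation Re := (@complex.Re R).
Local Notation Im := (@complex.Im R).
Implicit Types (z : C) (p t r : R).

(** * Polar coordinates in the upper half-plane *)

Lemma Im_gt0_neq0 z : 0 < Im z -> z != 0.
Proof. by move=> z0; apply/eqP => h; rewrite h ltxx in z0. Qed.

(** This form can be differentiated throughout the half-plane and makes the bounds 0 < Carg z < pi
    immediate. *)
Lemma Carg_atan z : 0 < Im z -> Carg z = pi / 2 - atan (Re z / Im z).
Proof.
move=> z0; rewrite /Carg (ltW z0).
have r0 := cmod_gt0 (Im_gt0_neq0 z0).
set B := atan _.
have cB : cos B = Im z / cmod z.
  rewrite cos_atan -[RHS]invrK invf_div; congr (_^-1).
  rewrite -[RHS]ger0_norm ?divr_ge0 ?cmod_ge0 ?(ltW z0) // -sqrtr_sqr; congr Num.sqrt.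
  by rewrite expr_div_n [in RHS]expr_div_n cmod_sqr; field; rewrite gt_eqF.
have sB : sin B = Re z / cmod z.
  have cB0 : cos B != 0 by rewrite cB gt_eqF // divr_gt0.
  have := atanK (Re z / Im z); rewrite -/B /tan => /(canRL (divfK cB0)) ->.
  by rewrite cB; field; rewrite !gt_eqF.
rewrite -sB -cosBpihalf -cosN opprB cosK //.
have := atan_gtNpi2 (Re z / Im z); have := atan_ltpi2 (Re z / Im z).
by rewrite -/B in_itv /=; lra.
Qed.

Lemma Carg_polar z : 0 < Im z ->
  [/\ 0 < Carg z, Carg z < pi, Re z = cmod z * cos (Carg z) &
      Im z = cmod z * sin (Carg z)].
Proof.
move=> z0; have r0 := cmod_gt0 (Im_gt0_neq0 z0).
have E := Carg_atan z0.
have h1 := atan_gtNpi2 (Re z / Im z); have h2 := atan_ltpi2 (Re z / Im z).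
have lt1 : -1 <= Re z / cmod z <= 1.
  by rewrite -ler_norml normrM normfV (ger0_norm (cmod_ge0 _)) ler_pdivrMr // mul1r Re_le.
split; [lra|lra| |]; rewrite /Carg (ltW z0).
  by rewrite acosK ?in_itv //= mulrC divfK // gt_eqF.
rewrite sin_acos // (_ : 1 - _ = (Im z / cmod z) ^+ 2).
  by rewrite sqrtr_sqr ger0_norm ?divr_ge0 ?ltW // mulrC divfK // gt_eqF.
rewrite !expr_div_n -[X in X - _](divff (_ : cmod z ^+ 2 != 0)) ?expf_neq0 ?gt_eqF //.
by rewrite -mulrBl [X in X - _]cmod_sqr addrAC subrr add0r.
Qed.

Lemma expiD a b : expi (a + b) = expi a * expi b :> C.
Proof. by rewrite /expi cosD sinD; apply: complexP; rewrite !cE //=; ring. Qed.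

Lemma cpowN_inv z p : 0 < Im z -> cpow z p * cpow z (- p) = 1.
Proof.
move=> z0; have r0 := cmod_gt0 (Im_gt0_neq0 z0).
rewrite /cpow mulrACA -rmorphM -expiD -powRD; last by apply/implyP => _; rewrite gt_eqF.
rewrite subrr powRr0 -mulrDl subrr mul0r /expi cos0 sin0.
by apply: complexP; rewrite !cE /=; ring.
Qed.

Definition is_cderive (f : R -> C) (s : R) (df : C) : Prop :=
  is_derive s 1 (fun x => Re (f x)) (Re df) /\ is_derive s 1 (fun x => Im (f x)) (Im df).

Lemma is_cderiveD f g s df dg : is_cderive f s df -> is_cderive g s dg ->
  is_cderive (fun x => f x + g x) s (df + dg).
Proof.
move=> [f1 f2] [g1 g2]; split.
  rewrite ReD (_ : (fun x => _) = (fun x => Re (f x)) + (fun x => Re (g x))).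
    exact: is_deriveD.
  by apply: funext => x; rewrite ReD.
rewrite ImD (_ : (fun x => _) = (fun x => Im (f x)) + (fun x => Im (g x))).
  exact: is_deriveD.
by apply: funext => x; rewrite ImD.
Qed.

Lemma is_cderiveM f g s df dg : is_cderive f s df -> is_cderive g s dg ->
  is_cderive (fun x => f x * g x) s (df * g s + f s * dg).
Proof.
move=> [f1 f2] [g1 g2]; split.
  rewrite (_ : (fun x => _) = (fun x => Re (f x)) * (fun x => Re (g x)) -
    (fun x => Im (f x)) * (fun x => Im (g x))).
    by apply: is_derive_eq; rewrite !cE /GRing.scale /=; ring.
  by apply: funext => x; rewrite ReM.
rewrite (_ : (fun x => _) = (fun x => Re (f x)) * (fun x => Im (g x)) +
    (fun x => Im (f x)) * (fun x => Re (g x))).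
  by apply: is_derive_eq; rewrite !cE /GRing.scale /=; ring.
by apply: funext => x; rewrite ImM.
Qed.

Lemma is_cderive_cst (c : C) s : is_cderive (fun=> c) s 0.
Proof. by split; exact: is_derive_cst. Qed.

Lemma is_cderive_line (w d : C) s : is_cderive (fun x : R => w + x%:C * d) s d.
Proof.
split.
  rewrite (_ : (fun x => _) = (fun=> Re w) + id * (fun=> Re d)).
    by apply: is_derive_eq; rewrite /GRing.scale /=; ring.
  by apply: funext => x; rewrite !cE /= mul0r subr0.
rewrite (_ : (fun x => _) = (fun=> Im w) + id * (fun=> Im d)).
  by apply: is_derive_eq; rewrite /GRing.scale /=; ring.
by apply: funext => x; rewrite !cE /= mul0r addr0.
Qed.

Lemma is_cderiveV f s df : f s != 0 -> is_cderive f s df ->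
  is_cderive (fun x => (f x)^-1) s (- df / f s ^+ 2).
Proof.
move=> fs0 [f1 f2].
set a := fun x => Re (f x) in f1; set b := fun x => Im (f x) in f2.
have n0 : a s ^+ 2 + b s ^+ 2 != 0.
  by rewrite -cmod_sqr gt_eqF // exprn_gt0 // cmod_gt0.
have hn : is_derive s 1 (a * a + b * b) (2 * (a s * Re df + b s * Im df)).
  by apply: is_derive_eq; rewrite /GRing.scale /=; ring.
have n0' : (a * a + b * b) s != 0 by move: n0; rewrite !expr2.
have hV := is_deriveV n0' hn.
have hRe : Re (- df / f s ^+ 2) =
   Re (- df) * (Re (f s)^-1 * Re (f s)^-1 - Im (f s)^-1 * Im (f s)^-1)
   - Im (- df) * (2 * (Re (f s)^-1 * Im (f s)^-1)).
  by rewrite expr2 invfM !cE; ring.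
have hIm : Im (- df / f s ^+ 2) =
   Re (- df) * (2 * (Re (f s)^-1 * Im (f s)^-1)) +
   Im (- df) * (Re (f s)^-1 * Re (f s)^-1 - Im (f s)^-1 * Im (f s)^-1).
  by rewrite expr2 invfM !cE; ring.
split.
  rewrite hRe (_ : (fun x => _) = a * (fun x => ((a * a + b * b) x)^-1)).
    apply: is_derive_eq.
    rewrite ReV ImV !cE /GRing.scale /= !fctE -/(a s) -/(b s).
    by field; move: n0; rewrite ?expr2.
  by apply: funext => x; rewrite ReV !expr2.
rewrite hIm (_ : (fun x => _) = (- b) * (fun x => ((a * a + b * b) x)^-1)).
  apply: is_derive_eq.
  rewrite ReV ImV !cE /GRing.scale /= !fctE -/(a s) -/(b s).
  by field; move: n0; rewrite ?expr2.
by apply: funext => x; rewrite ImV !expr2.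
Qed.

(* Written without case analysis, so that it can be differentiated pointwise. *)
Definition upper_pow p z : C :=
  (expR (p / 2 * ln (Re z * Re z + Im z * Im z)))%:C
  * expi (p * (pi / 2 - atan (Re z * (Im z)^-1))).

Lemma cpow_upper z p : 0 < Im z -> cpow z p = upper_pow p z.
Proof.
move=> z0; rewrite /cpow /upper_pow Carg_atan // -!expr2 -cmod_sqr.
have r0 := cmod_gt0 (Im_gt0_neq0 z0).
by rewrite lnXn // /powR gt_eqF // mulr2n; congr ((expR _)%:C * _); field.
Qed.

(** The logarithm of the modulus and the phase have derivatives p Re (f' / f) and p Im (f' / f); the
    product rule joins them into p f' / f times the power. *)
Lemma is_cderive_upper_pow f s df p : 0 < Im (f s) -> is_cderive f s df ->
  is_cderive (fun x => upper_pow p (f x)) s (p%:C * (df / f s) * upper_pow p (f s)).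
Proof.
move=> b0 [f1 f2].
set a := fun x => Re (f x) in f1; set b := fun x => Im (f x) in f2 b0.
have n0 : 0 < a s ^+ 2 + b s ^+ 2 by rewrite ltr_wpDl ?sqr_ge0 ?exprn_gt0.
pose m := expR \o (cst (p / 2) * (@ln R \o (a * a + b * b))).
pose A := cst p * (cst (pi / 2) - (@atan R \o (a * (fun x => (b x)^-1)))).
have hb := is_deriveV (lt0r_neq0 b0) f2.
have hn : is_derive s 1 (a * a + b * b) (2 * (a s * Re df + b s * Im df)).
  by apply: is_derive_eq; rewrite /GRing.scale /=; ring.
have n0' : 0 < (a * a + b * b) s by have := n0; rewrite !expr2.
have hln := is_derive1_comp (is_derive1_ln n0') hn.
have hm : is_derive s 1 m (m s * (p * (a s * Re df + b s * Im df) / (a s ^+ 2 + b s ^+ 2))).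
  rewrite /m; have h1 : is_derive s 1 (cst (p / 2) * (@ln R \o (a * a + b * b))) _ := is_deriveM (is_derive_cst _ _ _) hln.
  apply: (is_derive_eq (is_derive1_comp (is_derive_expR _) h1)).
  rewrite /GRing.scale /= !fctE; field; move: n0; rewrite !expr2 => n0; rewrite gt_eqF //.
have hA : is_derive s 1 A (p * (a s * Im df - b s * Re df) / (a s ^+ 2 + b s ^+ 2)).
  have h1 : is_derive s 1 (a * (fun x => (b x)^-1)) _ := is_deriveM f1 hb.
  have h2 := is_derive1_comp (is_derive1_atan _) h1.
  rewrite /A; apply: is_derive_eq.
  rewrite /GRing.scale /= !fctE; field.
  by move: n0; rewrite !expr2 => n0; rewrite !gt_eqF.
have hc := is_derive1_comp (is_derive_cos _) hA.
have hs := is_derive1_comp (is_derive_sin _) hA.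
split.
  rewrite (_ : (fun x => _) = m * (@cos R \o A)); last first.
    by apply: funext => x; rewrite /upper_pow /expi !cE /= mul0r subr0.
  apply: is_derive_eq.
  rewrite /upper_pow /expi !cE ReV ImV /= /GRing.scale /= -/(a s) -/(b s).
  rewrite -[expR _]/(m s) -[p * (pi / 2 - _)]/(A s).
  by field; rewrite gt_eqF.
rewrite (_ : (fun x => _) = m * (@sin R \o A)); last first.
  by apply: funext => x; rewrite /upper_pow /expi !cE /= mul0r addr0.
apply: is_derive_eq.
rewrite /upper_pow /expi !cE ReV ImV /= /GRing.scale /= -/(a s) -/(b s).
rewrite -[expR _]/(m s) -[p * (pi / 2 - _)]/(A s).
by field; rewrite gt_eqF.
Qed.

Lemma is_cderive_const (f : R -> C) :
  (forall s : R, 0 <= s <= 1 -> is_cderive f s 0) -> f 1 = f 0.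
Proof.
move=> hf.
have H (g : R -> R) : (forall s : R, 0 <= s <= 1 -> is_derive s 1 g 0) -> g 1 = g 0.
  move=> hg; have : {within `[0, 1], continuous g}.
    apply: derivable_within_continuous => x; rewrite in_itv /= => /hg h.
    exact: (@ex_derive _ _ _ _ _ _ _ h).
  move=> /(@MVT_segment R g (fun=> 0) 0 1 ler01)[x|c _].
    by rewrite in_itv /= => /andP[x0 x1]; apply: hg; rewrite !ltW.
  by rewrite mul0r => /eqP; rewrite subr_eq0 => /eqP.
by apply: complexP; [apply: (H (Re \o f))|apply: (H (Im \o f))] => s /hf [].
Qed.

Variable alpha : R.

(* With F = 1/G the equation [ode] says that (F - w) F^(alpha - 1) has zero
   derivative. *)
Lemma power_relation (F F' : R -> C) (w d c : C) :
  (forall s : R, 0 <= s <= 1 -> 0 < Im (F s)) ->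
  (forall s : R, 0 <= s <= 1 -> is_cderive F s (F' s)) ->
  (forall s : R, 0 <= s <= 1 ->
    F' s * (alpha%:C * F s + (1 - alpha)%:C * (w + s%:C * d)) = d * F s) ->
  F 0 - w = c * cpow (F 0) (1 - alpha) ->
  F 1 - (w + d) = c * cpow (F 1) (1 - alpha).
Proof.
move=> Fp dF hode h0.
have i01 : (0 : R) <= (0 : R) <= (1 : R) by apply/andP; split; [exact: lexx|exact: ler01].
have i11 : (0 : R) <= (1 : R) <= (1 : R) by apply/andP; split; [exact: ler01|exact: lexx].
pose Q (s : R) := (F s - (w + s%:C * d)) * upper_pow (- (1 - alpha)) (F s).
have Q10 : Q 1 = Q 0.
  apply: is_cderive_const => s s01; have F0 := Im_gt0_neq0 (Fp s s01).
  have hp := is_cderive_upper_pow (- (1 - alpha)) (Fp s s01) (dF s s01).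
  have hl := is_cderiveM (is_cderive_cst (-1) s) (is_cderive_line w d s).
  have := is_cderiveM (is_cderiveD (dF s s01) hl) hp.
  rewrite (_ : (fun x => _) = Q); last by apply: funext => x; rewrite mulN1r.
  set E := upper_pow _ _; rewrite (_ : _ + _ = 0) //.
  rewrite !mulN1r mul0r add0r.
  have -> : (- (1 - alpha))%:C = alpha%:C - 1 by rewrite -rmorphB opprB.
  have h := hode s s01.
  have e1 : (1 - alpha)%:C = 1 - alpha%:C by rewrite -rmorphB.
  rewrite e1 in h.
  apply: (mulIf F0); rewrite mul0r.
  (* Up to the nonzero factor F, the derivative of [Q] is the defect of the differential equation
     times the power [E]. *)
  transitivity ((F' s * (alpha%:C * F s + (1 - alpha%:C) * (w + s%:C * d)) - d * F s) * E).
    by field.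
  by rewrite h subrr mul0r.
have cu (s : R) : 0 <= s <= 1 -> cpow (F s) (1 - alpha) * upper_pow (- (1 - alpha)) (F s) = 1.
  by move=> s01; rewrite -cpow_upper ?cpowN_inv //; exact: Fp.
have cn : upper_pow (- (1 - alpha)) (F 1) != 0.
  by apply/eqP => h; have := cu 1 i11; rewrite h mulr0 => /eqP; rewrite eq_sym oner_eq0.
apply: (mulIf cn); rewrite -mulrA cu // mulr1.
move: Q10; rewrite /Q mul1r => ->; rewrite mul0r addr0 h0 -mulrA cu // mulr1 //.
Qed.

End polar.

(** * The functional equation H (F w) = w on the half-plane *)

Section relation.
Variable R : realType.
Local Notation C := R[i].
Local Notation Re := (@complex.Re R).
Local Notation Im := (@complex.Im R).

Lemma is_derive_quad (f : R -> R) (s df K dl : R) : 0 < dl ->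
  (forall h : R, `|h| < dl -> `|f (h + s) - f s - h * df| <= K * h ^+ 2) ->
  is_derive s 1 f df.
Proof.
move=> dl0 hf.
have hc : h^-1 *: (f (h *: 1 + s) - f s) @[h --> 0^'] --> df.
  apply/subr_cvg0; apply/norm_cvg0P.
  apply: (@squeeze_cvgr _ _ _ _ (fun=> 0) (fun h : R => K * `|h|)).
  - near=> h; rewrite normr_ge0 /= [h *: 1]mulr1.
    have h0 : h != 0 by near: h; exact: nbhs_dnbhs_neq.
    have hd : `|h| < dl.
      near: h; exact: dnbhs0_lt.
    have -> : h^-1 *: (f (h + s) - f s) - df = h^-1 * (f (h + s) - f s - h * df).
      by rewrite /GRing.scale /=; field.
    rewrite normrM normfV mulrC ler_pdivrMr ?normr_gt0 //.
    by rewrite -mulrA -expr2 real_normK ?num_real //; exact: hf.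
  - exact: cvg_cst.
  - rewrite -[X in _ --> X](mulr0 K); apply: cvgM; first exact: cvg_cst.
    by apply/norm_cvg0P; exact: nbhs_dnbhs.
apply: DeriveDef; first by apply/cvg_ex; exists df.
exact: cvg_lim hc.
Unshelve. all: by end_near. Qed.

Lemma is_cderive_quad (f : R -> C) (s : R) (df : C) (K dl : R) : 0 < dl ->
  (forall h : R, `|h| < dl -> cmod (f (h + s) - f s - h%:C * df) <= K * h ^+ 2) ->
  is_cderive f s df.
Proof.
move=> dl0 hf; split; apply: (is_derive_quad dl0 (K := K)) => h hd;
  apply: (le_trans _ (hf h hd)).
  by apply: (le_trans _ (Re_le _)); rewrite !cE /= mul0r subr0.
by apply: (le_trans _ (Im_le _)); rewrite !cE /= mul0r addr0.
Qed.

Variable mu : probability (measurableTypeR R) R.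
Local Notation G := (cauchy_transform mu).
Local Notation G1 := (cauchy_deriv mu).

Lemma is_cderive_cauchy (w d : C) (s : R) : 0 < Im (w + s%:C * d) ->
  is_cderive (fun x : R => G (w + x%:C * d)) s (d * G1 (w + s%:C * d)).
Proof.
set p := w + s%:C * d => p0.
pose D := cmod d + 1; have D0 : 0 < D by rewrite ltr_wpDl ?cmod_ge0.
pose dl := Im p / 2 / D; have dl0 : 0 < dl by rewrite !divr_gt0.
apply: (@is_cderive_quad _ _ _ (2 * (D ^+ 2 * ((Im p)^-1 ^+ 2 * (Im p / 2)^-1))) dl) => // h hd.
have -> : w + (h + s)%:C * d = p + h%:C * d by rewrite rmorphD /p; ring.
have hle : cmod (h%:C * d) <= `|h| * D by rewrite cmodM cmodR ler_wpM2l // lerDl.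
have hlt : cmod (h%:C * d) < Im p / 2.
  by apply: (le_lt_trans hle); rewrite -ltr_pdivlMr.
have hlt' : cmod (h%:C * d) < Im p by lra.
rewrite mulrA; apply: (le_trans (cauchy_diff mu p0 hlt')).
have hI : Im p / 2 <= Im (p + h%:C * d).
  by rewrite ImD; have := Im_le (h%:C * d); rewrite ler_norml; lra.
rewrite -mulrA; apply: ler_wpM2l => //.
rewrite [leRHS](_ : _ = (`|h| * D) ^+ 2 * ((Im p)^-1 ^+ 2 / (Im p / 2))); last first.
  by rewrite exprMn real_normK ?num_real //; ring.
have v2 : 0 < Im p / 2 by rewrite divr_gt0.
have v3 : 0 < Im (p + h%:C * d) by apply: lt_le_trans hI.
apply: ler_pM.
- by rewrite exprn_ge0 // cmod_ge0.
- by rewrite mulr_ge0 // ?exprn_ge0 // invr_ge0 ltW.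
- by rewrite lerXn2r ?nnegrE ?cmod_ge0 // mulr_ge0 // ltW.
- by rewrite ler_wpM2l ?exprn_ge0 ?invr_ge0 ?(ltW p0) // lef_pV2 ?posrE.
Qed.

Variables (alpha k : R).

(* What the Voiculescu transform [- expi k * z ^ (1 - alpha)] imposes on the
   imaginary half-axis; it already determines the measure. *)
Definition axis_relation : Prop :=
  exists2 M, 0 < M & forall y, M < y ->
    let w := axis_curve alpha (expi k * expi ((1 - alpha) * (pi / 2))) y in
    0 < Im w /\ G w = (y *i)^-1.

Hypothesis hax : axis_relation.

Lemma Im_F_gt0 (w : C) : 0 < Im w -> 0 < Im (G w)^-1.
Proof.
move=> w0; have := Im_cauchy_lt0 mu w0 => h.
rewrite ImV divr_gt0 ?oppr_gt0 // ltr_wpDl ?sqr_ge0 // exprn_even_gt0 //= lt_eqF //.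
Qed.

Lemma segment_Im_gt0 (a b : C) (s : R) : 0 < Im a -> 0 < Im b -> 0 <= s <= 1 ->
  0 < Im (a + s%:C * (b - a)).
Proof.
move=> a0 b0 /andP[s0 s1]; rewrite !cE /= mul0r addr0.
have [->|s1'] := eqVneq s 1; first by rewrite mul1r addrC subrK.
have s1'' : s < 1 by rewrite lt_neqAle s1' s1.
have h1 : 0 < (1 - s) * Im a by rewrite mulr_gt0 // subr_gt0.
by have h2 : 0 <= s * Im b by [rewrite mulr_ge0 // ltW]; lra.
Qed.

Lemma cpow_iy (y p : R) : 0 < y -> cpow (y *i) p = (y `^ p)%:C * expi (p * (pi / 2)).
Proof.
move=> y0; rewrite /cpow Carg_atan //= mul0r atan0 subr0.
by rewrite cmodE /= expr0n add0r sqrtr_sqr gtr0_norm.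
Qed.

(** The relation holds by hypothesis at a point of the curve and is carried to w along a segment,
    which stays in the convex half-plane. *)
Lemma F_relation (w : C) : 0 < Im w ->
  (G w)^-1 - w = expi k * cpow (G w)^-1 (1 - alpha).
Proof.
move=> w0; have [M M0 hM] := hax.
set c := expi k * expi _ in hM.
pose y := M + 1; have My : M < y by rewrite ltrDl.
have y0 : 0 < y by apply: lt_trans My.
have hode : forall z, 0 < Im z -> ode mu alpha z = 0.
  move=> z z0; apply: (@ode_upper_half R mu alpha c M M0) => //.
    by move=> u /hM [].
  by move=> u /hM [].
have [g0 gG] := hM y My; set gy := axis_curve alpha c y in g0 gG.
pose d := w - gy.
have pos (s : R) : 0 <= s <= 1 -> 0 < Im (gy + s%:C * d).
  exact: segment_Im_gt0.
have := @power_relation R alpha (fun s => (G (gy + s%:C * d))^-1)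
  (fun s => - (d * G1 (gy + s%:C * d)) / G (gy + s%:C * d) ^+ 2) gy d (expi k).
rewrite !(mul0r, mul1r, addr0) /d subrKC; apply.
- by move=> s s01; apply: Im_F_gt0; exact: pos.
- move=> s s01; have p0 := pos s s01; apply: is_cderiveV; last exact: is_cderive_cauchy.
  apply/eqP => h; have := Im_cauchy_lt0 mu p0; rewrite -/d h ltxx //.
- move=> s s01; have p0 := pos s s01; have := hode _ p0; rewrite /ode -/d.
  have G0 : G (gy + s%:C * d) != 0.
    by apply/eqP => h; have := Im_cauchy_lt0 mu p0; rewrite h ltxx.
  set z := gy + s%:C * d in G0 *; set g := G z in G0 *; set g1 := G1 z => h.
  (* The equation required of 1 / G is [ode] multiplied by - d / G^3, up to the term d / G. *)
  transitivity (- d * (alpha%:C * g1 + (1 - alpha)%:C * (z * (g * g1)) + g * g) / g ^+ 3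
     + d * g^-1).
    by field.
  by rewrite h mulr0 mul0r add0r.
- rewrite gG invrK cpow_iy // /gy /axis_curve /c opprB addrCA subrr addr0; ring.
Qed.

(** Real and imaginary parts of H (F w) = w at F w = r e^(i t). The bound on Im G, its boundary
    values and the range of [theta_x] all rest on these real equations. *)
Lemma polar_relation (w : C) : 0 < Im w -> exists r t : R,
  [/\ 0 < r, 0 < t < pi,
    Re w = r * cos t - r `^ (1 - alpha) * cos (k + (1 - alpha) * t),
    Im w = r * sin t - r `^ (1 - alpha) * sin (k + (1 - alpha) * t) &
    Im (G w) = - (sin t / r)].
Proof.
move=> w0; have F0 := Im_F_gt0 w0; have rel := F_relation w0.
have [t0 tpi hR hI] := Carg_polar F0.
set F := (G w)^-1 in F0 rel t0 tpi hR hI.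
have r0 := cmod_gt0 (Im_gt0_neq0 F0).
have hw : w = F - expi k * cpow F (1 - alpha) by rewrite -rel; ring.
have GF : G w = F^-1 by rewrite invrK.
clearbody F; exists (cmod F), (Carg F); split => //; first by rewrite t0.
- rewrite {1}hw /cpow !cE /= !mul0r subr0 addr0 {1}hR cosD; ring.
- rewrite {1}hw /cpow !cE /= !mul0r subr0 addr0 {1}hI sinD; ring.
- rewrite GF ImV -cmod_sqr {1}hI; field; rewrite gt_eqF //.
Qed.

End relation.

Section trig.
Variable R : realType.

Lemma powRD_gt0 (x r s : R) : 0 < x -> x `^ (r + s) = x `^ r * x `^ s.
Proof. by move=> x0; rewrite powRD // (gt_eqF x0) implybT. Qed.

Lemma powRB_gt0 (x r s : R) : 0 < x -> x `^ (r - s) = x `^ r / x `^ s.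
Proof. by move=> x0; rewrite powRD_gt0 // powRN. Qed.

Lemma powR_split (x p : R) : 0 < x -> x `^ (1 - p) * x `^ p = x.
Proof. by move=> x0; rewrite -powRD_gt0 // subrK powRr1 // ltW. Qed.

Variables alpha rho : R.
Hypothesis alpha01 : 0 < alpha < 1.
Hypothesis rho01 : 0 <= rho < 1.

(** * The parametrization by the angle *)

Let k : R := alpha * rho * pi.
Let b (t : R) : R := k + (1 - alpha) * t.

Definition theta_x (t : R) : R :=
  sin t `^ (- alpha^-1) * sin (alpha * rho * pi + (1 - alpha) * t) `^ (alpha^-1 - 1)
  * sin (alpha * rho * pi - alpha * t).

Definition theta_psi (t : R) : R :=
  pi^-1 * sin t `^ (1 + alpha^-1)
  * sin (alpha * rho * pi + (1 - alpha) * t) `^ (- alpha^-1).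

Lemma phase_range (t : R) : 0 < t < pi -> 0 < b t < pi.
Proof.
move=> /andP[t0 t1]; have /andP[a0 a1] := alpha01; have /andP[r0 r1] := rho01.
have p0 := pi_gt0 R; rewrite /b /k.
have h1 : 0 <= alpha * rho * pi by rewrite !mulr_ge0 // ltW.
have h2 : 0 < (1 - alpha) * t by rewrite mulr_gt0 // subr_gt0.
have h3 : (1 - alpha) * t < (1 - alpha) * pi by rewrite ltr_pM2l // subr_gt0.
have h4 : alpha * rho * pi < alpha * pi.
  by rewrite ltr_pM2r // -[ltRHS]mulr1 ltr_pM2l.
by apply/andP; split; lra.
Qed.

Lemma sin_phase_gt0 (t : R) : 0 < t < pi -> 0 < sin (b t).
Proof. by move=> /phase_range; exact: sin_gt0_pi. Qed.

(* The modulus of the point of argument t in the upper half-plane at which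
   z - expi k * z ^ (1 - alpha) is real. *)
Definition theta_r (t : R) : R := sin (b t) `^ alpha^-1 * sin t `^ (- alpha^-1).

Lemma theta_r_gt0 t : 0 < t < pi -> 0 < theta_r t.
Proof.
by move=> ht; rewrite mulr_gt0 // powR_gt0 ?sin_phase_gt0 // sin_gt0_pi.
Qed.

Lemma theta_rP (r t : R) : 0 < r -> 0 < t < pi ->
  (r * sin t == r `^ (1 - alpha) * sin (b t)) = (r == theta_r t).
Proof.
move=> r0 ht; have /andP[a0 a1] := alpha01.
have P0 := sin_gt0_pi ht; have S0 := sin_phase_gt0 ht.
have rn : r != 0 by rewrite gt_eqF.
have rE : r `^ (1 - alpha) * r `^ alpha = r.
  exact: powR_split.
have ra0 : 0 < r `^ (1 - alpha) by exact: powR_gt0.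
have tE : theta_r t `^ alpha = sin (b t) / sin t.
  rewrite /theta_r powRM ?powR_ge0 // -!powRrM mulNr mulVf ?gt_eqF //.
  by rewrite powRr1 ?ltW // powR_inv1 // ltW.
apply/eqP/eqP => [h|->].
  have : r `^ alpha = theta_r t `^ alpha.
    rewrite tE; apply: (mulfI (lt0r_neq0 ra0)); rewrite rE.
    by apply: (mulIf (lt0r_neq0 P0)); rewrite h mulrA divfK // gt_eqF.
  by apply: powR_injective; rewrite ?nnegrE // ltW // theta_r_gt0.
have t0 := theta_r_gt0 ht.
have {1}<- : theta_r t `^ (1 - alpha) * theta_r t `^ alpha = theta_r t.
  exact: powR_split.
by rewrite tE -mulrA divfK // gt_eqF.
Qed.

(** On this curve r^(1 - alpha) = r sin t / sin (b t), so the real part is r sin (b t - t) / sin (b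
    t), and b t - t is the angle in the last factor of [theta_x]. *)
Lemma theta_x_polar (t : R) (r := theta_r t) : 0 < t < pi ->
  r * cos t - r `^ (1 - alpha) * cos (b t) = theta_x t.
Proof.
move=> ht; have /andP[a0 a1] := alpha01.
have P0 := sin_gt0_pi ht; have S0 := sin_phase_gt0 ht.
have r0 := theta_r_gt0 ht; rewrite -/r in r0.
have /eqP : r * sin t == r `^ (1 - alpha) * sin (b t) by rewrite theta_rP.
move=> h; have <- : r * sin t / sin (b t) = r `^ (1 - alpha) by rewrite h mulfK ?gt_eqF.
rewrite /theta_x (_ : alpha * rho * pi - alpha * t = b t - t); last by rewrite /b /k; ring.
rewrite (powRB_gt0 _ _ S0).
rewrite -/k -/(b t) (powRr1 (ltW S0)) sinB /r /theta_r; field; rewrite gt_eqF //.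
Qed.

Lemma theta_psi_polar (t : R) : 0 < t < pi ->
  pi^-1 * (sin t / theta_r t) = theta_psi t.
Proof.
move=> ht; have P0 := sin_gt0_pi ht; have S0 := sin_phase_gt0 ht.
rewrite /theta_psi /theta_r -mulrA; congr (_ * _).
rewrite (powRD_gt0 _ _ P0).
by rewrite (powRr1 (ltW P0)) !powRN; field; rewrite !gt_eqF ?powR_gt0.
Qed.

Lemma theta_psi_gt0 t : 0 < t < pi -> 0 < theta_psi t.
Proof.
move=> ht; have P0 := sin_gt0_pi ht; have S0 := sin_phase_gt0 ht.
by rewrite !mulr_gt0 ?invr_gt0 ?pi_gt0 // powR_gt0.
Qed.

Lemma theta_x_deriv (t : R) : 0 < t < pi ->
  exists2 d, d < 0 & is_derive t 1 theta_x d.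
Proof.
move=> ht; have /andP[a0 a1] := alpha01.
have P0 := sin_gt0_pi ht; have S0 := sin_phase_gt0 ht.
set P := sin t in P0; set S := sin (b t) in S0.
pose A := P `^ (- alpha^-1); pose B := S `^ (alpha^-1 - 1).
have A0 : 0 < A by exact: powR_gt0.
have B0 : 0 < B by exact: powR_gt0.
pose D := sin (b t - t); pose C := cos (b t); pose c := cos t.
(* The sum of squares is (S / r)^2 |alpha z + (1 - alpha) x|^2 for z = r e^(i t), r = [theta_r t], x
   = [theta_x t], and alpha z + (1 - alpha) x equals z H'(z). Its imaginary part is positive, whence
   the strict sign. *)
exists (- (A * B / (alpha * P * S) * ((D + alpha * P * C) ^+ 2 + (alpha * P * S) ^+ 2))).
  rewrite oppr_lt0 mulr_gt0 ?divr_gt0 ?mulr_gt0 //.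
  by rewrite ltr_wpDl ?sqr_ge0 // exprn_gt0 // !mulr_gt0.
have hb : is_derive t 1 b (1 - alpha).
  rewrite (_ : b = cst k + (cst (1 - alpha) * id)) //.
  by apply: is_derive_eq; rewrite /GRing.scale /=; ring.
have hdl : is_derive t 1 (fun s => alpha * rho * pi - alpha * s) (- alpha).
  rewrite (_ : (fun s => _) = cst k - (cst alpha * id)) //.
  by apply: is_derive_eq; rewrite /GRing.scale /=; ring.
have h1 := is_derive1_comp (is_derive1_powR (- alpha^-1) P0) (is_derive_sin t).
have hS := is_derive1_comp (is_derive_sin (b t)) hb.
have h2 := is_derive1_comp (is_derive1_powR (alpha^-1 - 1) S0) hS.
have h3 := is_derive1_comp (is_derive_sin _) hdl.
rewrite (_ : theta_x = ((@powR R)^~ (- alpha^-1) \o @sin R) * ((@powR R)^~ (alpha^-1 - 1) \o (@sin R \o b))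
   * (@sin R \o (fun s => alpha * rho * pi - alpha * s))) //.
apply: is_derive_eq; rewrite /GRing.scale /= !fctE.
have pd (x y : R) : 0 < x -> x `^ (y - 1) = x `^ y / x.
  by move=> x0; rewrite powRB_gt0 // powRr1 // ltW.
rewrite !pd // -/P -/S.
have -> : alpha * rho * pi - alpha * t = b t - t by rewrite /b /k; ring.
rewrite -/A -/D -/C -/c -(pd S alpha^-1 S0) -/B.
have cD : cos (b t - t) = C * c + S * P by rewrite cosB.
have DE : D = S * c - C * P by rewrite /D sinB.
rewrite cD [LHS](_ : _ = A * B / (alpha * P * S) *
  (- (alpha ^+ 2 * (C * c + S * P) * P * S) + (1 - alpha) ^+ 2 * D * C * P - D * c * S)).
  by rewrite -[RHS]mulrN; congr (_ * _); rewrite DE; ring.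
by field; rewrite !gt_eqF.
Qed.

Lemma theta_x_decr (s t : R) : 0 < s -> s < t -> t < pi -> theta_x t < theta_x s.
Proof.
move=> s0 st tp.
pose d x := 'D_1 theta_x x.
have hd x : 0 < x < pi -> is_derive x 1 theta_x (d x) /\ d x < 0.
  move=> /theta_x_deriv [e e0 he]; have := he => -[h1 h2].
  by split; [apply: DeriveDef|rewrite /d h2].
have sub x : s <= x <= t -> 0 < x < pi by move=> /andP[h1 h2]; apply/andP; split; lra.
have cont : {within `[s, t], continuous theta_x}.
  apply: derivable_within_continuous => x; rewrite in_itv /= => /sub /hd [h _].
  exact: (@ex_derive _ _ _ _ _ _ _ h).
have hd' x : x \in `]s, t[ -> is_derive x 1 theta_x (d x).
  by rewrite in_itv /= => /andP[h1 h2]; apply: (hd x (sub x _)).1; rewrite !ltW.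
have [c] := MVT st hd' cont.
rewrite in_itv /= => /andP[h1 h2] hE.
have cs : s <= c <= t by rewrite !ltW.
have [_ d0] := hd c (sub c cs).
by rewrite -subr_lt0 hE nmulr_rlt0 // subr_gt0.
Qed.

Lemma theta_x_inj (s t : R) : 0 < s < pi -> 0 < t < pi -> theta_x s = theta_x t -> s = t.
Proof.
move=> /andP[s0 s1] /andP[t0 t1] h.
case: (ltgtP s t) => // st.
  by have := theta_x_decr s0 st t1; rewrite h ltxx.
by have := theta_x_decr t0 st s1; rewrite h ltxx.
Qed.

(* Concavity of [sin], as [b t] is a convex combination of [rho pi] and [t]. *)
Lemma sin_phase_ge (t : R) : 0 < t < pi -> (1 - alpha) * sin t <= sin (b t).
Proof.
move=> /andP[t0 tp]; have /andP[a0 a1] := alpha01; have /andP[r0 r1] := rho01.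
have p0 := pi_gt0 R.
pose f (x : R) := sin (b x) - (1 - alpha) * sin x.
pose df (x : R) := (1 - alpha) * (cos (b x) - cos x).
have hf (x : R) : is_derive x 1 f (df x).
  have hb : is_derive x 1 b (1 - alpha).
    rewrite (_ : b = cst k + (cst (1 - alpha) * id)) //.
    by apply: is_derive_eq; rewrite /GRing.scale /=; ring.
  have h1 := is_derive1_comp (is_derive_sin (b x)) hb.
  rewrite (_ : f = (@sin R \o b) - (cst (1 - alpha) * @sin R)) //.
  by apply: is_derive_eq; rewrite /GRing.scale /= /df; ring.
(* The fixed point of [b]. As b x - x = alpha (m - x), f decreases before m and increases after it,
   and f m = alpha sin m is nonnegative. *)
pose m := rho * pi.
have m0 : 0 <= m by rewrite mulr_ge0 // ltW.
have mp : m < pi by rewrite -[ltRHS]mul1r ltr_pM2r.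
have fm : 0 <= f m.
  rewrite /f (_ : b m = m); last by rewrite /b /k /m; ring.
  rewrite -[X in X - _]mul1r -mulrBl mulr_ge0 //; first by lra.
  by apply: sin_ge0_pi; rewrite m0 ltW.
have bE x : b x - x = alpha * (m - x) by rewrite /b /k /m; ring.
have cont u v : {within `[u, v], continuous f}.
  by apply: derivable_within_continuous => x _; exact: (@ex_derive _ _ _ _ _ _ _ (hf x)).
rewrite -subr_ge0 -/(f t); apply: (le_trans fm).
case: (ltgtP t m) => [tm|mt|->] //.
  have [c] := MVT tm (fun x _ => hf x) (cont t m).
  rewrite in_itv /= => /andP[h1 h2] hE.
  rewrite -subr_le0 hE pmulr_lle0 ?subr_gt0 // pmulr_rle0 ?subr_gt0 // subr_le0.
  have h3 : 0 < alpha * (m - c) by rewrite mulr_gt0 // subr_gt0.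
  have hc : 0 < c < pi by apply/andP; split; lra.
  have h4 := bE c; have /andP[h5 h6] := phase_range hc.
  by rewrite ltW // ltr_cos ?in_itv /=; lra.
have [c] := MVT mt (fun x _ => hf x) (cont m t).
rewrite in_itv /= => /andP[h1 h2] hE.
rewrite -subr_ge0 hE pmulr_lge0 ?subr_gt0 // pmulr_rge0 ?subr_gt0 // subr_ge0.
have h3 : 0 < alpha * (c - m) by rewrite mulr_gt0 // subr_gt0.
have hc : 0 < c < pi by apply/andP; split; lra.
have h4 := bE c; have /andP[h5 h6] := phase_range hc.
by rewrite ltW // ltr_cos ?in_itv /=; lra.
Qed.

(** The tangent at 1 to the concave power, obtained from Young's inequality with second factor 1. *)
Lemma powR_tangent (u p : R) : 0 <= u -> 0 < p < 1 -> u `^ p <= p * u + (1 - p).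
Proof.
move=> u0 /andP[p0 p1]; have p1' : 0 < 1 - p by lra.
have := @conjugate_powR R (u `^ p) 1 p^-1 (1 - p)^-1.
rewrite powR_ge0 ler01 !invr_gt0 p0 p1' !invrK mulr1 powR1 mul1r -powRrM divff ?gt_eqF //.
by rewrite powRr1 // [u * p]mulrC; apply => //; ring.
Qed.

End trig.

(** The difference vanishes at 0 and has derivative l (cos (l x) - cos x) > 0. Strictness is what
    keeps [theta_x] away from the edge of the support. *)
Lemma sin_scale_gt (R : realType) (l t : R) : 0 < l < 1 -> 0 < t < pi ->
  l * sin t < sin (l * t).
Proof.
move=> /andP[l0 l1] /andP[t0 tp].
pose f (x : R) := sin (l * x) - l * sin x.
pose df (x : R) := l * (cos (l * x) - cos x).
have hf (x : R) : is_derive x 1 f (df x).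
  have hb : is_derive x 1 (cst l * id) l.
    by apply: is_derive_eq; rewrite /GRing.scale /=; ring.
  have h1 := is_derive1_comp (is_derive_sin ((cst l * id) x)) hb.
  rewrite (_ : f = (@sin R \o (cst l * id)) - (cst l * @sin R)) //.
  by apply: is_derive_eq; rewrite /GRing.scale /= /df !fctE /=; ring.
have cont : {within `[0, t], continuous f}.
  by apply: derivable_within_continuous => x _; exact: (@ex_derive _ _ _ _ _ _ _ (hf x)).
have [c] := MVT t0 (fun x _ => hf x) cont; rewrite in_itv /= => /andP[c0 ct].
rewrite {2}/f mulr0 sin0 mulr0 !subr0 => hE.
rewrite -subr_gt0 -/(f t) hE mulr_gt0 // mulr_gt0 // subr_gt0.
have h : l * c < c by rewrite -[ltRHS]mul1r ltr_pM2r.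
have h' : 0 < l * c by rewrite mulr_gt0.
by rewrite ltr_cos // in_itv /=; apply/andP; split; lra.
Qed.

Section boundary.
Variable R : realType.
Local Notation C := R[i].
Local Notation Re := (@complex.Re R).
Local Notation Im := (@complex.Im R).

Lemma cluster_image (T U : topologicalType) (X : Type) (F : set_system X)
    (p : X -> T) (f : T -> U) (q : T) :
  cluster (p @ F) q -> {for q, continuous f} -> cluster ((fun x => f (p x)) @ F) (f q).
Proof.
move=> hq cf A B FA nB.
have [z [Az Bz]] := hq (f @^-1` A) (f @^-1` B) FA (cf _ nB).
by exists (f z).
Qed.

Lemma cluster_lim (X : Type) (F : set_system X) (f : X -> R) (l c : R) :
  f @ F --> l -> cluster (f @ F) c -> l = c.
Proof.
move=> fl fc; apply: (@Rhausdorff R) => A B nA nB.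
by apply: fc => //; exact: fl.
Qed.

(** * Boundary values *)

Variables alpha rho : R.
Hypothesis alpha01 : 0 < alpha < 1.
Hypothesis rho01 : 0 <= rho < 1.
Let k : R := alpha * rho * pi.
Let b (t : R) : R := k + (1 - alpha) * t.

(** The minimum of r - r^(1 - alpha) over r > 0, that is, of H on the positive half-line when rho =
    0. *)
Definition stable_edge : R := - (alpha * (1 - alpha) `^ (alpha^-1 - 1)).

Lemma sub_powR_ge_edge (r : R) : 0 < r -> stable_edge <= r - r `^ (1 - alpha).
Proof.
move=> r0; have /andP[a0 a1] := alpha01; have a1' : 0 < 1 - alpha by lra.
(* The critical point of r - r^(1 - alpha), where equality holds; the tangent inequality is applied
   to r / r1. *)
pose r1 := (1 - alpha) `^ alpha^-1.
have r10 : 0 < r1 by exact: powR_gt0.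
have r1a : r1 `^ alpha = 1 - alpha by rewrite /r1 -powRrM mulVf ?gt_eqF // powRr1 // ltW.
have r1b : r1 `^ (1 - alpha) = r1 / (1 - alpha).
  by rewrite -{2}(powR_split alpha r10) r1a mulfK // gt_eqF.
have -> : stable_edge = r1 - r1 `^ (1 - alpha).
  rewrite /stable_edge powRB_gt0 // -/r1 powRr1 ?(ltW a1') // r1b; field; rewrite gt_eqF //.
have h := @powR_tangent R (r / r1) (1 - alpha) (divr_ge0 (ltW r0) (ltW r10)).
have {}h : (r / r1) `^ (1 - alpha) <= (1 - alpha) * (r / r1) + alpha.
  by apply: (le_trans (h _)); [apply/andP; split; lra|rewrite lerD2l; lra].
have e : r `^ (1 - alpha) = (r / r1) `^ (1 - alpha) * (r1 / (1 - alpha)).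
  rewrite -r1b -powRM ?divfK // ?gt_eqF // ?divr_ge0 ?ltW //.
rewrite e; have := ler_wpM2r (_ : 0 <= r1 / (1 - alpha)) h.
rewrite divr_ge0 ?(ltW r10) ?(ltW a1') // => /(_ isT).
have -> : ((1 - alpha) * (r / r1) + alpha) * (r1 / (1 - alpha)) = r + r1 * (alpha / (1 - alpha)).
  by field; rewrite !gt_eqF.
rewrite r1b => h2.
have h3 : r1 / (1 - alpha) = r1 + r1 * (alpha / (1 - alpha)).
  by field; rewrite !gt_eqF.
move: h2 h3; set q := r1 / _; set q' := r1 * _; set A := _ `^ _ * q.
by move=> h2 h3; lra.
Qed.

Lemma theta_x_lt_edge (t : R) : rho = 0 -> 0 < t < pi -> theta_x alpha rho t < stable_edge.
Proof.
move=> r0 ht; have /andP[a0 a1] := alpha01; have a1' : 0 < 1 - alpha by lra.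
rewrite /theta_x /stable_edge r0 mulr0 mul0r add0r sub0r sinN mulrN ltrN2.
have P0 := sin_gt0_pi ht; set P := sin t in P0 *.
have h1 : alpha * P < sin (alpha * t) by apply: sin_scale_gt.
have h2 : (1 - alpha) * P < sin ((1 - alpha) * t).
  by apply: sin_scale_gt => //; apply/andP; split; lra.
have e0 : 0 < alpha^-1 - 1 by rewrite subr_gt0 invf_gt1.
have h3 : ((1 - alpha) * P) `^ (alpha^-1 - 1) < sin ((1 - alpha) * t) `^ (alpha^-1 - 1).
  apply: gt0_ltr_powR => //; rewrite ?nnegrE ?mulr_ge0 ?(ltW a1') ?(ltW P0) //.
  by apply: ltW; apply: lt_trans h2; rewrite mulr_gt0.
(* Replacing the two sines by alpha P and (1 - alpha) P makes all powers of P cancel, since -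
   1/alpha + (1/alpha - 1) + 1 = 0. *)
have -> : alpha * (1 - alpha) `^ (alpha^-1 - 1) =
  P `^ (- alpha^-1) * ((1 - alpha) * P) `^ (alpha^-1 - 1) * (alpha * P).
  rewrite powRM ?(ltW a1') ?(ltW P0) // [P `^ (_ - 1)]powRB_gt0 // powRr1 ?(ltW P0) // powRN.
  by field; rewrite !gt_eqF // powR_gt0.
have A0 : 0 < P `^ (- alpha^-1) by exact: powR_gt0.
apply: ltr_pM => //; rewrite ?mulr_ge0 ?powR_ge0 ?(ltW a0) ?(ltW P0) //.
by rewrite ltr_pM2l.
Qed.

(** The value 0 off the range of [theta_x] is the true boundary value for x <> 0: there only t = 0
    can occur, where sin t / r = 0. *)
Definition stable_density (x : R) : R :=
  if pselect (exists t, 0 < t < pi /\ theta_x alpha rho t = x) is left h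
  then theta_psi alpha rho (projT1 (cid h)) else 0.

Lemma stable_densityE (t : R) : 0 < t < pi ->
  stable_density (theta_x alpha rho t) = theta_psi alpha rho t.
Proof.
move=> ht; rewrite /stable_density; case: pselect => [h|]; last first.
  by move=> nh; case: nh; exists t.
case: (cid h) => s [h1 h2] /=.
by congr theta_psi; exact: (theta_x_inj alpha01 rho01 h1 ht h2).
Qed.

Lemma stable_density_out (x : R) : (forall t, 0 < t < pi -> theta_x alpha rho t <> x) ->
  stable_density x = 0.
Proof.
by move=> hx; rewrite /stable_density; case: pselect => [h|//]; case: (cid h) => t [h1 h2]; case: (hx t h1).
Qed.

Lemma stable_density_ge0 (x : R) : 0 <= stable_density x.
Proof.
rewrite /stable_density; case: pselect => [h|//]; case: (cid h) => s [h1 h2] /=.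
by apply: ltW; exact: theta_psi_gt0.
Qed.

Variable mu : probability (measurableTypeR R) R.
Local Notation G := (cauchy_transform mu).
Hypothesis hax : axis_relation mu alpha k.

Definition poisson_bound : R := ((1 - alpha) `^ alpha^-1)^-1.

(** Im w > 0 together with [sin_phase_ge] forces r^alpha > 1 - alpha, so sin t / r is bounded.
    Uniformity on the half-plane is used both for dominated convergence and to exclude atoms. *)
Lemma Im_cauchy_bound (w : C) : 0 < Im w -> 0 <= - Im (G w) <= poisson_bound.
Proof.
move=> w0; have /andP[a0 a1] := alpha01; have a1' : 0 < 1 - alpha by lra.
have [r [t [r0 ht _ hI ->]]] := polar_relation hax w0.
have P0 := sin_gt0_pi ht; rewrite opprK divr_ge0 ?(ltW P0) ?(ltW r0) //=.
have hS := sin_phase_ge alpha01 rho01 ht.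
have ra0 : 0 < r `^ (1 - alpha) by exact: powR_gt0.
have h1 : r `^ (1 - alpha) * ((1 - alpha) * sin t) < r `^ (1 - alpha) * (r `^ alpha * sin t).
  apply: (@le_lt_trans _ _ (r `^ (1 - alpha) * sin (k + (1 - alpha) * t))).
    by rewrite ler_pM2l.
  by rewrite mulrA powR_split // -subr_gt0 -hI.
have h2 : 1 - alpha < r `^ alpha by move: h1; rewrite ltr_pM2l // ltr_pM2r.
have h3 : (1 - alpha) `^ alpha^-1 <= r.
  have -> : r = (r `^ alpha) `^ alpha^-1 by rewrite -powRrM divff ?gt_eqF // powRr1 // ltW.
  by apply: ge0_ler_powR; rewrite ?nnegrE ?invr_ge0 ?powR_ge0 ?ltW.
rewrite /poisson_bound ler_pdivrMr // mulrC ler_pdivlMr ?powR_gt0 //.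
by rewrite -[leRHS]mulr1 mulrC; apply: ler_pM => //; rewrite ?powR_ge0 ?ltW // ltW // sin_le1.
Qed.

Let w (x : R) (n : nat) : C := x +i* (n.+1%:R)^-1.

(** The polar coordinates of 1 / G at [w x n] remain in a compact rectangle, and the equations pass
    to a cluster point, which may sit at t = 0 or t = pi. The filter is kept general so that any
    subsequence can be tested. *)
Lemma boundary_cluster (x : R) (F : set_system nat) : ProperFilter F -> \oo `<=` F ->
  x != 0 ->
  exists r t, [/\ 0 < r, 0 <= t <= pi,
    r * cos t - r `^ (1 - alpha) * cos (b t) = x,
    r * sin t = r `^ (1 - alpha) * sin (b t) &
    cluster ((fun n => - Im (G (w x n))) @ F) (sin t / r)].
Proof.
move=> PF hF x0; have /andP[a0 a1] := alpha01; have a1' : 0 < 1 - alpha by lra.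
have w0 n : 0 < Im (w x n) by rewrite /= invr_gt0.
have /choice[p hp] : forall n, exists q : R * R, [/\ 0 < q.1, 0 < q.2 < pi,
    x = q.1 * cos q.2 - q.1 `^ (1 - alpha) * cos (b q.2),
    (n.+1%:R)^-1 = q.1 * sin q.2 - q.1 `^ (1 - alpha) * sin (b q.2) &
    - Im (G (w x n)) = sin q.2 / q.1].
  move=> n; have [r [t [h1 h2 h3 h4 h5]]] := polar_relation hax (w0 n).
  by exists (r, t); split => //; rewrite h5 opprK.
(* Upper bound: r <= |x| + 1 + r^(1 - alpha), and the tangent inequality gives alpha r <= |x| + 1 +
   alpha. Lower bound: if r <= 1, then |x| <= r + r^(1 - alpha) <= 2 r^(1 - alpha), which is where x
   <> 0 enters. *)
pose rM := (`|x| + 2) / alpha + 1.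
pose rm := Num.min 1 ((`|x| / 2) `^ (1 - alpha)^-1).
have x0' : 0 < `|x| / 2 by rewrite divr_gt0 // normr_gt0.
have rm0 : 0 < rm by rewrite lt_min ltr01 powR_gt0.
have hr n : rm <= (p n).1 <= rM.
  have [r0 ht hx hv _] := hp n; set r := (p n).1 in r0 hx hv *; set t := (p n).2 in ht hx hv *.
  have ra0 : 0 < r `^ (1 - alpha) by exact: powR_gt0.
  apply/andP; split.
    rewrite /rm ge_min; case: (leP 1 r) => //= r1.
    have rr : r <= r `^ (1 - alpha).
      rewrite -{1}(powRr1 (ltW r0)); apply: ger_powR; [by rewrite r0 ltW|lra].
    have hxr : `|x| <= 2 * r `^ (1 - alpha).
      rewrite hx; apply: (le_trans (ler_normB _ _)); rewrite !normrM (gtr0_norm r0) (gtr0_norm ra0).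
      have c1 := cos_max t; have c2 := cos_max (b t).
      have h1 : r * `|cos t| <= r by rewrite ler_piMr // ltW.
      have h2 : r `^ (1 - alpha) * `|cos (b t)| <= r `^ (1 - alpha) by rewrite ler_piMr // ltW.
      by lra.
    have -> : r = (r `^ (1 - alpha)) `^ (1 - alpha)^-1 by rewrite -powRrM divff ?gt_eqF // powRr1 // ltW.
    by apply: ge0_ler_powR; rewrite ?nnegrE ?invr_ge0 ?powR_ge0 ?(ltW a1') ?(ltW x0') // ler_pdivrMr // mulrC.
  have hn : `|n.+1%:R^-1| <= 1 :> R.
    by rewrite gtr0_norm ?invr_gt0 // invf_le1 // ler1n.
  have tg := @powR_tangent R r (1 - alpha) (ltW r0).
  have {}tg : r `^ (1 - alpha) <= (1 - alpha) * r + alpha.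
    by apply: (le_trans (tg _)); [apply/andP; split; lra|rewrite lerD2l; lra].
  have : r <= `|x| + 1 + r `^ (1 - alpha).
    (* Rotation by - t: r is the real part of e^(- i t) times x + i / (n + 1) + r^(1 - alpha) e^(i
       b(t)). *)
    have e : r = (x + r `^ (1 - alpha) * cos (b t)) * cos t
       + (n.+1%:R^-1 + r `^ (1 - alpha) * sin (b t)) * sin t.
      by rewrite hv {1}hx !subrK -!mulrA -!expr2 -mulrDr cos2Dsin2 mulr1.
    have e2 : r = x * cos t + n.+1%:R^-1 * sin t + r `^ (1 - alpha) * cos (b t - t).
      by rewrite {1}e cosB; ring.
    rewrite {1}e2; apply: lerD; last by rewrite ler_piMr ?cos_le1 // ltW.
    apply: lerD; apply: (le_trans (ler_norm _)); rewrite normrM.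
      by rewrite ler_piMr ?cos_max.
    by rewrite -[leRHS]mulr1 ler_pM ?sin_max.
  move=> hle; rewrite /rM -subr_ge0.
  rewrite (_ : _ - r = (`|x| + 2 + alpha - alpha * r) / alpha); last by field; rewrite gt_eqF.
  by rewrite divr_ge0 ?(ltW a0) //; lra.
pose K := (`[rm, rM] `*` `[0, pi])%classic : set (R * R).
have cK : compact K by apply: compact_setX; exact: segment_compact.
have pK : (p @ F) K.
  apply: hF; exists 0 => // n _ /=; have [_ /andP[t0 tp] _ _ _] := hp n.
  by split; rewrite /= in_itv /=; [exact: hr|rewrite !ltW].
have [q [[Kq1 Kq2] hq]] := cK _ (fmap_proper_filter p PF) pK.
move: Kq1 Kq2; rewrite /= !in_itv /= => /andP[q1m q1M] qt.
have q0 : 0 < q.1 by apply: lt_le_trans q1m.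
have c1 : {for q, continuous (fun p : R * R => p.1)} by exact: cvg_fst.
have c2 : {for q, continuous (fun p : R * R => p.2)} by exact: cvg_snd.
have cpow : {for q, continuous (fun p : R * R => p.1 `^ (1 - alpha))}.
  apply: (@continuous_comp _ _ _ _ (@powR R ^~ (1 - alpha))); first exact: c1.
  apply/differentiable_continuous/derivable1_diffP.
  exact: (@ex_derive _ _ _ _ _ _ _ (is_derive1_powR _ q0)).
have cb : {for q, continuous (fun p : R * R => b p.2)}.
  apply: cvgD; first exact: cvg_cst.
  by apply: cvgM; [exact: cvg_cst|exact: c2].
have ccos : {for q, continuous (fun p : R * R => cos p.2)}.
  by apply: continuous_comp; [exact: c2|exact: continuous_cos].
have csin : {for q, continuous (fun p : R * R => sin p.2)}.
  by apply: continuous_comp; [exact: c2|exact: continuous_sin].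
have cbcos : {for q, continuous (fun p : R * R => cos (b p.2))}.
  by apply: (@continuous_comp _ _ _ (fun p : R * R => b p.2)); [exact: cb|exact: continuous_cos].
have cbsin : {for q, continuous (fun p : R * R => sin (b p.2))}.
  by apply: (@continuous_comp _ _ _ (fun p : R * R => b p.2)); [exact: cb|exact: continuous_sin].
have CI (f : R * R -> R) : {for q, continuous f} -> cluster ((fun n => f (p n)) @ F) (f q).
  move=> cf; exact: (cluster_image hq cf).
have cu : {for q, continuous (fun p : R * R => p.1 * cos p.2 - p.1 `^ (1 - alpha) * cos (b p.2))}.
  by apply: cvgB; apply: cvgM; [exact: c1|exact: ccos|exact: cpow|exact: cbcos].
have cv : {for q, continuous (fun p : R * R => p.1 * sin p.2 - p.1 `^ (1 - alpha) * sin (b p.2))}.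
  by apply: cvgB; apply: cvgM; [exact: c1|exact: csin|exact: cpow|exact: cbsin].
have cg : {for q, continuous (fun p : R * R => sin p.2 / p.1)}.
  by apply: cvgM; [exact: csin|apply: cvgV; [rewrite gt_eqF|exact: c1]].
exists q.1, q.2; split => //.
- apply/esym; apply: (cluster_lim _ (CI _ cu)).
  rewrite (_ : (fun n => _) = fun=> x); first exact: cvg_cst.
  by apply: funext => n; have [_ _ <-] := hp n.
- apply/eqP; rewrite -subr_eq0; apply/eqP/esym; apply: (cluster_lim _ (CI _ cv)).
  rewrite (_ : (fun n => _) = fun n => n.+1%:R^-1).
    by move=> A /(@cvg_harmonic R) hA; exact: hF.
  by apply: funext => n; have [_ _ _ <-] := hp n.
- rewrite (_ : (fun n => _) = fun n => sin (p n).2 / (p n).1); first exact: CI cg.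
  by apply: funext => n; have [_ _ _ _ <-] := hp n.
Qed.

(** If convergence failed, the indices with error at least e would carry a proper filter beyond
    infinity; yet a cluster point along it has the value [stable_density x], so the errors cluster
    at 0. *)
Lemma stable_density_cvg (x : R) : x != 0 ->
  (fun n => pi^-1 * - Im (G (w x n))) @ \oo --> stable_density x.
Proof.
move=> x0; apply/cvgrPdist_lt => e e0; apply: contrapT => nh.
pose S := [set n | e <= `|stable_density x - pi^-1 * - Im (G (w x n))|].
have PF : ProperFilter (within S \oo).
  apply: Build_ProperFilter_ex => P hP.
  apply: contrapT => nP; apply: nh; near=> n.
  rewrite ltNge; apply/negP => hn; apply: nP; exists n.
  by move: hn; near: n.
have SF : \oo `<=` within S \oo by move=> A; exact: filterS.
have [r [t [r0 /andP[t0 tp] hu hv hc]]] := boundary_cluster PF SF x0.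
have hc' : cluster ((fun n => `|stable_density x - pi^-1 * - Im (G (w x n))|) @ within S \oo)
    `|stable_density x - pi^-1 * (sin t / r)|.
  apply: (cluster_image (f := fun y : R => `|stable_density x - pi^-1 * y|) hc).
  apply: cvg_norm; apply: cvgB; first exact: cvg_cst.
  by apply: cvgM; [exact: cvg_cst|exact: cvg_id].
suff h0 : stable_density x = pi^-1 * (sin t / r).
  have z0 : `|stable_density x - pi^-1 * (sin t / r)| = 0 by rewrite h0 subrr normr0.
  rewrite z0 in hc'.
  have [] := hc' [set y | e <= y] [set y | y < e].
  - exact: withinT.
  - exact: lt_nbhsl.
  - by move=> y [/= h1 h2]; have := le_lt_trans h1 h2; rewrite ltxx.
have ra0 : 0 < r `^ (1 - alpha) by exact: powR_gt0.
have /andP[a0 a1] := alpha01.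
(* At t = 0 the imaginary equation forces sin k = 0, hence rho = 0; then x = r - r^(1 - alpha) lies
   at or above the edge, outside the range of [theta_x]. At t = pi that equation fails, since 0 < b
   pi < pi. *)
case: (ltgtP 0 t) t0 => // [t0|tE] _; last first.
  rewrite -tE sin0 mul0r mulr0; apply: stable_density_out => s hs hsx.
  have k0 : rho = 0.
    apply/eqP; rewrite -[_ == 0]negbK; apply/negP => rn.
    have rp : 0 < rho by rewrite lt_neqAle eq_sym rn; have /andP[] := rho01.
    have kp : 0 < k by rewrite /k !mulr_gt0 ?pi_gt0.
    have kpi : k < pi.
      rewrite /k -[ltRHS]mul1r ltr_pM2r ?pi_gt0 //; have /andP[_ r1] := rho01.
      by apply: (lt_trans _ r1); rewrite -[ltRHS]mul1r ltr_pM2r.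
    have sk : 0 < sin k by apply: sin_gt0_pi; rewrite kp.
    move: hv; rewrite -tE sin0 mulr0 /b mulr0 addr0 => /eqP.
    by rewrite eq_sym mulf_eq0 !gt_eqF.
  have := theta_x_lt_edge k0 hs; rewrite hsx -hu -tE cos0 mulr1 /b mulr0 addr0 /k k0.
  rewrite mulr0 mul0r cos0 mulr1 ltNge; apply/negP; rewrite negbK.
  exact: sub_powR_ge_edge.
case: (ltgtP t pi) tp => // [tp|tE] _; last first.
  have bp : 0 < b pi < pi.
    have p0 := pi_gt0 R; have /andP[rh0 rh1] := rho01.
    have h1 : 0 <= alpha * rho * pi by rewrite !mulr_ge0 // ltW.
    have h2 : 0 < (1 - alpha) * pi by rewrite mulr_gt0 // subr_gt0.
    have h4 : alpha * rho * pi < alpha * pi.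
      by rewrite ltr_pM2r // -[ltRHS]mulr1 ltr_pM2l.
    by rewrite /b /k; apply/andP; split; lra.
  have := sin_gt0_pi bp => sb.
  by move: hv; rewrite tE sinpi mulr0 => /eqP; rewrite eq_sym mulf_eq0 !gt_eqF.
have ht : 0 < t < pi by rewrite t0.
have rE : r = theta_r alpha rho t.
  by apply/eqP; rewrite -theta_rP //; apply/eqP.
by rewrite -hu rE theta_psi_polar // theta_x_polar // stable_densityE.
Unshelve. all: by end_near. Qed.

(** A boundary cluster point itself provides the angle of x, once t = 0 and t = pi are excluded; the
    measure thus supplies the surjectivity of [theta_x]. At x = 0 the angle is rho pi. *)
Lemma stable_density_domain (x : R) : 0 < rho \/ x < stable_edge ->
  exists2 t, 0 < t < pi & theta_x alpha rho t = x.
Proof.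
have /andP[a0 a1] := alpha01; have /andP[rh0 rh1] := rho01; have p0 := pi_gt0 R.
move=> hx; have [x0|x0] := eqVneq x 0.
  case: hx => [rp|xe]; last first.
    have : stable_edge <= 0 by rewrite oppr_le0 mulr_ge0 ?powR_ge0 // ltW.
    by rewrite leNgt -x0 xe.
  exists (rho * pi).
    by rewrite mulr_gt0 // -[ltRHS]mul1r ltr_pM2r.
  by rewrite /theta_x x0 mulrA subrr sin0 mulr0.
have [r [t [r0 /andP[t0 tp] hu hv _]]] := @boundary_cluster x \oo _ (fun A h => h) x0.
have ra0 : 0 < r `^ (1 - alpha) by exact: powR_gt0.
have t0' : t != 0.
  apply/eqP => tE; move: hu hv; rewrite tE sin0 cos0 mulr1 mulr0 /b mulr0 addr0 => hu hv.
  case: hx => [rp|xe].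
    have kp : 0 < k by rewrite /k !mulr_gt0 ?pi_gt0.
    have kpi : k < pi.
      rewrite /k -[ltRHS]mul1r ltr_pM2r ?pi_gt0 //.
      by apply: (lt_trans _ rh1); rewrite -[ltRHS]mul1r ltr_pM2r.
    have sk : 0 < sin k by apply: sin_gt0_pi; rewrite kp.
    by move: hv => /eqP; rewrite eq_sym mulf_eq0 !gt_eqF.
  have h1 := sub_powR_ge_edge r0.
  have h2 : r `^ (1 - alpha) * cos k <= r `^ (1 - alpha) by rewrite ler_piMr ?cos_le1 // ltW.
  by lra.
have tp' : t != pi.
  apply/eqP => tE; have bp : 0 < b pi < pi.
    have h1 : 0 <= alpha * rho * pi by rewrite !mulr_ge0 // ltW.
    have h2 : 0 < (1 - alpha) * pi by rewrite mulr_gt0 // subr_gt0.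
    have h4 : alpha * rho * pi < alpha * pi.
      by rewrite ltr_pM2r // -[ltRHS]mulr1 ltr_pM2l.
    by rewrite /b /k; apply/andP; split; lra.
  have sb := sin_gt0_pi bp.
  by move: hv; rewrite tE sinpi mulr0 => /eqP; rewrite eq_sym mulf_eq0 !gt_eqF.
have ht : 0 < t < pi by rewrite !lt_neqAle t0 tp tp' eq_sym t0'.
exists t => //.
have rE : r = theta_r alpha rho t by apply/eqP; rewrite -theta_rP //; apply/eqP.
by rewrite -hu rE theta_x_polar.
Qed.

End boundary.

(** * Measures given by a density, determined by half-open intervals *)

Section density_measure.
Variable R : realType.
Variable h : measurableTypeR R -> R.
Hypothesis mh : measurable_fun [set: measurableTypeR R] h.
Hypothesis h0 : forall x, 0 <= h x.

Definition density_measure (A : set (measurableTypeR R)) : \bar R :=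
  (\int[@lebesgue_measure R]_(x in A) (h x)%:E)%E.

Let density_measure0 : density_measure set0 = 0%E.
Proof. exact: integral_set0. Qed.

Let density_measure_ge0 A : (0 <= density_measure A)%E.
Proof. by apply: integral_ge0 => x _; rewrite lee_fin. Qed.

Let density_measure_sigma_additive : semi_sigma_additive density_measure.
Proof.
move=> /= A mA tA mUA; rewrite /density_measure ge0_integral_bigcup //=; last 2 first.
- by apply: measurable_funTS; exact/measurable_EFinP.
- by move=> x _; rewrite lee_fin.
apply: is_cvg_ereal_nneg_natsum_cond => n _ _.
by apply: integral_ge0 => x _; rewrite lee_fin.
Qed.

HB.instance Definition _ := isMeasure.Build _ _ _
  density_measure density_measure0 density_measure_ge0 density_measure_sigma_additive.

Lemma density_measure_unique (mu : probability (measurableTypeR R) R) :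
  (forall a b : R, a < b -> mu `]a, b]%classic = density_measure `]a, b]%classic) ->
  forall A, measurable A -> mu A = density_measure A.
Proof.
move=> H; apply: (@measure_unique _ R (measurableTypeR R) (@ocitv R)
  (fun n => `](- n%:R), n%:R]%classic)).
- by [].
- exact: ocitvI.
- by move=> i; exact: is_ocitv.
- apply/seteqP; split => // x _; exists (Num.truncn `|x|).+1 => //=.
  rewrite in_itv /=; have := truncnS_gt `|x|; rewrite ltr_norml => /andP[h1 h2].
  by rewrite h1 ltW.
- move=> A /ocitvP[->|[[a b] /= ab ->]]; last exact: H.
  by rewrite !measure0.
- by move=> k; rewrite -ge0_fin_numE //; exact: fin_num_measure.
Qed.

End density_measure.

Section stieltjes.
Variable R : realType.
Variable mu : probability (measurableTypeR R) R.
Local Notation C := R[i].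
Local Notation Re := (@complex.Re R).
Local Notation Im := (@complex.Im R).
Local Notation G := (cauchy_transform mu).
Local Notation lam := (@lebesgue_measure R).

(** * Stieltjes inversion *)

Definition poisson_kernel (e u : R) : R := pi^-1 * (e / (u ^+ 2 + e ^+ 2)).

Lemma poisson_kernel_ge0 e u : 0 < e -> 0 <= poisson_kernel e u.
Proof.
move=> e0; rewrite mulr_ge0 ?invr_ge0 ?pi_ge0 // divr_ge0 ?(ltW e0) //.
by rewrite addr_ge0 ?sqr_ge0.
Qed.

Lemma poisson_kernel_continuous e : 0 < e -> continuous (poisson_kernel e).
Proof.
move=> e0 u; rewrite /poisson_kernel; apply: cvgM; first exact: cvg_cst.
apply: cvgM; first exact: cvg_cst.
apply: cvgV; first by rewrite gt_eqF // ltr_wpDl ?sqr_ge0 ?exprn_gt0.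
by apply: cvgD; [exact: exprn_continuous|exact: cvg_cst].
Qed.

Lemma measurable_poisson_kernel e : 0 < e ->
  measurable_fun [set: measurableTypeR R] (poisson_kernel e : measurableTypeR R -> R).
Proof. by move=> e0; apply: continuous_measurable_fun; exact: poisson_kernel_continuous. Qed.

Lemma poisson_integral e x : 0 < e ->
  ((pi^-1 * - Im (G (x +i* e)))%:E = \int[mu]_t (poisson_kernel e (x - t))%:E)%E.
Proof.
move=> e0; have ib := cbounded_Im mu (cbounded_resolvent (_ : 0 < Im (x +i* e))).
have {}ib := ib e0.
rewrite cauchy_transformE /cint /= mulrN -mulNr -RintegralZl // /Rintegral fineK.
  apply: eq_integral => t _; congr (_%:E); rewrite mulNr -mulrN; congr (_ * _).
  have E : Im (resolvent (x +i* e) t) = - e / ((x - t) ^+ 2 + e ^+ 2).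
    by rewrite /resolvent ImV !cE /= subr0.
  by rewrite [X in - X]E mulNr opprK.
apply: integrable_fin_num => //.
exact: (integrableZl measurableT (- pi^-1) ib).
Qed.

Lemma poisson_kernel_integral e (a b t : R) : 0 < e -> a < b ->
  (\int[lam]_(x in `[a, b]) (poisson_kernel e (x - t))%:E =
   (pi^-1 * (atan ((b - t) / e) - atan ((a - t) / e)))%:E)%E.
Proof.
move=> e0 ab.
pose F (x : R) := pi^-1 * atan ((x - t) / e).
have dF (x : R) : is_derive x 1 F (poisson_kernel e (x - t)).
  have h1 : is_derive x 1 ((id - cst t) * cst e^-1) e^-1.
    by apply: is_derive_eq; rewrite /GRing.scale /=; ring.
  have h2 := is_derive1_comp (is_derive1_atan _) h1.
  rewrite (_ : F = cst pi^-1 * (@atan R \o ((id - cst t) * cst e^-1))) //.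
  apply: is_derive_eq; rewrite /GRing.scale /= !fctE /= /poisson_kernel.
  have en : e != 0 by rewrite gt_eqF.
  have dn : (x - t) ^+ 2 + e ^+ 2 != 0 by rewrite gt_eqF // ltr_wpDl ?sqr_ge0 ?exprn_gt0.
  rewrite mulr0 addr0; congr (_ * _); field; rewrite en /=.
  by rewrite andbT; exact: dn.
have cF : continuous F.
  by move=> x; apply/differentiable_continuous/derivable1_diffP; exact: (@ex_derive _ _ _ _ _ _ _ (dF x)).
rewrite (@continuous_FTC2 _ _ F) //.
- by rewrite -EFinB /F -mulrBr.
- apply: continuous_subspaceT => x.
  apply: (@continuous_comp _ _ _ (fun x : R => x - t)); last exact: poisson_kernel_continuous.
  by apply: cvgB; [exact: cvg_id|exact: cvg_cst].
- split; first by move=> x _; exact: (@ex_derive _ _ _ _ _ _ _ (dF x)).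
    exact/cvg_at_right_filter/cF.
  exact/cvg_at_left_filter/cF.
- by move=> x _; rewrite derive1E; exact: (@derive_val _ _ _ _ _ _ _ (dF x)).
Qed.

(** - Im G / pi at height e is the Poisson smoothing of [mu]; Tonelli applies as the kernel is
    nonnegative, and integrating it over [a, b] first leaves arctangents. *)
Lemma stieltjes_fubini e (a b : R) : 0 < e -> a < b ->
  (\int[lam]_(x in `[a, b]) (pi^-1 * - Im (G (x +i* e)))%:E =
   \int[mu]_t (pi^-1 * (atan ((b - t) / e) - atan ((a - t) / e)))%:E)%E.
Proof.
move=> e0 ab.
under eq_integral do rewrite poisson_integral //.
under [in RHS]eq_integral do rewrite -(poisson_kernel_integral _ e0 ab).
pose f (z : measurableTypeR R * measurableTypeR R) : \bar R :=
  (poisson_kernel e (z.1 - z.2) * \1_`[a, b] z.1)%:E.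
have mf : measurable_fun setT f.
  apply/measurable_EFinP; apply: measurable_funM.
    apply: (measurableT_comp (measurable_poisson_kernel e0)).
    by apply: measurable_funB; [exact: measurable_fst|exact: measurable_snd].
  by apply: (measurableT_comp (measurable_indic _) measurable_fst).
have f0 z : (0 <= f z)%E by rewrite lee_fin mulr_ge0 // poisson_kernel_ge0.
have h := fubini_tonelli (m1 := lam) (m2 := mu) f mf f0.
rewrite /f /= in h; rewrite [LHS]integral_mkcond.
transitivity (\int[lam]_x \int[mu]_y (poisson_kernel e (x - y) * \1_`[a, b] x)%:E)%E.
  apply: eq_integral => x _; rewrite /patch indicE; case: ifP => xab.
    by under [in RHS]eq_integral do rewrite mulr1.
  by under eq_integral do rewrite mulr0; rewrite integral0.
rewrite h; apply: eq_integral => t _; rewrite [in RHS]integral_mkcond.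
by apply: eq_integral => x _; rewrite /patch indicE; case: ifP => xab; rewrite ?mulr1 ?mulr0.
Qed.

End stieltjes.

Section inversion.
Variable R : realType.
Variable mu : probability (measurableTypeR R) R.
Local Notation C := R[i].
Local Notation Im := (@complex.Im R).
Local Notation G := (cauchy_transform mu).
Local Notation lam := (@lebesgue_measure R).
Local Notation eps n := ((n.+1%:R : R)^-1).

Let eps0 n : 0 < eps n. Proof. by rewrite invr_gt0. Qed.

Lemma atan_scale_cvg (u : R) :
  atan (u / eps n) @[n --> \oo] --> pi / 2 * Num.sg u.
Proof.
have H (v : R) : 0 < v -> atan (v / eps n) @[n --> \oo] --> pi / 2.
  move=> v0; have hv : v / eps n @[n --> \oo] --> +oo.
    apply/cvgryPge => A; exists (Num.truncn (A / v)).+1 => // n /= hn.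
    rewrite invrK mulrC -ler_pdivrMr // (le_trans (ltW (truncnS_gt _))) // ler_nat.
    exact: ltnW.
  exact: (cvg_comp _ _ hv (@cvgy_atan R)).
have [u0|u0|->] := ltgtP u 0; last first.
- by rewrite sgr0 mulr0; under eq_fun do rewrite mul0r atan0; exact: cvg_cst.
- by rewrite gtr0_sg // mulr1; exact: H.
- rewrite ltr0_sg // mulrN1.
  have := H (- u) (_ : 0 < - u); rewrite oppr_gt0 => /(_ u0) /cvgN hN.
  rewrite (_ : (fun n => _) = (fun n => - atan (- u / eps n))) //.
  by apply: funext => n; rewrite mulNr atanN opprK.
Qed.

Variable K : R.
Hypothesis hK : forall w, 0 < Im w -> 0 <= - Im (G w) <= K.

Let smooth (a b : R) n (t : R) := pi^-1 * (atan ((b - t) / eps n) - atan ((a - t) / eps n)).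
(** For a < b: 1 inside, 1/2 at the endpoints, 0 outside, the pointwise limit of the smoothed
    indicators. *)
Let step (a b t : R) := (Num.sg (b - t) - Num.sg (a - t)) / 2.

Let smooth_cvg a b t : smooth a b n t @[n --> \oo] --> step a b t.
Proof.
have -> : step a b t = pi^-1 * (pi / 2 * Num.sg (b - t) - pi / 2 * Num.sg (a - t)).
  by rewrite /step; move: (pi_gt0 R); move: (pi : R) => p p0; field; rewrite gt_eqF.
apply: cvgM; first exact: cvg_cst.
by apply: cvgB; exact: atan_scale_cvg.
Qed.

Let measurable_smooth a b n :
  measurable_fun [set: measurableTypeR R] (smooth a b n : measurableTypeR R -> R).
Proof.
apply: continuous_measurable_fun => t; apply: cvgM; first exact: cvg_cst.
have H (c : R) : {for t, continuous (fun t : R => atan ((c - t) / eps n))}.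
  apply: (@continuous_comp _ _ _ (fun t : R => (c - t) / eps n)); last exact: continuous_atan.
  apply: cvgM; last exact: cvg_cst.
  by apply: cvgB; [exact: cvg_cst|exact: cvg_id].
by apply: cvgB; exact: H.
Qed.

Let measurable_step a b :
  measurable_fun [set: measurableTypeR R] (step a b : measurableTypeR R -> R).
Proof.
apply: (measurable_fun_cvg (h := fun n => smooth a b n)); first exact: measurable_smooth.
by move=> x _; exact: smooth_cvg.
Qed.

Let smooth_le1 a b n t : `|smooth a b n t| <= 1.
Proof.
rewrite /smooth normrM gtr0_norm ?invr_gt0 ?pi_gt0 // mulrC ler_pdivrMr ?pi_gt0 // mul1r.
have := atan_ltpi2 ((b - t) / eps n); have := atan_gtNpi2 ((b - t) / eps n).
have := atan_ltpi2 ((a - t) / eps n); have := atan_gtNpi2 ((a - t) / eps n).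
by rewrite ler_norml => *; apply/andP; split; lra.
Qed.

Let smooth_integral_cvg a b :
  (\int[mu]_t (smooth a b n t)%:E)%E @[n --> \oo] --> (\int[mu]_t (step a b t)%:E)%E.
Proof.
have [] // := @dominated_convergence _ _ R mu setT measurableT
  (fun n t => (smooth a b n t)%:E) (fun t => (step a b t)%:E) (cst 1%E).
- by move=> n; exact/measurable_EFinP.
- exact/measurable_EFinP.
- by apply/aeW => t _; apply/cvg_EFin; [exact: nearW|exact: smooth_cvg].
- have := @bounded_meas_integrable R mu (cst 1) (measurable_cst _); apply.
  by exists 1 => t; rewrite normr1.
- by apply/aeW => t n _ /=; rewrite lee_fin.
Qed.

Let approx n (x : R) : R := pi^-1 * - Im (G (x +i* eps n)).

Let approx_bound n x : 0 <= approx n x <= pi^-1 * K.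
Proof.
have /andP[h1 h2] := hK (eps0 n : 0 < Im (x +i* eps n)).
by rewrite mulr_ge0 ?invr_ge0 ?pi_ge0 //= ler_wpM2l ?invr_ge0 ?pi_ge0.
Qed.

Let measurable_approx n :
  measurable_fun [set: measurableTypeR R] (approx n : measurableTypeR R -> R).
Proof.
apply/measurable_EFinP.
rewrite (_ : _ \o _ = fubini_F mu (fun z : measurableTypeR R * measurableTypeR R =>
  (poisson_kernel (eps n) (z.1 - z.2))%:E)).
  apply: measurable_fun_fubini_tonelli_F.
    apply/measurable_EFinP; apply: (measurableT_comp (measurable_poisson_kernel (eps0 n))).
    by apply: measurable_funB; [exact: measurable_fst|exact: measurable_snd].
  by move=> z; rewrite lee_fin poisson_kernel_ge0.
by apply: funext => x; rewrite /= /fubini_F /approx poisson_integral.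
Qed.

Let K0 : 0 <= pi^-1 * K.
Proof. by have /andP[] := approx_bound 0 0; exact: le_trans. Qed.

Let step_integral_le a b : a < b ->
  (\int[mu]_t (step a b t)%:E <= (pi^-1 * K * (b - a))%:E)%E.
Proof.
move=> ab; apply: (cvge_to_le (@smooth_integral_cvg a b)); near=> n.
rewrite -stieltjes_fubini //.
have -> : ((pi^-1 * K * (b - a))%:E = \int[lam]_(x in `[a, b]) (cst (pi^-1 * K)%:E) x)%E.
  have hl : lam `[a, b]%classic = (b - a)%:E.
    by rewrite lebesgue_measure_itv /= lte_fin ab EFinB.
  by rewrite integral_cst // [X in (_ * X)%E]hl -EFinM.
apply: ge0_le_integral => //.
- by move=> x _; rewrite lee_fin; have /andP[] := approx_bound n x.
- by apply: measurable_funTS; apply/measurable_EFinP; exact: (measurable_approx n).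
- by move=> x _; rewrite lee_fin; have /andP[] := approx_bound n x.
Unshelve. all: by end_near. Qed.

Let step_ge0 a b t : a < b -> 0 <= step a b t.
Proof.
move=> ab; rewrite /step divr_ge0 // subr_ge0.
have [h1|h1|h1] := ltgtP (a - t) 0.
- rewrite (ltr0_sg h1); have [h2|h2|->] := ltgtP (b - t) 0.
  + by rewrite (ltr0_sg h2).
  + by rewrite (gtr0_sg h2) (@le_trans _ _ 0) // oppr_le0.
  + by rewrite sgr0 oppr_le0.
- by rewrite (gtr0_sg h1) gtr0_sg //; lra.
- by rewrite h1 sgr0 gtr0_sg //; lra.
Qed.

(** Half the atom at a is seen by [step a (a + d)], whose integral is at most pi^-1 K d, and d is
    arbitrarily small. *)
Let atom0 a : mu [set a] = 0%E.
Proof.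
apply/eqP; rewrite eq_le measure_ge0 andbT; apply/lee_addgt0Pr => e e0; rewrite add0e.
pose d := e / (2 * (pi^-1 * K) + 1).
have dn : 0 < 2 * (pi^-1 * K) + 1 by have := K0; lra.
have d0 : 0 < d by rewrite divr_gt0.
have ad : a < a + d by rewrite ltrDl.
have h1 := step_integral_le ad.
have h2 : ((2^-1)%:E * mu [set a] <= \int[mu]_t (step a (a + d) t)%:E)%E.
  have <- : (\int[mu]_t ((2^-1)%:E * (\1_[set a] t)%:E) = (2^-1)%:E * mu [set a])%E.
    rewrite ge0_integralZl //.
      by rewrite integral_indic // setIT.
    by apply/measurable_EFinP; exact: measurable_indic.
  apply: ge0_le_integral => //.
  - by apply: measurable_funeM; apply/measurable_EFinP; exact: measurable_indic.
  - exact/measurable_EFinP.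
  move=> t _; rewrite -EFinM lee_fin indicE; have [->|ta] := eqVneq t a.
    rewrite mem_set //= mulr1 /step subrr sgr0 subr0 gtr0_sg ?mul1r //; lra.
  rewrite memNset ?mulr0 ?step_ge0 //=.
  exact/eqP.
have fin := fin_num_measure mu [set a] (measurable_set1 a).
move: h2; rewrite -(fineK fin) -EFinM => /le_trans /(_ h1).
rewrite !lee_fin addrC addKr => h3.
have h4 : 2 * (pi^-1 * K) * d <= e.
  rewrite /d mulrCA ler_piMr ?(ltW e0) // ler_pdivrMr // mul1r; lra.
by lra.
Qed.

Let step_integral a b : a < b -> (\int[mu]_t (step a b t)%:E = mu `]a, b]%classic)%E.
Proof.
move=> ab; transitivity (\int[mu]_t (\1_(`]a, b]%classic : set (measurableTypeR R)) t)%:E)%E; last first.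
  by rewrite integral_indic // setIT.
apply: ae_eq_integral => //.
- exact/measurable_EFinP.
- by apply/measurable_EFinP; exact: measurable_indic.
exists ([set a] `|` [set b]); split.
- by apply: measurableU.
- by apply: null_set_setU => //; exact: atom0.
move=> t /= ht; apply: contrapT => nab; apply: ht => _; congr (_%:E).
have ta : t != a by apply/eqP => h; apply: nab; left.
have tb : t != b by apply/eqP => h; apply: nab; right.
rewrite /step indicE; case: (boolP (t \in _)) => hin.
  move: hin; rewrite inE /= in_itv /= => /andP[h1 h2].
  rewrite gtr0_sg ?subr_gt0; last by rewrite lt_neqAle tb h2.
  by rewrite ltr0_sg ?subr_lt0 // opprK -[1 + 1]/(2 : R) divff.
move: hin; rewrite notin_setE /= in_itv /= => /negP; rewrite negb_and -!ltNge -leNgt => /orP[h|h].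
  have h' : t < a by rewrite lt_neqAle ta.
  by rewrite !gtr0_sg ?subrr ?mul0r // subr_gt0 //; apply: lt_trans ab.
by rewrite !ltr0_sg ?subrr ?mul0r // subr_lt0 //; apply: lt_trans h.
Qed.

Variable h : R -> R.
Hypothesis mh : measurable_fun [set: measurableTypeR R] (h : measurableTypeR R -> R).
Hypothesis h0 : forall x, 0 <= h x.
Hypothesis approx_cvg : forall x, x != 0 ->
  (fun n => pi^-1 * - Im (G (x +i* eps n))) @ \oo --> h x.

(** The same integrals have two limits: the integral of h, by the uniform bound on Im G, and after
    Tonelli the mass of ]a, b], as endpoints carry none. The point 0, where no limit is assumed, is
    Lebesgue-null. *)
Lemma stieltjes_inversion (A : set (measurableTypeR R)) : measurable A ->
  mu A = (\int[lam]_(x in A) (h x)%:E)%E.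
Proof.
apply: (density_measure_unique mh h0) => a b ab; rewrite /density_measure.
rewrite integral_itv_obnd_cbnd; last by apply: measurable_funTS; exact/measurable_EFinP.
rewrite -step_integral //.
have [|||||_ _ hc] := @dominated_convergence _ _ R lam `[a, b]%classic (measurable_itv _)
  (fun n x => (approx n x)%:E) (fun x => (h x)%:E) (cst (pi^-1 * K)%:E).
- by move=> n; apply: measurable_funTS; apply/measurable_EFinP; exact: (measurable_approx n).
- by apply: measurable_funTS; exact/measurable_EFinP.
- exists [set 0]; split.
  + exact: measurable_set1.
  + exact: lebesgue_measure_set1.
  move=> x /= hx; apply: contrapT => /eqP x0; apply: hx => _.
  by apply/cvg_EFin; [exact: nearW|exact: approx_cvg].
- apply: measurable_bounded_integrable => //=.
  + by rewrite lebesgue_measure_itv /= lte_fin ab ltry.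
  + exact: bounded_cst.
- by apply/aeW => x n _ /=; rewrite lee_fin ger0_norm; have /andP[h1 h2] := approx_bound n x.
apply: (cvg_unique _ (@smooth_integral_cvg a b)) => //.
move: hc; rewrite (_ : (fun n => _) = (fun n => \int[mu]_t (smooth a b n t)%:E)%E) //.
by apply: funext => n; exact: stieltjes_fubini.
Qed.

End inversion.

Section majorant.
Variable R : realType.
Local Notation C := R[i].
Local Notation Re := (@complex.Re R).
Local Notation Im := (@complex.Im R).

(** * Power series solutions of the differential equation *)

(** Course-of-values recursion: [S n] lists the first n + 1 terms and [F n] reads only those, so
    evaluating it on the list padded with 0 gives the right value. *)
Lemma recursive_sequence (a : C) (F : nat -> (nat -> C) -> C) :
  (forall n u v, (forall i, (i <= n)%N -> u i = v i) -> F n u = F n v) ->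
  exists g : nat -> C, g 0%N = a /\ forall n, g n.+1 = F n g.
Proof.
move=> hF.
pose S := fix S n : seq C := if n is m.+1 then rcons (S m) (F m (nth 0 (S m))) else [:: a].
have sS n : size (S n) = n.+1 by elim: n => //= n IH; rewrite size_rcons IH.
pose g n := nth 0 (S n) n.
have gS n i : (i <= n)%N -> nth 0 (S n) i = g i.
  elim: n => [|n IH]; first by rewrite leqn0 => /eqP ->.
  rewrite leq_eqVlt => /predU1P[->//|hi] /=; rewrite nth_rcons sS hi.
  exact: IH.
exists g; split => // n; rewrite {1}/g /= nth_rcons sS ltnn eqxx.
by apply: hF => i hi; rewrite gS.
Qed.

Let e (n : nat) : R := (n.+1%:R ^+ 2)^-1.

Let e_gt0 n : 0 < e n. Proof. by rewrite invr_gt0 exprn_gt0. Qed.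

Let sum_e_le n : \sum_(i < n.+1) e i <= 2 - n.+1%:R^-1.
Proof.
elim: n => [|n IH].
  by rewrite big_ord1 /e expr1n invr1; lra.
rewrite big_ord_recr /=; apply: (le_trans (lerD IH (lexx _))).
rewrite /e -[n.+2%:R]natr1; set m : R := n.+1%:R.
have m0 : 0 < m by rewrite ltr0n.
rewrite -subr_ge0 (_ : _ - _ = (m * (m + 1) ^+ 2)^-1); last first.
  by field; rewrite !gt_eqF //; lra.
by rewrite invr_ge0 mulr_ge0 ?exprn_ge0 //; lra.
Qed.

(** With x + y = n + 2, 1 / (x y)^2 <= 2 (1 / x^2 + 1 / y^2) / (x + y)^2, the difference being a
    square; each of the two sums of inverse squares is at most 2, whence 8. *)
Let conv_e n : \sum_(i < n.+1) e i * e (n - i)%N <= 8 * e n.+1.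
Proof.
have H (i : 'I_n.+1) : e i * e (n - i)%N <= 2 * e n.+1 * (e i + e (n - i)%N).
  have hi : n.+2%:R = i.+1%:R + (n - i).+1%:R :> R.
    rewrite -natrD; congr (_%:R); have := ltn_ord i; lia.
  rewrite /e hi; set x : R := i.+1%:R; set y : R := (n - i).+1%:R.
  have x0 : 0 < x by rewrite ltr0n.
  have y0 : 0 < y by rewrite ltr0n.
  rewrite -subr_ge0 (_ : _ - _ = ((x - y) ^+ 2) / ((x * y * (x + y)) ^+ 2)); last first.
    by field; rewrite !gt_eqF //; lra.
  by rewrite divr_ge0 // exprn_even_ge0.
apply: (le_trans (ler_sum _ (fun i _ => H i))).
rewrite -mulr_sumr big_split /=.
have -> : \sum_(i < n.+1) e (n - i)%N = \sum_(i < n.+1) e i.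
  rewrite (reindex_inj rev_ord_inj) /=; apply: eq_bigr => i _; congr e.
  by have := ltn_ord i; lia.
have h : \sum_(i < n.+1) e i <= 2.
  by apply: (le_trans (sum_e_le n)); rewrite lerBlDr lerDl invr_ge0.
have -> : 8 * e n.+1 = 2 * e n.+1 * 4 by ring.
rewrite ler_wpM2l ?mulr_ge0 ?(ltW (e_gt0 _)) //.
by apply: (le_trans (lerD h h)); lra.
Qed.

(* The weights 1/(n+1)^2 are, up to a constant, stable under convolution. *)
Lemma quadratic_recursion_bound (b : nat -> R) (A B : R) :
  0 <= A -> 0 <= B -> (forall n, 0 <= b n) ->
  (forall n, b n.+1 <= A * \sum_(i < n) b i.+1 * b (n - i)%N
                       + B * \sum_(i < n.+1) b i * b (n - i)%N) ->
  exists D L, [/\ 0 < D, 0 < L & forall n, b n <= D * L ^+ n].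
Proof.
move=> A0 B0 b0 hb.
(* D covers the first two terms, b 1 <= B (b 0)^2 being compared with D / 4; L exceeds 8 D (A + B),
   the constant produced by the two convolutions. *)
pose D := b 0 + 4 * B * b 0 ^+ 2 + 1; pose L := 1 + 8 * D * (A + B).
have bb0 : 0 <= 4 * B * b 0 ^+ 2 by rewrite !mulr_ge0 // exprn_ge0.
have D0 : 0 < D by have := b0 0; rewrite /D; lra.
have DAB : 0 <= 8 * D * (A + B) by rewrite !mulr_ge0 ?addr_ge0 // ltW.
have L1 : 1 <= L by rewrite /L lerDl.
have L0 : 0 < L by apply: lt_le_trans L1.
(* The exponent n - 1 matters: in the first sum both indices are positive and add up to n + 1, so
   the exponents add up to n - 1, and one factor L is left to absorb the constants. *)
have claim n : b n <= D * L ^+ n.-1 * e n.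
  elim/ltn_ind: n => -[_|n IH].
    by rewrite /e expr0 !expr1n invr1 !mulr1 /D; lra.
  apply: (le_trans (hb n)).
  have [->|n0] := posnP n.
    rewrite big_ord0 big_ord1 /= mulr0 add0r expr0 mulr1 -expr2.
    have -> : e 1 = 4^-1 by rewrite /e; congr (_^-1); ring.
    by rewrite ler_pdivlMr // /D; have := b0 0; lra.
  have e8 := conv_e n.
  have b1 i : (i < n)%N -> b i.+1 * b (n - i)%N <= D ^+ 2 * L ^+ n.-1 * (e i.+1 * e (n - i)%N).
    move=> hi; have h1 := IH i.+1 _; have h2 := IH (n - i)%N _.
    have {}h1 := h1 ltac:(lia); have {}h2 := h2 ltac:(lia).
    apply: (le_trans (ler_pM (b0 _) (b0 _) h1 h2)).
    rewrite [leLHS](_ : _ = D ^+ 2 * (L ^+ i.+1.-1 * L ^+ (n - i).-1) * (e i.+1 * e (n - i)%N)); last by ring.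
    rewrite -exprD /= (_ : (i + (n - i).-1)%N = n.-1) //; lia.
  have b2 i : (i <= n)%N -> b i * b (n - i)%N <= D ^+ 2 * L ^+ n.-1 * (e i * e (n - i)%N).
    move=> hi; have h1 := IH i ltac:(lia); have h2 := IH (n - i)%N ltac:(lia).
    apply: (le_trans (ler_pM (b0 _) (b0 _) h1 h2)).
    rewrite [leLHS](_ : _ = D ^+ 2 * (L ^+ i.-1 * L ^+ (n - i).-1) * (e i * e (n - i)%N)); last by ring.
    apply: ler_wpM2r; first by rewrite mulr_ge0 // ltW.
    apply: ler_wpM2l; first by rewrite exprn_ge0 // ltW.
    by rewrite -exprD ler_weXn2l //; lia.
  have DL : 0 <= D ^+ 2 * L ^+ n.-1 by rewrite mulr_ge0 // exprn_ge0 // ltW.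
  have s1 : \sum_(i < n) b i.+1 * b (n - i)%N <= D ^+ 2 * L ^+ n.-1 * (8 * e n.+1).
    apply: (@le_trans _ _ (D ^+ 2 * L ^+ n.-1 * \sum_(i < n) (e i.+1 * e (n - i)%N))).
      by rewrite mulr_sumr ler_sum // => i _; exact: b1.
    apply: ler_wpM2l => //.
    have e9 := conv_e n.+1.
    apply: (@le_trans _ _ (8 * e n.+2)).
      apply: le_trans e9; rewrite big_ord_recl big_ord_recr /=.
      rewrite [leLHS](_ : _ = \sum_(i < n) e (bump 0 i) * e (n.+1 - bump 0 i)%N).
        by rewrite addrCA lerDl addr_ge0 // mulr_ge0 // ltW.
      by apply: eq_bigr => i _; rewrite /bump /= add1n subSS.
    rewrite ler_wpM2l // /e lef_pV2 ?posrE ?exprn_gt0 //.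
    by rewrite lerXn2r ?nnegrE // ler_nat.
  have s2 : \sum_(i < n.+1) b i * b (n - i)%N <= D ^+ 2 * L ^+ n.-1 * (8 * e n.+1).
    apply: (@le_trans _ _ (D ^+ 2 * L ^+ n.-1 * \sum_(i < n.+1) (e i * e (n - i)%N))).
      by rewrite mulr_sumr ler_sum // => i _; apply: b2; rewrite -ltnS.
    exact: ler_wpM2l.
  apply: (le_trans (lerD (ler_wpM2l A0 s1) (ler_wpM2l B0 s2))).
  have LE : L ^+ n = L * L ^+ n.-1 by rewrite -exprS prednK.
  rewrite -mulrDl [n.+1.-1]/= LE.
  rewrite [leLHS](_ : _ = D * (8 * D * (A + B) * L ^+ n.-1) * e n.+1); last by ring.
  apply: ler_wpM2r; first exact: ltW.
  apply: ler_wpM2l; first exact: ltW.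
  by apply: ler_wpM2r; [rewrite exprn_ge0 // ltW|rewrite /L lerDr].
exists D, L; split => // n; apply: (le_trans (claim n)).
rewrite -mulrA ler_pM2l //; apply: (@le_trans _ _ (L ^+ n.-1)).
  rewrite ler_piMr ?exprn_ge0 ?(ltW L0) // /e invf_le1 ?exprn_gt0 //.
  by rewrite exprn_ege1 // ler1n.
by rewrite ler_weXn2l // leq_pred.
Qed.

End majorant.

Section formal.
Variable R : realType.
Local Notation C := R[i].
Local Notation Re := (@complex.Re R).
Local Notation Im := (@complex.Im R).

Lemma cmod_nat n : cmod (n%:R : C) = n%:R.
Proof. by rewrite -(rmorph_nat (real_complex R)) cmodR ger0_norm. Qed.

Lemma natC_neq0 n : (n.+1%:R : C) != 0.
Proof. by rewrite pnatr_eq0. Qed.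

(** The coefficient g (n+1) enters the n-th equation linearly with factor (n + 1) De; the rest
    involves earlier ones. Dividing by n + 1 offsets the weights n - i from differentiation, which
    leaves the recursion of [quadratic_recursion_bound]. *)
Lemma formal_solution (alpha : R) (w g0 : C) :
  alpha%:C + (1 - alpha)%:C * w * g0 != 0 ->
  exists g : nat -> C, [/\ g 0%N = g0, forall n, ode_series alpha w g n = 0 &
    exists D L, [/\ 0 < D, 0 < L & forall n, cmod (g n) <= D * L ^+ n]].
Proof.
set a1 := (1 - alpha)%:C; set De := _ + _ => De0.
pose F (n : nat) (u : nat -> C) : C :=
  - (a1 * w * (\sum_(i < n) u i.+1 * ((n - i)%:R * u (n - i)%N))
     + a1 * (\sum_(i < n) u i * ((n - i)%:R * u (n - i)%N))
     + \sum_(i < n.+1) u i * u (n - i)%N) / (De * n.+1%:R).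
have [|g [gz gS]] := @recursive_sequence R g0 F.
  move=> n u v huv; rewrite /F; congr (- (_ * _ + _ * _ + _) / _); apply: eq_bigr => i _;
    by rewrite !huv ?leq_subr //; have := ltn_ord i; lia.
exists g; split => //.
- move=> n; rewrite /ode_series.
  set m := cauchy_prod g _.
  have mE j : m j = g0 * (j.+1%:R * g j.+1) + \sum_(i < j) g i.+1 * ((j - i)%:R * g (j - i)%N).
    rewrite /m /cauchy_prod big_ord_recl subn0 gz; congr (_ + _).
    by apply: eq_bigr => i _; rewrite /bump /= ?add1n subnSK.
  have cE2 : cauchy_prod (nth 0 [:: w; 1]) m n =
      w * m n + \sum_(i < n) g i * ((n - i)%:R * g (n - i)%N).
    rewrite /cauchy_prod big_ord_recl subn0; congr (_ + _).
    case: n => [|n]; first by rewrite !big_ord0.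
    rewrite big_ord_recl /= mul1r big1 ?addr0; last first.
      by move=> i _; rewrite /bump /= nth_default ?mul0r.
    rewrite /bump /= ?add1n subSS subn0 /m /cauchy_prod; apply: eq_bigr => i _.
    by rewrite subSn // -ltnS.
  rewrite cE2 mE gS /F -/a1 -/(cauchy_prod g g n).
  set S1 := \sum_(i < n) _ * _; set S2 := \sum_(i < n) _ * _; set S3 := cauchy_prod g g n.
  have n0 := natC_neq0 n.
  have -> : alpha%:C * (n.+1%:R * (- (a1 * w * S1 + a1 * S2 + S3) / (De * n.+1%:R))) +
    a1 * (w * (g0 * (n.+1%:R * (- (a1 * w * S1 + a1 * S2 + S3) / (De * n.+1%:R))) + S1) + S2) + S3
    = De * (- (a1 * w * S1 + a1 * S2 + S3) / De) + (a1 * w * S1 + a1 * S2 + S3).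
    by rewrite {3}/De; field; rewrite De0 nat1r n0.
  by rewrite mulrC divfK // addNr.
have De1 := cmod_gt0 De0.
apply: (@quadratic_recursion_bound R (fun n => cmod (g n))
  (cmod (a1 * w) / cmod De) ((cmod a1 + 1) / cmod De)).
- by rewrite divr_ge0 ?cmod_ge0.
- by rewrite divr_ge0 ?cmod_ge0 // addr_ge0 // cmod_ge0.
- by move=> n; exact: cmod_ge0.
move=> n; rewrite /= gS /F [cmod (_ / _)]cmodM cmodN cmodV [cmod (De * _)]cmodM cmod_nat.
set T1 := \sum_(i < n) cmod _ * cmod _; set T2 := \sum_(i < n.+1) cmod _ * cmod _.
rewrite ler_pdivrMr ?mulr_gt0 //.
have -> : (cmod (a1 * w) / cmod De * T1 + (cmod a1 + 1) / cmod De * T2) * (cmod De * n.+1%:R)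
  = cmod (a1 * w) * (n.+1%:R * T1) + cmod a1 * (n.+1%:R * T2) + n.+1%:R * T2.
  by field; rewrite gt_eqF.
apply: (le_trans (cmodD _ _)); apply: lerD; last first.
  apply: (le_trans (cmod_sum _ _ _)).
  apply: (@le_trans _ _ T2); first by apply: ler_sum => i _; rewrite cmodM.
  by rewrite ler_peMl ?ler1n // sumr_ge0 // => i _; rewrite mulr_ge0 // cmod_ge0.
apply: (le_trans (cmodD _ _)); apply: lerD.
  rewrite cmodM; apply: ler_wpM2l; first exact: cmod_ge0.
  apply: (le_trans (cmod_sum _ _ _)); rewrite /T1 mulr_sumr; apply: ler_sum => i _.
  rewrite !cmodM cmod_nat mulrCA; apply: ler_wpM2r; first by rewrite mulr_ge0 ?cmod_ge0.
  by rewrite ler_nat; lia.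
rewrite cmodM; apply: ler_wpM2l; first exact: cmod_ge0.
apply: (le_trans (cmod_sum _ _ _)); rewrite /T2 big_ord_recr /= mulrDr.
apply: ler_wpDr; first by rewrite !mulr_ge0 ?cmod_ge0.
rewrite mulr_sumr; apply: ler_sum => i _.
rewrite !cmodM cmod_nat mulrCA; apply: ler_wpM2r; first by rewrite mulr_ge0 ?cmod_ge0.
by rewrite ler_nat; lia.
Qed.

(** * Geometrically bounded power series on the real line *)

Lemma geometric_bound_cvg (c : nat -> R) (D L x : R) :
  0 <= L -> (forall n, `|c n| <= D * L ^+ n) -> L * `|x| < 1 -> cvgn (pseries c x).
Proof.
move=> L0 hc hx; apply: normed_cvg.
have q0 : 0 <= L * `|x| by rewrite mulr_ge0.
have D0 : 0 <= D by have := hc 0%N; rewrite expr0 mulr1; apply: le_trans.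
apply: (@series_le_cvg R (fun n => `|c n * x ^+ n|) (fun n => D * (L * `|x|) ^+ n)).
- by move=> n.
- by move=> n; rewrite mulr_ge0 // exprn_ge0.
- by move=> n; rewrite normrM normrX exprMn mulrA ler_wpM2r // exprn_ge0.
by apply: is_cvg_geometric_series; rewrite ger0_norm.
Qed.

Lemma geometric_bound_diffs (c : nat -> R) (D L : R) :
  0 <= L -> (forall n, `|c n| <= D * L ^+ n) ->
  forall n, `|pseries_diffs c n| <= D * L * (2 * L) ^+ n.
Proof.
move=> L0 hc n; rewrite /pseries_diffs normrM ger0_norm //.
have D0 : 0 <= D by have := hc 0%N; rewrite expr0 mulr1; apply: le_trans.
apply: (@le_trans _ _ (2 ^+ n * (D * L ^+ n.+1))).
  apply: ler_pM => //; have := @ltn_expl 2 n isT; rewrite -(ler_nat R) natrX; exact.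
by rewrite exprMn exprS [leLHS](_ : _ = D * L * (2 ^+ n * L ^+ n)) //; ring.
Qed.

(** Since n + 1 <= 2^n, a differentiation doubles the ratio L; two of them give 4 L, and the radius
    1 / (8 L) leaves room for convergence. *)
Lemma geometric_bound_derive (c : nat -> R) (D L x : R) :
  0 < L -> (forall n, `|c n| <= D * L ^+ n) -> 8 * L * `|x| < 1 ->
  is_derive x 1 (fun x => limn (pseries c x)) (limn (pseries (pseries_diffs c) x)).
Proof.
move=> L0 hc hx; have L0' := ltW L0.
have h1 := geometric_bound_diffs L0' hc.
have L2 : 0 <= 2 * L by rewrite mulr_ge0.
have h2 := geometric_bound_diffs L2 h1.
pose K := (8 * L)^-1; have K0 : 0 < K by rewrite invr_gt0 mulr_gt0.
have KE : `|K| = K by rewrite gtr0_norm.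
apply: (@pseries_snd_diffs _ _ K).
- apply: geometric_bound_cvg L0' hc _; rewrite KE /K invfM mulrCA mulfV ?gt_eqF //; lra.
- apply: geometric_bound_cvg L2 h1 _; rewrite KE /K.
  by rewrite (_ : _ / _ = 4^-1); [lra|field; rewrite gt_eqF].
- apply: (geometric_bound_cvg _ h2); first by rewrite mulr_ge0.
  by rewrite KE /K (_ : _ / _ = 2^-1); [lra|field; rewrite gt_eqF].
by rewrite KE /K -[ltRHS]mul1r ltr_pdivlMr ?mulr_gt0 // mulrC.
Qed.

Definition pseriesC (g : nat -> C) (x : R) : C :=
  limn (pseries (fun n => Re (g n)) x) +i* limn (pseries (fun n => Im (g n)) x).

Lemma pseriesC_psum (g : nat -> C) (D L x : R) :
  0 <= L -> (forall n, cmod (g n) <= D * L ^+ n) -> L * `|x| < 1 ->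
  psum g x%:C (pseriesC g x).
Proof.
move=> L0 hg hx.
have hR n : `|Re (g n)| <= D * L ^+ n by apply: le_trans (Re_le _) (hg n).
have hI n : `|Im (g n)| <= D * L ^+ n by apply: le_trans (Im_le _) (hg n).
have XR n : Re (x%:C ^+ n) = x ^+ n by rewrite -rmorphXn.
have XI n : Im (x%:C ^+ n) = 0 by rewrite -rmorphXn.
split; first split.
- rewrite (_ : (fun N => _) = pseries (fun n => Re (g n)) x).
    exact: (geometric_bound_cvg L0 hR hx).
  apply: funext => N; rewrite Re_sum /pseries /series /= big_mkord.
  by apply: eq_bigr => i _; rewrite ReM XR XI mulr0 subr0.
- rewrite (_ : (fun N => _) = pseries (fun n => Im (g n)) x).
    exact: (geometric_bound_cvg L0 hI hx).
  apply: funext => N; rewrite Im_sum /pseries /series /= big_mkord.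
  by apply: eq_bigr => i _; rewrite ImM XR XI mulr0 add0r.
exists (D * (1 - L * `|x|)^-1) => N.
have q0 : 0 <= L * `|x| by rewrite mulr_ge0.
have D0 : 0 <= D by have := hg 0%N; rewrite expr0 mulr1; apply: le_trans; exact: cmod_ge0.
apply: (@le_trans _ _ (D * \sum_(i < N) (L * `|x|) ^+ i)).
  rewrite mulr_sumr ler_sum // => i _; rewrite cmodM cmodX cmodR exprMn mulrA.
  by rewrite ler_wpM2r // exprn_ge0.
apply: ler_wpM2l => //.
by apply: geom_sum_le; rewrite q0.
Qed.

End formal.

(** * Local power series of the density *)

Section analyticity.
Variable R : realType.
Local Notation C := R[i].
Local Notation Re := (@complex.Re R).
Local Notation Im := (@complex.Im R).

Lemma pseriesC_derive (g : nat -> C) (D L x : R) :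
  0 < L -> (forall n, cmod (g n) <= D * L ^+ n) -> 8 * L * `|x| < 1 ->
  is_cderive (pseriesC g) x (pseriesC (fun n => n.+1%:R * g n.+1) x).
Proof.
move=> L0 hg hx.
have hR n : `|Re (g n)| <= D * L ^+ n by apply: le_trans (Re_le _) (hg n).
have hI n : `|Im (g n)| <= D * L ^+ n by apply: le_trans (Im_le _) (hg n).
have nE n : (n%:R : C) = (n%:R : R)%:C by rewrite rmorph_nat.
split.
  rewrite /pseriesC /= (_ : (fun n => Re (n.+1%:R * g n.+1)) = pseries_diffs (fun n => Re (g n))).
    exact: (geometric_bound_derive L0 hR hx).
  by apply: funext => n; rewrite nE !cE /= mul0r subr0.
rewrite /pseriesC /= (_ : (fun n => Im (n.+1%:R * g n.+1)) = pseries_diffs (fun n => Im (g n))).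
  exact: (geometric_bound_derive L0 hI hx).
by apply: funext => n; rewrite nE !cE /= mul0r addr0.
Qed.

Lemma psum0 (g : nat -> C) (l : C) : psum g 0 l -> l = g 0%N.
Proof.
move=> h; apply: (psum_unique h); have [_ h2] := h; split => //.
apply: (@ccvg_bound _ _ _ _ _ _ (fun=> 0)); last exact: cvg_cst.
exists 1%N => // -[//|N] _ /=; rewrite big_ord_recl expr0 mulr1 big1 ?addr0 ?subrr ?cmod0 //.
by move=> i _; rewrite expr0n mulr0.
Qed.

Lemma is_cderive_scale (f : R -> C) (u s : R) (df : C) : is_cderive f (u * s) df ->
  is_cderive (fun x : R => f (x * s)) u (s%:C * df).
Proof.
have hl : is_derive u 1 (id * cst s) s.
  by apply: is_derive_eq; rewrite /GRing.scale /=; ring.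
have comp (F : R -> R) dF : is_derive (u * s) 1 F dF ->
    is_derive u 1 (fun x => F (x * s)) (s * dF).
  move=> h; have h' : is_derive ((id * cst s) u) 1 F dF by [].
  by apply: (is_derive_eq (is_derive1_comp h' hl)); rewrite mulrC.
move=> [/comp h1 /comp h2]; split.
  by rewrite !cE /= mul0r subr0.
by rewrite !cE /= mul0r addr0.
Qed.

Variables alpha rho : R.
Hypothesis alpha01 : 0 < alpha < 1.
Hypothesis rho01 : 0 <= rho < 1.
Local Notation k := (alpha * rho * pi).
Local Notation density := (stable_density alpha rho).

(** H z = x determines the modulus of z by [theta_rP] and its angle by injectivity, however z was
    found; so the series solution need not be compared with the Cauchy transform. *)
Lemma stable_densityP (z : C) (x : R) : 0 < Im z ->
  z - x%:C = expi k * cpow z (1 - alpha) ->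
  density x = - (pi^-1 * Im z^-1).
Proof.
move=> z0 hz; have [t0 tp hR hI] := Carg_polar z0.
have r0 := cmod_gt0 (Im_gt0_neq0 z0).
have ht : 0 < Carg z < pi by rewrite t0.
have hre := congr1 Re hz; have him := congr1 Im hz.
rewrite /cpow !cE /= in hre him; rewrite !(mul0r, subr0, addr0) in hre him.
set r := cmod z in hR hI r0 hre him; set t := Carg z in t0 tp hR hI ht hre him.
have rE : r = theta_r alpha rho t.
  apply/eqP; rewrite -theta_rP //; apply/eqP; rewrite -hI him sinD; ring.
have xE : x = theta_x alpha rho t.
  rewrite -(theta_x_polar alpha01 rho01 ht) -rE -hR cosD.
  have -> : x = Re z - (Re z - x) by ring.
  by rewrite hre; ring.
rewrite xE stable_densityE // -(theta_psi_polar alpha01 rho01 ht) -rE ImV -cmod_sqr -/r hI.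
have p0 := pi_gt0 R; move: (pi : R) p0 => p p0.
by field; rewrite !gt_eqF.
Qed.

(** The formal solution at x0 with initial value 1 / z0, where H z0 = x0, converges near x0;
    [power_relation] shows that its inverse solves H z = x0 + s, and [stable_densityP] reads off the
    density. *)
Lemma stable_density_pseries (t0 : R) : 0 < t0 < pi ->
  exists g : nat -> C, exists D L d : R, [/\ 0 < L, 0 < d,
    (forall n, cmod (g n) <= D * L ^+ n) &
    forall s, `|s| < d -> 8 * L * `|s| < 1 /\
      density (theta_x alpha rho t0 + s) = - (pi^-1 * Im (pseriesC g s))].
Proof.
move=> ht; set x0 := theta_x alpha rho t0; pose r0 := theta_r alpha rho t0.
have /andP[a0 a1] := alpha01; have /andP[tt0 ttp] := ht.
have r00 : 0 < r0 by exact: theta_r_gt0.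
have sp := sin_gt0_pi ht.
pose z0 : C := (r0 * cos t0) +i* (r0 * sin t0).
have z00 : 0 < Im z0 by rewrite mulr_gt0.
have cz : cmod z0 = r0.
  by rewrite cmodE /= [(r0 * cos _) ^+ 2]exprMn [(r0 * sin _) ^+ 2]exprMn -mulrDr cos2Dsin2 mulr1 sqrtr_sqr gtr0_norm.
have az : Carg z0 = t0.
  rewrite /Carg (ltW z00) cz /= mulrAC divff ?gt_eqF // mul1r cosK // in_itv /=.
  by rewrite !ltW.
have z0n := Im_gt0_neq0 z00.
have hz0 : z0 - x0%:C = expi k * cpow z0 (1 - alpha).
  have /eqP hv : r0 * sin t0 == r0 `^ (1 - alpha) * sin (k + (1 - alpha) * t0).
    by rewrite theta_rP.
  rewrite /cpow cz az; apply: complexP; rewrite !cE /= !(mul0r, subr0, addr0).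
    rewrite /x0 -(theta_x_polar alpha01 rho01 ht) -/r0 cosD; ring.
  by rewrite hv sinD; ring.
(* The leading coefficient is alpha z0 + (1 - alpha) x0 divided by z0, and that numerator has
   imaginary part alpha Im z0 > 0. *)
have De0 : alpha%:C + (1 - alpha)%:C * x0%:C * z0^-1 != 0.
  have -> : alpha%:C + (1 - alpha)%:C * x0%:C * z0^-1 = (alpha%:C * z0 + (1 - alpha)%:C * x0%:C) * z0^-1.
    by field.
  rewrite mulf_neq0 ?invr_eq0 //; apply: Im_gt0_neq0; rewrite !cE /= !(mul0r, addr0, mulr0).
  by rewrite mulr_gt0.
have [g [gz gode [D [L [D0 L0 hg]]]]] := formal_solution De0.
pose y := pseriesC g; pose y' := pseriesC (fun n => n.+1%:R * g n.+1).
pose d1 := (8 * L)^-1; have d10 : 0 < d1 by rewrite invr_gt0 mulr_gt0.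
have L0' := ltW L0.
have sd1 (s : R) : `|s| < d1 -> 8 * L * `|s| < 1.
  by rewrite /d1 -[_^-1]mul1r ltr_pdivlMr ?mulr_gt0 // mulrC.
have sd2 (s : R) : `|s| < d1 -> L * `|s| < 1 /\ 2 * L * `|s| < 1.
  move=> /sd1; have : 0 <= L * `|s| by rewrite mulr_ge0.
  by rewrite -!mulrA; set u := L * _ => u0 hu; split; lra.
have hg' n : cmod (n.+1%:R * g n.+1) <= D * L * (2 * L) ^+ n.
  rewrite cmodM cmod_nat; apply: (@le_trans _ _ (2 ^+ n * (D * L ^+ n.+1))).
    apply: ler_pM; rewrite ?cmod_ge0 //.
    by have := @ltn_expl 2 n isT; rewrite -(ler_nat R) natrX; exact.
  by rewrite exprMn exprS [leLHS](_ : _ = D * L * (2 ^+ n * L ^+ n)) //; ring.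
have yode (s : R) : `|s| < d1 ->
    alpha%:C * y' s + (1 - alpha)%:C * ((x0%:C + s%:C) * (y s * y' s)) + y s * y s = 0.
  move=> hs; have [h1 h2] := sd2 s hs.
  have p1 := pseriesC_psum L0' hg h1.
  have p2 := pseriesC_psum (mulr_ge0 (ler0n _ 2) L0') hg' h2.
  apply: (psum_unique (ode_series_psum alpha x0%:C p1 p2)); split.
    by under eq_fun do (under eq_bigr do rewrite gode mul0r; rewrite big1 //); exact: ccvg_cst.
  by exists 0 => N; rewrite big1 // => n _; rewrite gode mul0r cmod0.
have dy (s : R) : `|s| < d1 -> is_cderive y s (y' s).
  by move=> /sd1 hs; exact: (pseriesC_derive L0 hg hs).
have y0 : y 0 = z0^-1.
  rewrite -gz; apply: psum0.
  have h1 : L * `|0 : R| < 1 by rewrite normr0 mulr0.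
  exact: (pseriesC_psum L0' hg h1).
have Imz : Im z0^-1 < 0.
  by rewrite ImV mulNr oppr_lt0 divr_gt0 // -cmod_sqr exprn_gt0 // cmod_gt0.
(* The inverse of the series must stay in the upper half-plane along the path: [d2] secures this by
   continuity at 0, [d1] secures convergence. *)
have [d2 d20 hd2] : exists2 d2 : R, 0 < d2 & forall s : R, `|s| < d2 -> Im (y s) < 0.
  have z1 : `|0 : R| < d1 by rewrite normr0.
  have [_ hI] := dy 0 z1.
  have cI : {for (0 : R), continuous (fun s => Im (y s))}.
    apply/differentiable_continuous/derivable1_diffP.
    exact: (@ex_derive _ _ _ _ _ _ _ hI).
  have : \forall s \near (0 : R), Im (y s) < 0.
    by apply: (cvgr_lt _ cI); rewrite -[Im _]/(Im (y 0)) y0.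
  case=> d /= d0 hd; exists d => // s hs; apply: hd.
  by rewrite /= sub0r normrN.
pose d := Num.min d1 d2.
exists g, D, L, d; split => //; first by rewrite lt_min d10.
move=> s; rewrite lt_min => /andP[hs1 hs2]; split; first exact: sd1.
have us1 (u : R) : 0 <= u <= 1 -> `|u * s| < d1.
  move=> /andP[u0 u1]; rewrite normrM ger0_norm //.
  by apply: le_lt_trans hs1; rewrite ler_piMl.
have us2 (u : R) : 0 <= u <= 1 -> Im (y (u * s)) < 0.
  move=> /andP[u0 u1]; apply: hd2; rewrite normrM ger0_norm //.
  by apply: le_lt_trans hs2; rewrite ler_piMl.
have yn (u : R) : 0 <= u <= 1 -> y (u * s) != 0.
  by move=> hu; apply/eqP => h; have := us2 u hu; rewrite h ltxx.
have Fp (u : R) : 0 <= u <= 1 -> 0 < Im (y (u * s))^-1.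
  move=> hu; rewrite ImV divr_gt0 ?oppr_gt0 ?us2 //.
  by rewrite -cmod_sqr exprn_gt0 // cmod_gt0 // yn.
have := @power_relation R alpha (fun u => (y (u * s))^-1)
  (fun u => - (s%:C * y' (u * s)) / y (u * s) ^+ 2) x0%:C s%:C (expi k).
rewrite mul0r mul1r y0 invrK -rmorphD => H.
have i11 : (0 : R) <= (1 : R) <= (1 : R) by apply/andP; split; [exact: ler01|exact: lexx].
rewrite -[Im _]/(Im (y s)) -[y s]invrK; apply: stable_densityP.
  by have := Fp 1 i11; rewrite mul1r.
apply: H => //.
- by move=> u hu; apply: is_cderiveV; [exact: yn|apply: is_cderive_scale; exact/dy/us1].
move=> u hu; have h := yode _ (us1 u hu).
have e : (u * s)%:C = u%:C * s%:C by rewrite rmorphM.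
rewrite e in h; have := yn u hu; move: h.
move: (y (u * s)) (y' (u * s)) => yy yy' h Y0.
transitivity (- s%:C * (alpha%:C * yy' + (1 - alpha)%:C * ((x0%:C + u%:C * s%:C) * (yy * yy')) + yy * yy) / yy ^+ 3
     + s%:C * yy^-1).
  by field.
by rewrite h mulr0 mul0r add0r.
Qed.

Lemma stable_density_analytic (t0 : R) : 0 < t0 < pi ->
  analytic_at density (theta_x alpha rho t0) /\
  {for theta_x alpha rho t0, continuous density}.
Proof.
move=> ht; have [g [D [L [d [L0 d0 hg hd]]]]] := stable_density_pseries ht.
set x0 := theta_x alpha rho t0 in hd *.
have near_d : \forall x \near x0, `|x - x0| < d.
  by exists d => // x /=; rewrite distrC.
split.
  exists (fun n => - (pi^-1 * Im (g n))); near=> x.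
  have hx : `|x - x0| < d by near: x.
  have [h1 h2] := hd _ hx.
  have hI n : `|Im (g n)| <= D * L ^+ n by apply: le_trans (Im_le _) (hg n).
  have h3 : L * `|x - x0| < 1.
    have : 0 <= L * `|x - x0| by rewrite mulr_ge0 // ltW.
    by move: h1; rewrite -mulrA; set u := L * _ => *; lra.
  have := geometric_bound_cvg (ltW L0) hI h3 => hc.
  rewrite subrKC in h2; rewrite h2 /pseriesC /=.
  rewrite (_ : series _ = (fun N => - (pi^-1 * pseries (fun n => Im (g n)) (x - x0) N))).
    by apply: cvgN; apply: cvgM; [exact: cvg_cst|exact: hc].
  apply: funext => N; rewrite /pseries /series /= mulr_sumr -sumrN.
  by apply: eq_bigr => i _; rewrite mulrA mulNr.
have hd0 : 8 * L * `|0 : R| < 1 by rewrite normr0 mulr0.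
have [_ hI] := pseriesC_derive L0 hg hd0.
have cI : {for (0 : R), continuous (fun s => Im (pseriesC g s))}.
  apply/differentiable_continuous/derivable1_diffP.
  exact: (@ex_derive _ _ _ _ _ _ _ hI).
have E : density x0 = - (pi^-1 * Im (pseriesC g (x0 - x0))).
  have z1 : `|x0 - x0| < d by rewrite subrr normr0.
  by have [_] := hd _ z1; rewrite subrKC.
suff h : density x @[x --> x0] --> density x0 by exact: h.
rewrite E.
have : (fun x => - (pi^-1 * Im (pseriesC g (x - x0)))) @ x0 -->
    - (pi^-1 * Im (pseriesC g (x0 - x0))).
  apply: cvgN; apply: cvgM; first exact: cvg_cst.
  apply: (@continuous_comp _ _ _ (fun x => x - x0) (fun s => Im (pseriesC g s))).
    by apply: cvgB; [exact: cvg_id|exact: cvg_cst].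
  by rewrite subrr.
apply: cvg_trans; apply: near_eq_cvg; near=> x.
have hx : `|x - x0| < d by near: x.
by have [_] := hd _ hx; rewrite subrKC.
Unshelve. all: by end_near. Qed.

End analyticity.

(** * Density and support of the stable law *)

Section assembly.
Variable R : realType.
Local Notation C := R[i].
Local Notation Re := (@complex.Re R).
Local Notation Im := (@complex.Im R).
Variable alpha : R.
Hypothesis alpha01 : 0 < alpha < 1.

Lemma free_stable_axis (rho : R) (nu : probability (measurableTypeR R) R) :
  is_free_stable alpha rho nu -> axis_relation nu alpha (alpha * rho * pi).
Proof.
move=> /(_ 1 ltr01) [M M0 [Finv [_ hIm hF _] hphi]].
exists M => // y My w; have y0 : 0 < y by apply: lt_trans My.
have hy : truncated_cone 1 M (y *i) by split => //=; rewrite normr0 mul1r.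
have wE : w = Finv (y *i).
  rewrite /w /axis_curve -(subrK (y *i) (Finv _)) -hphi // cpow_iy // addrC; congr (_ + _).
  by congr (- _); ring.
rewrite wE; split; first exact: hIm.
by have h := hF _ hy; rewrite -[LHS]invrK; congr (_^-1); exact: h.
Qed.

Section density.
Variables (rho : R) (nu : probability (measurableTypeR R) R).
Hypothesis rho01 : 0 <= rho < 1.
Hypothesis hax : axis_relation nu alpha (alpha * rho * pi).
Local Notation density := (stable_density alpha rho).

Lemma stable_density_domain_analytic (x : R) : 0 < rho \/ x < stable_edge alpha ->
  analytic_at density x /\ {for x, continuous density}.
Proof.
move=> hx; have [t ht <-] := stable_density_domain alpha01 rho01 hax hx.
exact: stable_density_analytic.
Qed.

Lemma stable_density_above_edge (x : R) : rho = 0 -> stable_edge alpha <= x -> density x = 0.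
Proof.
move=> r0 hx; apply: stable_density_out => t ht hxt.
by have := theta_x_lt_edge alpha01 r0 ht; rewrite hxt ltNge hx.
Qed.

(** For rho > 0 the density is continuous everywhere. For rho = 0 continuity is known below the
    edge, so the line is cut there, the density being 0 on the other part. *)
Lemma measurable_stable_density :
  measurable_fun [set: measurableTypeR R] (density : measurableTypeR R -> R).
Proof.
have /andP[rh0 _] := rho01; move: rh0; rewrite le_eqVlt => /predU1P[r0|rp]; last first.
  apply: continuous_measurable_fun => x.
  by have [] := @stable_density_domain_analytic x (or_introl rp).
set e := stable_edge alpha.
have -> : [set: measurableTypeR R] = `]-oo, e[%classic `|` `[e, +oo[%classic.
  by rewrite -setCitvl setUv.
apply/measurable_funU => //; split.
  apply: open_continuous_measurable_fun => //.
  move=> x; rewrite inE /= in_itv /= => hx.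
  by have [] := @stable_density_domain_analytic x (or_intror hx).
have : measurable_fun (`[e, +oo[%classic : set (measurableTypeR R)) (cst 0 : measurableTypeR R -> R).
  exact: measurable_cst.
apply: eq_measurable_fun => x; rewrite inE /= in_itv /= andbT => hx.
by rewrite stable_density_above_edge.
Qed.

Lemma stable_measureE (A : set (measurableTypeR R)) : measurable A ->
  nu A = (\int[@lebesgue_measure R]_(x in A) (density x)%:E)%E.
Proof.
apply: (@stieltjes_inversion R nu (poisson_bound alpha)).
- by move=> w w0; exact: (Im_cauchy_bound alpha01 rho01 hax w0).
- exact: measurable_stable_density.
- exact: stable_density_ge0.
- by move=> x x0; exact: stable_density_cvg.
Qed.

Lemma stable_density_unique (x : R) : 0 < rho \/ x < stable_edge alpha ->
  exists2 t : R, unique (fun t : R => 0 < t < pi /\ x = theta_x alpha rho t) t &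
    density x = theta_psi alpha rho t.
Proof.
move=> hx; have [t ht tx] := stable_density_domain alpha01 rho01 hax hx.
exists t; last by rewrite -tx stable_densityE.
split => // s [hs sx]; apply: (theta_x_inj alpha01 rho01) => //.
by rewrite tx sx.
Qed.

Lemma stable_density_gt0 (x : R) : 0 < rho \/ x < stable_edge alpha -> 0 < density x.
Proof.
by move=> /stable_density_unique [t [[ht _] _] ->]; exact: theta_psi_gt0.
Qed.

End density.

Section one_sided.
Variable nu : probability (measurableTypeR R) R.
Hypothesis hax : axis_relation nu alpha (alpha * 0 * pi).
Local Notation density := (stable_density alpha 0).
Local Notation e := (stable_edge alpha).

Let rho01 : (0 : R) <= (0 : R) < 1. Proof. by rewrite lexx ltr01. Qed.

(** Above the edge the density vanishes. For x at or below it, an open interval ending at x lies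
    strictly below the edge, where the density is positive; mass 0 would make this interval
    Lebesgue-null. *)
Lemma stable_support : measure_support nu = `]-oo, e]%classic.
Proof.
apply/seteqP; split => x /=.
  rewrite in_itv /= => hx; rewrite leNgt; apply/negP => ex.
  have : (0 < nu `]e, +oo[%classic)%E.
    by apply: hx; [exact: interval_open|rewrite /= in_itv /= ex].
  rewrite (stable_measureE rho01 hax) // integral0_eq ?ltxx // => y /=.
  rewrite in_itv /= andbT => hy.
  by rewrite (stable_density_above_edge (erefl 0)) // ltW.
rewrite in_itv /= => xe U oU Ux.
have [d /= d0 hd] : nbhs x U by exact: open_nbhs_nbhs.
have hsub : `]x - d, x[%classic `<=` U.
  move=> y /=; rewrite in_itv /= => /andP[h1 h2]; apply: hd.
  by rewrite /ball /= gtr0_norm ?subr_gt0 //; lra.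
apply: (@lt_le_trans _ _ (nu `]x - d, x[%classic)); last first.
  by apply: le_measure; rewrite ?inE //; exact: open_measurable.
rewrite lt_neqAle measure_ge0 andbT; apply/eqP => h0.
have hd0 y : `]x - d, x[%classic y -> 0 < density y.
  rewrite /= in_itv /= => /andP[_ yx]; apply: (stable_density_gt0 rho01 hax).
  by right; apply: lt_le_trans xe.
have [I IE] : exists I : set (measurableTypeR R), I = `]x - d, x[%classic by exists `]x - d, x[%classic.
have mI : measurable I by rewrite IE.
have md : measurable_fun I (fun y => (density y)%:E).
  by apply: measurable_funTS; apply/measurable_EFinP; exact: (measurable_stable_density rho01 hax).
have : (\int[@lebesgue_measure R]_(y in I) `|(density y)%:E| = 0)%E.
  rewrite h0 -IE (stable_measureE rho01 hax) //; apply: eq_integral => y hy.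
  by rewrite gee0_abs // lee_fin stable_density_ge0.
move=> /(ae_eq_integral_abs _ mI md) [N [mN N0 hN]].
have : (@lebesgue_measure R I <= @lebesgue_measure R N)%E.
  apply: le_measure; rewrite ?inE // => y hy; apply: hN => /= /(_ hy) [] h.
  by move: hy; rewrite IE => /hd0; rewrite h ltxx.
rewrite N0 IE lebesgue_measure_itv /= lte_fin ltrBlDr ltrDl d0 -EFinB lee_fin.
by rewrite leNgt; apply/negP; rewrite negbK; lra.
Qed.

Lemma stable_support_interior (x : R) : (measure_support nu)^°%classic x -> x < e.
Proof.
rewrite stable_support => -[d /= d0 hd].
have /= := hd (x + d / 2) _; rewrite in_itv /= => h.
have : x + d / 2 <= e.
  apply: h; rewrite /ball /= opprD addrA subrr sub0r normrN gtr0_norm ?divr_gt0 //.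
  by rewrite ltr_pdivrMr //; lra.
lra.
Qed.

End one_sided.

End assembly.

(** * Reflection of a measure in the origin *)

Section reflection.
Variable R : realType.
Local Notation C := R[i].
Local Notation Re := (@complex.Re R).
Local Notation Im := (@complex.Im R).

Definition real_opp : measurableTypeR R -> measurableTypeR R := fun t => - t.

Lemma measurable_real_opp : measurable_fun [set: measurableTypeR R] real_opp.
Proof. by apply: (@measurable_funN _ _ R setT id); exact: measurable_id. Qed.

HB.instance Definition _ :=
  isMeasurableFun.Build _ _ (measurableTypeR R) (measurableTypeR R) real_opp measurable_real_opp.

Definition reflected (mu : probability (measurableTypeR R) R) :
  probability (measurableTypeR R) R := distribution mu real_opp.

Lemma reflectedE mu (A : set (measurableTypeR R)) :
  reflected mu A = mu (real_opp @^-1` A).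
Proof. by []. Qed.

Lemma cauchy_transform_reflected mu (w : C) : 0 < Im w ->
  cauchy_transform (reflected mu) w =
  - conjc (cauchy_transform mu (- conjc w)).
Proof.
move=> w0; have w0' : 0 < Im (- conjc w) by case: w w0 => a b /=; rewrite opprK.
have H (g : R -> R) : measurable_fun [set: measurableTypeR R] (g : measurableTypeR R -> R) ->
    (exists M, forall t, `|g t| <= M) ->
    \int[reflected mu]_t g t = \int[mu]_t g (- t).
  move=> mg [M hM]; rewrite /Rintegral; congr fine.
  rewrite [LHS](@integral_pushforward _ _ _ _ R real_opp measurable_real_opp mu setT (EFin \o g)) //.
    exact/measurable_EFinP.
  apply: (@bounded_meas_integrable R mu (g \o real_opp)).
    by apply: measurableT_comp => //; exact: measurable_real_opp.
  by exists M => t; exact: hM.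
have [m1 m2 [M hM]] := cbounded_resolvent w0.
have rE t : resolvent w (- t) = - conjc (resolvent (- conjc w) t).
  rewrite /resolvent conjc_inv -invrN; congr (_^-1).
  by case: w {w0 w0' m1 m2 hM} => a b; apply: complexP => /=; ring.
rewrite !cauchy_transformE /cint H //; last by exists M => t; apply: le_trans (Re_le _) (hM t).
rewrite H //; last by exists M => t; apply: le_trans (Im_le _) (hM t).
have hb := cbounded_resolvent w0'.
apply: complexP => /=.
  rewrite -mulN1r -RintegralZl //; last exact: cbounded_Re.
  by apply: eq_Rintegral => t _; rewrite rE mulN1r; case: (resolvent _ _).
by rewrite opprK; apply: eq_Rintegral => t _; rewrite rE; case: (resolvent _ _) => a b /=; rewrite opprK.
Qed.

(** The map w |-> - conjc w fixes the imaginary axis and replaces a phase by pi minus it; since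
    alpha pi + (1 - alpha) pi/2 = pi - (1 - alpha) pi/2, it exchanges the curves for rho = 1 and rho
    = 0. *)
Lemma axis_relation_reflected (alpha : R) (nu : probability (measurableTypeR R) R) :
  axis_relation nu alpha (alpha * 1 * pi) ->
  axis_relation (reflected nu) alpha (alpha * 0 * pi).
Proof.
move=> [M M0 hM]; exists M => // y My w.
have [h1 h2] := hM y My.
have wE : - conjc w = axis_curve alpha (expi (alpha * 1 * pi) * expi ((1 - alpha) * (pi / 2))) y.
  rewrite /w /axis_curve -!expiD mulr0 mul0r add0r.
  have -> : alpha * 1 * pi + (1 - alpha) * (pi / 2) = pi - (1 - alpha) * (pi / 2).
    by move: (pi : R) => p; field.
  rewrite /expi cosB sinB cospi sinpi.
  by apply: complexP; rewrite !cE /=; ring.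
rewrite -wE in h1 h2.
have w0 : 0 < Im w by move: h1; case: (w) => a b /=; rewrite opprK.
split => //; rewrite cauchy_transform_reflected // h2.
by apply: complexP; rewrite /= ?expr0n /= ?add0r ?mul0r ?oppr0 ?opprK.
Qed.

End reflection.
Local Close Scope complex_scope.

Theorem propositionA1p4 (R : realType) (alpha : R)
    (halpha : 0 < alpha < 1) :
  [/\ (forall (rho : R) (nu : probability (measurableTypeR R) R),
        0 < rho < 1 -> is_free_stable alpha rho nu ->
        exists psi : R -> R,
        [/\ has_density_on [set: R] psi nu,
            analytic_on [set: R] psi,
            (forall x, 0 < psi x) &
            forall x, exists2 theta : R,
              unique (fun t : R => 0 < t < pi /\
                x = sin t `^ (- alpha^-1)
                    * sin (alpha * rho * pi + (1 - alpha) * t)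
                        `^ (alpha^-1 - 1)
                    * sin (alpha * rho * pi - alpha * t)) theta &
              psi x = pi^-1 * sin theta `^ (1 + alpha^-1)
                      * sin (alpha * rho * pi + (1 - alpha) * theta)
                          `^ (- alpha^-1)]),
      (forall nu : probability (measurableTypeR R) R,
        is_free_stable alpha 0 nu ->
        measure_support nu
          = `]-oo, - (alpha * (1 - alpha) `^ (alpha^-1 - 1))]%classic
        /\ exists psi : R -> R,
        [/\ has_density_on (measure_support nu) psi nu,
            analytic_on (measure_support nu)^° psi &
            forall x, (measure_support nu)^° x -> exists2 theta : R,
              unique (fun t : R => 0 < t < pi /\
                x = - (sin t `^ (- alpha^-1)
                       * sin ((1 - alpha) * t) `^ (alpha^-1 - 1)
                       * sin (alpha * t))) theta &
              psi x = pi^-1 * sin theta `^ (1 + alpha^-1)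
                      * sin ((1 - alpha) * theta) `^ (- alpha^-1)]) &
      (forall nu0 nu1 : probability (measurableTypeR R) R,
        is_free_stable alpha 0 nu0 -> is_free_stable alpha 1 nu1 ->
        forall A : set (measurableTypeR R), measurable A ->
          nu1 A = pushforward nu0
            (fun t : measurableTypeR R => (- t : measurableTypeR R)) A)].
Proof.
have /andP[a0 a1] := halpha.
split.
- move=> rho nu /andP[r0 r1] hnu; have hax := free_stable_axis hnu.
  have rho01 : 0 <= rho < 1 by rewrite ltW.
  exists (stable_density alpha rho); split.
  + split.
    * exact: (measurable_stable_density halpha rho01 hax).
    * by move=> x _; exact: stable_density_ge0.
    * by move=> A mA; rewrite setIT; exact: (stable_measureE halpha rho01 hax).
  + by move=> x _; have [] := stable_density_domain_analytic halpha rho01 hax (x := x) (or_introl r0).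
  + by move=> x; exact: (stable_density_gt0 halpha rho01 hax (or_introl r0)).
  + move=> x; exact: (stable_density_unique halpha rho01 hax (or_introl r0)).
- move=> nu hnu; have hax := free_stable_axis hnu.
  have rho01 : (0 : R) <= (0 : R) < 1 by rewrite lexx ltr01.
  have hs := stable_support halpha hax.
  split; first exact: hs.
  exists (stable_density alpha 0); split.
  + rewrite hs; split.
    * by apply: measurable_funTS; exact: (measurable_stable_density halpha rho01 hax).
    * by move=> x _; exact: stable_density_ge0.
    * move=> A mA; rewrite (stable_measureE halpha rho01 hax mA) integral_mkcondr.
      apply: eq_integral => x _; rewrite /patch; case: ifPn => //.
      rewrite notin_setE /= in_itv /= => /negP; rewrite -ltNge => hx.
      by rewrite (stable_density_above_edge halpha) // ltW.
  + move=> x /(stable_support_interior halpha hax) xe.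
    by have [] := stable_density_domain_analytic halpha rho01 hax (or_intror xe).
  + move=> x /(stable_support_interior halpha hax) xe.
    have [t [[ht hx] hu] ->] := stable_density_unique halpha rho01 hax (or_intror xe).
    have E s : theta_x alpha 0 s = - (sin s `^ (- alpha^-1) * sin ((1 - alpha) * s)
        `^ (alpha^-1 - 1) * sin (alpha * s)).
      by rewrite /theta_x mulr0 mul0r add0r sub0r sinN mulrN.
    exists t; last by rewrite /theta_psi mulr0 mul0r add0r.
    by split; [rewrite -E|move=> s; rewrite -E; exact: hu].
- move=> nu0 nu1 h0 h1 A mA.
  have rho01 : (0 : R) <= (0 : R) < 1 by rewrite lexx ltr01.
  (* Both [nu0] and the reflection of [nu1] have the density [stable_density alpha 0], hence agree,
     and the reflection is an involution. *)
  have hax0 := free_stable_axis h0.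
  have hax1 := axis_relation_reflected (free_stable_axis h1).
  have mB : measurable (@real_opp R @^-1` A).
    by rewrite -[_ @^-1` _]setTI; exact: measurable_real_opp.
  have := stable_measureE halpha rho01 hax1 mB.
  rewrite -(stable_measureE halpha rho01 hax0 mB) reflectedE => h.
  rewrite /pushforward -[RHS]h; congr (nu1 _).
  by apply/seteqP; split => x /=; rewrite /real_opp opprK.
Qed.
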